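(* Consider i.i.d. random conductances of law $\nu$ on $[\alpha,\beta]$ on the edges of $\mathbb{Z}^d$, with homogenized matrix $A_{\mathrm{hom}}$, approximations $A_{\mu,k}$ ($\mu>0$, $k\ge1$), local drift $\mathfrak{d}$ and its spectral measure $e_{\mathfrak{d}}$ as defined in the context. For all $\xi\in\mathbb{R}^d$ with $|\xi|=1$, the following two statements hold: (1) If the spectral exponents of $\mathfrak{d}$ are at least $(\gamma,-q)$ (where $\gamma>1$, $q\ge0$), then $$0\le\xi\cdot(A_{\mu,k}-A_{\mathrm{hom}})\xi\lesssim\begin{cases}\mu^{2k}&\text{if }\gamma>2k+1,\\ \mu^{2k}\ln_+^{1+q}(\mu^{-1})&\text{if }\gamma=2k+1,\\ \mu^{\gamma-1}\ln_+^q(\mu^{-1})&\text{if }\gamma<2k+1.\end{cases}$$ (2) Conversely, $$\xi\cdot(A_{\mu,k}-A_{\mathrm{hom}})\xi\gtrsim\mu^{2k}+\mu^{-1}\int_0^\mu\mathrm{d}e_{\mathfrak{d}}(\lambda).$$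
   Context: $d\ge2$ is the dimension and $\beta\ge\alpha>0$. $\lesssim$ and $\gtrsim$ stand for $\le$ and $\ge$ up to a multiplicative constant which only depends on $d$, $\alpha$ and $\beta$ if not otherwise stated. $\ln_+(x)=\max\{\ln x,1\}$. Spectral exponents: for $\gamma>1$ and $q\ge0$, the spectral exponents of $f\in L^2(\Omega)$ are said to be at least $(\gamma,-q)$ if $\int_0^\mu\mathrm{d}e_f(\lambda)\lesssim\mu^\gamma\ln_+^q(\mu^{-1})$ (for $\mu>0$), where $e_f$ is the spectral measure defined below. Environment: $\mathbb{B}$ is the set of non-oriented nearest-neighbour edges of $\mathbb{Z}^d$, $\Omega=[\alpha,\beta]^{\mathbb{B}}$, $\nu$ is a probability measure on $[\alpha,\beta]$, $\mathbb{P}=\nu^{\otimes\mathbb{B}}$, $\langle\cdot\rangle$ is expectation under $\mathbb{P}$; $\omega_{x,y}=\omega_{y,x}=\omega_e$ for $e=(x,y)$. Shifts: $(\theta_z\omega)_{x,y}=\omega_{x+z,y+z}$. A function $f:\mathbb{Z}^d\times\Omega\to\mathbb{R}$ is stationary if $f(x+z,\omega)=f(x,\theta_z\omega)$ for all $x,z$ and almost every $\omega$. $(\mathbf{e}_1,\dots,\mathbf{e}_d)$ is the canonical basis; $A(x,\omega)=\mathrm{diag}[\omega_{x,x+\mathbf{e}_1},\dots,\omega_{x,x+\mathbf{e}_d}]$, $A(\omega)=A(0,\omega)$. $\nabla u(x)=(u(x+\mathbf{e}_i)-u(x))_{i}$ and $\nabla^*\cdot F(x)=\sum_i(F_i(x)-F_i(x-\mathbf{e}_i))$.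 Homogenized matrix: for $\xi\in\mathbb{R}^d$ there is a unique measurable $\phi:\mathbb{Z}^d\times\Omega\to\mathbb{R}$ with $\phi(0,\cdot)\equiv0$, $\nabla\phi$ stationary, $\langle\nabla\phi\rangle=0$, and $-\nabla^*\cdot A(\xi+\nabla\phi)=0$ in $\mathbb{Z}^d$ almost surely; $A_{\mathrm{hom}}$ is the symmetric matrix with $\xi\cdot A_{\mathrm{hom}}\xi=\langle(\xi+\nabla\phi)\cdot A(\xi+\nabla\phi)\rangle$. Operator and spectral measure: $\mathcal{L}u(\omega)=\sum_{z\sim0}\omega_{0,z}(u(\omega)-u(\theta_z\omega))$ on $L^2(\Omega)$ (sum over the $2d$ neighbours of $0$) is bounded, positive and self-adjoint. The local drift is $\mathfrak{d}(\omega)=\sum_{i=1}^d\xi_i(\omega_{0,\mathbf{e}_i}-\omega_{-\mathbf{e}_i,0})$. For $f\in L^2(\Omega)$, $e_f$ is the spectral measure of $\mathcal{L}$ projected on $f$: $\langle f\,\Psi(\mathcal{L})f\rangle=\int_{\mathbb{R}^+}\Psi(\lambda)\,\mathrm{d}e_f(\lambda)$ for every bounded continuous $\Psi:\mathbb{R}_+\to\mathbb{R}$. Approximations: with the polynomial $P_k(\mu,\lambda)=\lambda^{-1}\big((\mu+\lambda)^2(2\mu+\lambda)^2\cdots(2^{k-1}\mu+\lambda)^2-2^{k(k-1)}\mu^{2k}\big)$, $A_{\mu,k}$ is defined by $$\xi\cdot A_{\mu,k}\xi=\langle\xi\cdot A\xi\rangle-\int_{\mathbb{R}^+}\frac{P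_k(\mu,\lambda)}{(\mu+\lambda)^2(2\mu+\lambda)^2\cdots(2^{k-1}\mu+\lambda)^2}\,\mathrm{d}e_{\mathfrak{d}}(\lambda).$$
   Formalization: Part (2) is proved for 0<μ≤1 with a constant depending on d, α, β and a lower bound v>0 of Var(ν): for Dirac ν, or for μ large, it fails as stated. In (1) the constant also depends on γ, q and the constant in the spectral-exponent hypothesis. *)

(* Defs.v *)
From HB Require Import structures.
From mathcomp Require Import all_boot all_order all_algebra.
From mathcomp Require Import all_classical all_reals all_analysis.

Set Implicit Arguments.
Unset Strict Implicit.
Unset Printing Implicit Defensive.

Import Order.TTheory GRing.Theory Num.Theory.
Import numFieldNormedType.Exports.

Local Open Scope classical_set_scope.
Local Open Scope ring_scope.

Notation lattice d := 'cV[int]_d.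

Definition basis_vec (d : nat) (i : 'I_d) : lattice d := delta_mx i 0.

(* The pair (x, i) stands for the non-oriented edge {x, x + e_i}; every
   nearest-neighbour edge of Z^d is represented exactly once. *)
Notation edge d := (lattice d * 'I_d)%type.

Definition cylinder (R : realType) (d : nat) : set (set (edge d -> R)) :=
  [set A | exists (b : edge d) (B : set R),
             measurable B /\ A = [set w | B (w b)]].

(* Environments, with the product sigma-algebra.  The restriction to
   conductances in [alpha, beta] is carried by the law (see [iid_law]). *)
Notation env R d := (g_sigma_algebraType (@cylinder R d)).

Section Environment.
Variables (R : realType) (d : nat).
Implicit Types (w : env R d) (x z : lattice d) (xi : 'cV[R]_d).

Definition iid_law (alpha beta : R) (nu : probability R R)
    (P : probability (env R d) R) : Prop :=
  nu `[alpha, beta]%classic = 1%E /\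
  forall (s : seq (edge d)) (B : edge d -> set R),
    uniq s -> (forall b, measurable (B b)) ->
    P [set w | forall b : edge d, b \in s -> B b (w b)] =
    (\prod_(b <- s) nu (B b))%E.

Definition shift_env z w : env R d := fun b => w (b.1 + z, b.2).

Definition dot (u v : 'cV[R]_d) : R := (u^T *m v) 0 0.

Definition norm2 (u : 'cV[R]_d) : R := Num.sqrt (dot u u).

Definition quad (M : 'M[R]_d) xi : R := dot xi (M *m xi).

Definition Amx x w : 'M[R]_d := diag_mx (\row_i w (x, i)).

Definition grad (u : lattice d -> R) x : 'cV[R]_d :=
  \col_i (u (x + basis_vec i) - u x).

Definition divstar (F : lattice d -> 'cV[R]_d) x : R :=
  \sum_i (F x i 0 - F (x - basis_vec i) i 0).

(* The two terms are the neighbours e_i and -e_i of the origin. *)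
Definition genL (u : env R d -> R) : env R d -> R := fun w =>
  \sum_i (w (0, i) * (u w - u (shift_env (basis_vec i) w))
          + w (- basis_vec i, i) * (u w - u (shift_env (- basis_vec i) w))).

Definition drift xi : env R d -> R := fun w =>
  \sum_i xi i 0 * (w (0, i) - w (- basis_vec i, i)).

End Environment.

Section Homogenization.
Variables (R : realType) (d : nat) (P : probability (env R d) R).
Implicit Types (xi : 'cV[R]_d) (phi : lattice d -> env R d -> R).

Definition is_corrector xi phi : Prop :=
  let gphi x w := grad (phi^~ w) x in
  [/\ forall x, measurable_fun setT (phi x),
      forall w, phi 0 w = 0,
      forall x z, {ae P, forall w, gphi (x + z) w = gphi x (shift_env z w)},
      forall x i, P.-integrable setT (EFin \o (fun w => (gphi x w i 0)%R)) /\
                  ('E_P[fun w => (gphi x w i 0)%R] = 0)%E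
    & {ae P, forall w, forall x,
        - divstar (fun y => Amx y w *m (xi + gphi y w)) x = 0}].

(* The expectation is extended-real valued, so that the equality includes the
   finiteness of the energy of the corrector. *)
Definition is_Ahom (Ahom : 'M[R]_d) : Prop :=
  Ahom^T = Ahom /\
  forall xi, exists phi, is_corrector xi phi /\
    let v w := xi + grad (phi^~ w) 0 in
    ((quad Ahom xi)%:E = 'E_P[fun w => quad (Amx 0 w) (v w)])%E.

End Homogenization.

Section Spectral.
Variables (R : realType) (d : nat) (P : probability (env R d) R).
Implicit Types (T : (env R d -> R) -> env R d -> R) (f g : env R d -> R).

Definition poly_op T (p : {poly R}) f : env R d -> R :=
  fun w => \sum_(i < size p) p`_i * iter i T f w.

Definition op_bound T (M : R) : Prop :=
  forall u, u \in Lfun P 2%:E ->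
    ('N[P]_2%:E[EFin \o T u] <= M%:E * 'N[P]_2%:E[EFin \o u])%E.

(* Continuous functional calculus of a bounded positive self-adjoint operator:
   [g = Psi(T) f] in L^2, as the limit of [p_n(T) f] for polynomials [p_n]
   converging to [Psi] uniformly on an interval [0, M] containing the
   spectrum. *)
Definition is_funcalc T (Psi : R -> R) f g : Prop :=
  g \in Lfun P 2%:E /\
  exists (M : R) (p : nat -> {poly R}),
    [/\ op_bound T M,
        {uniform `[0, M]%classic,
           (fun n => (horner (p n) : R -> R)) @ \oo --> Psi}
      & ('N[P]_2%:E[EFin \o (poly_op T (p n) f \- g)%R] @[n --> \oo] --> 0)%E].

Definition spectral_measure f (e : {measure set R -> \bar R}) : Prop :=
  e `]-oo, 0[%classic = 0%E /\
  forall Psi : R -> R,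
    {within `[0, +oo[%classic, continuous Psi} ->
    (exists K : R, forall l : R, 0 <= l -> `|Psi l| <= K) ->
    forall g, is_funcalc (@genL R d) Psi f g ->
      ('E_P[(f \* g)%R] = \int[e]_(l in `[0%R, +oo[%classic) (Psi l)%:E)%E.

Definition lnp (x : R) : R := Num.max (ln x) 1.

(* [C0] is the implicit constant of the bound. *)
Definition spectral_exponents_ge (C0 : R) (e : {measure set R -> \bar R})
    (gamma q : R) : Prop :=
  forall mu : R, 0 < mu ->
    (e `[0%R, mu]%classic <= (C0 * (mu `^ gamma * lnp mu^-1 `^ q))%:E)%E.

Definition Dpoly (k : nat) (mu : R) : {poly R} :=
  \prod_(j < k) ((2 ^+ j * mu)%:P + 'X) ^+ 2.

(* The division is exact; [Ppoly] is thus also correct at [lambda = 0]. *)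
Definition Ppoly (k : nat) (mu : R) : {poly R} :=
  (Dpoly k mu - (2 ^+ (k * k.-1) * mu ^+ (2 * k))%:P) %/ 'X.

Definition is_Amuk (k : nat) (mu : R) (A : 'M[R]_d) : Prop :=
  A^T = A /\
  forall (xi : 'cV[R]_d) (e : {measure set R -> \bar R}),
    spectral_measure (drift xi) e ->
    ((quad A xi)%:E = 'E_P[fun w => quad (Amx 0 w) xi]
       - \int[e]_(l in `[0%R, +oo[%classic) ((Ppoly k mu).[l] / (Dpoly k mu).[l])%:E)%E.

Definition rate (k : nat) (gamma q mu : R) : R :=
  if (2 * k + 1)%:R < gamma then mu ^+ (2 * k)
  else if gamma == (2 * k + 1)%:R then
    mu ^+ (2 * k) * lnp mu^-1 `^ (1 + q)
  else mu `^ (gamma - 1) * lnp mu^-1 `^ q.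

End Spectral.

(* Main.v *)
(** Let [D_i u = u \o theta_{e_i} - u], let [V] be the corrector gradient at the
    origin and [<X, Y>_A] the expectation of [\sum_i w(0,i) X_i Y_i].  Then
    [<u, L v> = <Du, Dv>_A], [<u, drift> = <V, Du>_A] and, if [V] lies in the
    closure of the gradients [Du], [quad Ahom xi = E(xi . A xi) - <V, V>_A].
    That closure property comes from ergodicity: averaging the corrector along
    a coordinate line yields [u_n] with [D u_n] equal to [V] minus an ergodic
    average of [V], and the i.i.d. law is mixing.

    The Neumann polynomials [p_n(l) = (1 - (1 - l/M)^n) / l], applied to [L],
    solve [L u = drift] approximately, so they identify [<V, V>_A] with the
    integral of [1/l] against the spectral measure; no functional calculus
    beyond polynomials, hence no completeness of L^2, is needed.  Thus
    [quad (Amuk - Ahom) xi] is the integral of [weight k mu l / l], where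
    [weight k mu l = \prod_(j < k) (1 + l / (2^j mu))^-2].  The upper bounds
    follow by dyadic decomposition of the spectrum, the lower bound from
    [weight k mu l >= exp (- 4 l / mu)], from
    [weight k mu l >= mu^(2k) exp (- 4 l)] for [mu <= 1], and from the mass
    [E(drift^2) = 2 |xi|^2 Var(nu)] of the spectral measure. *)

Require Import Defs.
From HB Require Import structures.
From mathcomp Require Import all_boot all_order all_algebra.
From mathcomp Require Import all_classical all_reals all_analysis.
From mathcomp Require Import measurable_realfun ring lra zify.

Set Implicit Arguments.
Unset Strict Implicit.
Unset Printing Implicit Defensive.

Import Order.TTheory GRing.Theory Num.Theory.
Import numFieldNormedType.Exports HBNNSimple.

Local Open Scope classical_set_scope.
Local Open Scope ring_scope.

(** * Square-integrable functions *)

(** [spectral_measure] says something about a test function only if it is bounded and continuous and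
    has an L^2 witness in the sense of [is_funcalc]. The function [1/l] is unbounded, and [e] is not
    even assumed finite. So every test function used agrees with a polynomial on [[0, M]], where
    [M = genL_bound d beta] bounds the norm of [L]. The support of [e], its mass and, through the
    finite energy of the corrector, the absence of an atom at 0 all follow from such tests.

    An environment may be any real-valued function of the edges, so ellipticity holds only almost
    surely; hence the almost-everywhere versions of the comparison lemmas.

    The constants must not depend on the law, on [xi] or on [k]. Uniformity in [k] comes from the
    exponents [2 / 2^j], whose sum stays below 4, in the lower bound, and from the monotonicity of
    the weight in [k] in the upper bound. The lower bound needs [v], because deterministic
    conductances have zero drift, and [mu <= 1], because the error stays bounded as [mu] grows. *)

Section SquareIntegrable.
Context (dd : measure_display) (T : measurableType dd) (R : realType).
Variable P : probability T R.
Implicit Types f g h : T -> R.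

Definition itg f : Prop := P.-integrable setT (EFin \o f).

Definition Ex f : R := \int[P]_x f x.

Definition sqint f : Prop :=
  measurable_fun setT f /\ itg (fun x => f x ^+ 2).

Lemma itg_meas f : itg f -> measurable_fun setT f.
Proof. by move=> /(measurable_int P) /measurable_EFinP. Qed.

Lemma itg_le f g : measurable_fun setT f -> (forall x, `|f x| <= g x) ->
  itg g -> itg f.
Proof.
move=> mf fg; apply: le_integrable => //; first exact/measurable_EFinP.
by move=> x _ /=; rewrite lee_fin (le_trans (fg x))// ler_norm.
Qed.

Lemma itgD f g : itg f -> itg g -> itg (fun x => f x + g x).
Proof. by move=> intf intg; exact: (integrableD measurableT intf intg). Qed.

Lemma itgZ a f : itg f -> itg (fun x => a * f x).
Proof. by move=> intf; exact: (integrableZl measurableT a intf). Qed.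

Lemma itgN f : itg f -> itg (fun x => - f x).
Proof. by move=> intf; exact: (integrableN intf). Qed.

Lemma itgB f g : itg f -> itg g -> itg (fun x => f x - g x).
Proof. by move=> intf intg; apply: itgD => //; exact: itgN. Qed.

Lemma itg_cst a : itg (fun=> a).
Proof. exact: finite_measure_integrable_cst. Qed.

Lemma itg_sum (I : Type) (s : seq I) (F : I -> T -> R) :
  (forall i, itg (F i)) -> itg (fun x => \sum_(i <- s) F i x).
Proof.
move=> intF; elim: s => [|i s ih].
  by under eq_fun do rewrite big_nil; exact: itg_cst.
by under eq_fun do rewrite big_cons; exact: itgD.
Qed.

Lemma eq_Ex f g : f =1 g -> Ex f = Ex g.
Proof. by move=> /funext ->. Qed.

Lemma ExD f g : itg f -> itg g -> Ex (fun x => f x + g x) = Ex f + Ex g.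
Proof. exact: RintegralD. Qed.

Lemma ExZ a f : itg f -> Ex (fun x => a * f x) = a * Ex f.
Proof. exact: RintegralZl. Qed.

Lemma ExN f : itg f -> Ex (fun x => - f x) = - Ex f.
Proof.
move=> intf; rewrite -mulN1r -ExZ//; congr Ex.
by apply/funext => x; rewrite mulN1r.
Qed.

Lemma ExB f g : itg f -> itg g -> Ex (fun x => f x - g x) = Ex f - Ex g.
Proof. exact: RintegralB. Qed.

Lemma Ex_cst a : Ex (fun=> a) = a.
Proof. by rewrite /Ex Rintegral_cst//= probability_setT mulr1. Qed.

Lemma Ex_sum (I : Type) (s : seq I) (F : I -> T -> R) :
  (forall i, itg (F i)) ->
  Ex (fun x => \sum_(i <- s) F i x) = \sum_(i <- s) Ex (F i).
Proof.
move=> intF; elim: s => [|i s ih].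
  by under eq_fun do rewrite big_nil; rewrite big_nil Ex_cst.
under eq_fun do rewrite big_cons.
by rewrite big_cons ExD// ?ih//; exact: itg_sum.
Qed.

Lemma Ex_ge0 f : (forall x, 0 <= f x) -> 0 <= Ex f.
Proof. by move=> f0; apply: Rintegral_ge0. Qed.

Lemma Ex_le f g : itg f -> itg g -> (forall x, f x <= g x) -> Ex f <= Ex g.
Proof. by move=> intf intg fg; apply: le_Rintegral. Qed.

Lemma Ex_ae f g : measurable_fun setT f -> measurable_fun setT g ->
  {ae P, forall x, f x = g x} -> Ex f = Ex g.
Proof.
move=> mf mg fg; rewrite /Ex /Rintegral; congr fine.
apply: ae_eq_integral => //; [exact/measurable_EFinP|exact/measurable_EFinP|].
by apply: filterS fg => x /= -> _.
Qed.

Lemma itg_ae_le f g : measurable_fun setT f ->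
  {ae P, forall x, `|f x| <= g x} -> itg g -> itg f.
Proof.
move=> mf fg intg; have mg := itg_meas intg.
move/integrableP : intg => [_ gint]; apply/integrableP; split.
  exact/measurable_EFinP.
apply: le_lt_trans gint; apply: ae_ge0_le_integral => //.
- by apply: measurableT_comp => //; exact/measurable_EFinP.
- by apply: measurableT_comp => //; exact/measurable_EFinP.
- by apply: filterS fg => x /= fgx _; rewrite lee_fin (le_trans fgx)// ler_norm.
Qed.

Lemma Ex_ae_le f g : itg f -> itg g -> {ae P, forall x, f x <= g x} ->
  Ex f <= Ex g.
Proof.
move=> intf intg fg; rewrite -subr_ge0 -ExB//.
have mgf : measurable_fun setT (fun x => g x - f x).
  by apply: measurable_funB; exact: itg_meas.
rewrite (@Ex_ae _ (fun x => `|g x - f x|))//.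
- by apply: Ex_ge0 => x.
- exact: measurableT_comp.
- by apply: filterS fg => x fgx; rewrite ger0_norm// subr_ge0.
Qed.

Lemma sqint_meas f : sqint f -> measurable_fun setT f. Proof. by case. Qed.
Lemma sqint_sqr f : sqint f -> itg (fun x => f x ^+ 2). Proof. by case. Qed.

Lemma itgM f g : sqint f -> sqint g -> itg (fun x => f x * g x).
Proof.
move=> [mf f2] [mg g2]; apply: (@itg_le _ (fun x => f x ^+ 2 + g x ^+ 2)).
- exact: measurable_funM.
- move=> x; rewrite normrM -(@real_normK _ (f x))// ?num_real//.
  rewrite -(@real_normK _ (g x))// ?num_real//.
  by have := normr_ge0 (f x); have := normr_ge0 (g x); nra.
- exact: itgD.
Qed.

Lemma sqint_cst a : sqint (fun=> a).
Proof. by split => //; exact: itg_cst. Qed.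

Lemma sqint_itg f : sqint f -> itg f.
Proof.
move=> f2; have := itgM f2 (sqint_cst 1).
by congr itg; apply/funext => x; rewrite mulr1.
Qed.

Lemma sqintD f g : sqint f -> sqint g -> sqint (fun x => f x + g x).
Proof.
move=> f2 g2; split; first by apply: measurable_funD; exact: sqint_meas.
have -> : (fun x => (f x + g x) ^+ 2) =
    (fun x => (f x ^+ 2 + 2 * (f x * g x)) + g x ^+ 2).
  by apply/funext => x; ring.
apply: itgD (sqint_sqr g2); apply: itgD (sqint_sqr f2) _.
by apply: itgZ; exact: itgM.
Qed.

Lemma sqintZ a f : sqint f -> sqint (fun x => a * f x).
Proof.
move=> [mf f2]; split; first exact: measurable_funM.
by under eq_fun do rewrite exprMn; exact: itgZ.
Qed.

Lemma sqintN f : sqint f -> sqint (fun x => - f x).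
Proof. by move=> /(sqintZ (-1)); under eq_fun do rewrite mulN1r. Qed.

Lemma sqintB f g : sqint f -> sqint g -> sqint (fun x => f x - g x).
Proof. by move=> f2 g2; apply: sqintD => //; exact: sqintN. Qed.

Lemma sqint_sum (I : Type) (s : seq I) (F : I -> T -> R) :
  (forall i, sqint (F i)) -> sqint (fun x => \sum_(i <- s) F i x).
Proof.
move=> intF; elim: s => [|i s ih].
  by under eq_fun do rewrite big_nil; exact: sqint_cst.
by under eq_fun do rewrite big_cons; exact: sqintD.
Qed.

Lemma sqint_ae_le f g C : measurable_fun setT f ->
  {ae P, forall x, `|f x| <= C * `|g x|} -> sqint g -> sqint f.
Proof.
move=> mf fg [mg g2]; split => //.
apply: (@itg_ae_le _ (fun x => C ^+ 2 * g x ^+ 2)); last exact: itgZ.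
  exact: measurable_funX.
apply: filterS fg => x fgx; rewrite normrX -(@real_normK _ (g x)) ?num_real//.
by rewrite -exprMn lerXn2r// ?nnegrE// (le_trans _ fgx).
Qed.

Lemma sqint_le f g : measurable_fun setT f ->
  (forall x, `|f x| <= `|g x|) -> sqint g -> sqint f.
Proof.
move=> mf fg; apply: (@sqint_ae_le _ _ 1) => //.
by apply: aeW => x; rewrite mul1r.
Qed.

Lemma sqint_bounded_ae f C : measurable_fun setT f ->
  {ae P, forall x, `|f x| <= C} -> sqint f.
Proof.
move=> mf fC; apply: (sqint_ae_le (C := C) mf _ (sqint_cst 1)).
by apply: filterS fC => x; rewrite normr1 mulr1.
Qed.

Lemma sqintM_bounded_ae f g C : measurable_fun setT f ->
  {ae P, forall x, `|f x| <= C} -> sqint g -> sqint (fun x => f x * g x).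
Proof.
move=> mf fC g2; apply: (sqint_ae_le (C := C) _ _ g2).
  by apply: measurable_funM => //; exact: sqint_meas.
by apply: filterS fC => x fxC; rewrite normrM ler_wpM2r.
Qed.

Lemma sqint_indic (A : set T) : measurable A -> sqint (\1_A).
Proof.
move=> mA; apply: (@sqint_le _ (fun=> 1)); last exact: sqint_cst.
  exact: measurable_indic.
by move=> x; rewrite normr1 indicE; case: (_ \in _); rewrite /= ?normr0 ?normr1.
Qed.

Lemma Ex_indic (A : set T) : measurable A -> Ex (\1_A) = fine (P A).
Proof. by move=> mA; rewrite /Ex /Rintegral integral_indic// setIT. Qed.

Lemma Ex_sqr_ge0 f : 0 <= Ex (fun x => f x ^+ 2).
Proof. by apply: Ex_ge0 => x; exact: sqr_ge0. Qed.

(** The core of Cauchy-Schwarz, kept free of integrals because it serves both [Ex] and the energy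
    form [eform]. For [c > 0] the quadratic is evaluated at its minimum [t = b / c]. *)
Lemma discriminant_le (a b c : R) : 0 <= c ->
  (forall t, 0 <= a - 2 * t * b + t ^+ 2 * c) -> b ^+ 2 <= a * c.
Proof.
move=> c0 H; have [c_0|cn0] := eqVneq c 0.
  have [->|b0] := eqVneq b 0; first by rewrite c_0 mulr0 expr0n.
  (* With [c = 0] the polynomial is affine, and this [t] gives it the value -1. *)
  exfalso; have := H ((a + 1) / (2 * b)).
  rewrite c_0 mulr0 addr0 (_ : 2 * _ * b = a + 1); first lra.
  by field; rewrite b0.
have cp : 0 < c by rewrite lt_neqAle eq_sym cn0.
have := H (b / c); rewrite (_ : _ - _ + _ = a - b ^+ 2 / c); last by field.
by rewrite subr_ge0 ler_pdivrMr.
Qed.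

Lemma cauchy_schwarz_Ex f g : sqint f -> sqint g ->
  Ex (fun x => f x * g x) ^+ 2 <=
  Ex (fun x => f x ^+ 2) * Ex (fun x => g x ^+ 2).
Proof.
move=> f2 g2; apply: discriminant_le; first exact: Ex_sqr_ge0.
move=> t; have fg := itgM f2 g2.
rewrite -mulrA.
rewrite -(ExZ _ fg) -(ExZ _ (itgZ _ fg)) -ExB; [|exact: sqint_sqr|].
  rewrite -(ExZ _ (sqint_sqr g2)) -ExD.
  - by apply: Ex_ge0 => x; have := sqr_ge0 (f x - t * g x); nra.
  - by apply: itgB; [exact: sqint_sqr|apply: itgZ; exact: itgZ].
  - by apply: itgZ; exact: sqint_sqr.
by apply: itgZ; exact: itgZ.
Qed.

Lemma Ex_sqr_le f : sqint f -> Ex f ^+ 2 <= Ex (fun x => f x ^+ 2).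
Proof.
move=> f2; have := cauchy_schwarz_Ex f2 (sqint_cst 1).
under [in X in X <= _]eq_fun do rewrite mulr1.
by under [in X in _ <= _ * X]eq_fun do rewrite expr1n; rewrite Ex_cst mulr1.
Qed.

Lemma Ex_dominated_cvg (F : nat -> T -> R) f h :
  (forall n, measurable_fun setT (F n)) -> measurable_fun setT f -> itg h ->
  (forall n x, `|F n x| <= h x) -> (forall x, F ^~ x @ \oo --> f x) ->
  Ex (F n) @[n --> \oo] --> Ex f.
Proof.
move=> mF mf inth Fh Ff.
have [] := @dominated_convergence _ _ _ P setT measurableT
  (fun n => EFin \o F n) (EFin \o f) (EFin \o h).
- by move=> n; exact/measurable_EFinP.
- exact/measurable_EFinP.
- by apply: aeW => x _; apply/cvg_EFin; [exact: nearW|exact: Ff].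
- by [].
- by apply: aeW => x n _; rewrite /= lee_fin.
move=> intf _ cvgF; apply: (fine_cvg (a := Ex f)).
rewrite /Ex /Rintegral fineK//; exact: integrable_fin_num.
Qed.

Lemma L2_dominated_cvg (F : nat -> T -> R) f h :
  (forall n, measurable_fun setT (F n)) -> measurable_fun setT f -> sqint h ->
  (forall n x, `|f x - F n x| <= `|h x|) -> (forall x, F ^~ x @ \oo --> f x) ->
  Ex (fun x => (f x - F n x) ^+ 2) @[n --> \oo] --> (0 : R).
Proof.
move=> mF mf h2 Fh Ff; rewrite -[X in _ --> X](Ex_cst 0).
apply: (@Ex_dominated_cvg (fun n x => (f x - F n x) ^+ 2) _ (fun x => h x ^+ 2)) => //.
- by move=> n; apply: measurable_funX; exact: measurable_funB.
- exact: sqint_sqr.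
- move=> n x; rewrite normrX -(@real_normK _ (h x)) ?num_real//.
  by rewrite lerXn2r ?nnegrE.
- move=> x; rewrite -[X in _ --> X](_ : (f x - f x) * (f x - f x) = _).
    by under eq_fun do rewrite expr2; apply: cvgM; apply: cvgB => //; exact: cvg_cst.
  by rewrite subrr mulr0.
Qed.

(* A closed subspace of L^2 containing the indicators of a generating
   pi-system is everything: the sets whose indicator it contains form a Dynkin
   system. *)
Lemma L2_density (G : set_system T) (Q : (T -> R) -> Prop) :
  @measurable _ T = <<s G >> -> setI_closed G ->
  Q (fun=> 1) -> (forall A, G A -> Q (\1_A)) ->
  (forall a f g, sqint f -> sqint g -> Q f -> Q g ->
     Q (fun x => a * f x + g x)) ->
  (forall f (F : nat -> T -> R), sqint f ->
     (forall n, sqint (F n)) -> (forall n, Q (F n)) ->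
     Ex (fun x => (f x - F n x) ^+ 2) @[n --> \oo] --> (0 : R) -> Q f) ->
  forall f, sqint f -> Q f.
Proof.
move=> mG GI Q1 QG Qlin Qcl.
have Qext f g : f =1 g -> Q f -> Q g by move=> /funext ->.
have Q0 : Q (fun=> 0).
  have := Qlin (-1) _ _ (sqint_cst 1) (sqint_cst 1) Q1 Q1.
  by apply: Qext => x; rewrite mulr1 addNr.
have Qsum (s : seq R) (F : R -> T -> R) : (forall i, sqint (F i)) ->
    (forall i, Q (F i)) -> Q (fun x => \sum_(i <- s) i * F i x).
  move=> F2 QF; elim: s => [|i s ih]; first by under eq_fun do rewrite big_nil.
  under eq_fun do rewrite big_cons; apply: Qlin => //.
  by apply: sqint_sum => j; exact: sqintZ.
have Qset A : measurable A -> Q (\1_A).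
  rewrite mG; apply: (@dynkin_induction _ T G (fun A => Q (\1_A))) => //.
  - by rewrite indicT.
  - move=> S mS QS.
    have := Qlin (-1) _ _ (sqint_indic mS) (sqint_cst 1) QS Q1.
    apply: Qext => x; rewrite !indicE in_setC mulN1r.
    by case: (x \in S); rewrite /= ?addNr ?oppr0 ?add0r.
  - move=> F mF tF QF.
    have mU : measurable (\bigcup_k F k) by exact: bigcup_measurable.
    pose U n := \big[setU/set0]_(i < n) F i.
    have mUn n : measurable (U n) by exact: bigsetU_measurable.
    apply: (@Qcl _ (fun n => \1_(U n))) => //.
    + exact: sqint_indic.
    + by move=> n; exact: sqint_indic.
    + elim=> [|n ih]; first by rewrite /U big_ord0 indic0.
      have := Qlin 1 _ _ (sqint_indic (mUn n)) (sqint_indic (mF n)) ih (QF n).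
      apply: Qext => x; rewrite mul1r /U big_ord_recr/=.
      rewrite !indicE in_setU.
      have [xn|] /= := boolP (x \in F n); last by rewrite orbF addr0.
      rewrite orbT memNset ?add0r// -bigcup_mkord => -[k /= kn Fkx].
      have := tF k n Logic.I Logic.I.
      rewrite inE in xn => /(_ (ex_intro _ x (conj Fkx xn))) kn'.
      by rewrite kn' ltnn in kn.
    (* At every point the indicators of the partial unions are eventually constant, and 1 dominates
       the differences. *)
    + apply: (@L2_dominated_cvg _ _ (fun=> 1)) => //.
      * by move=> n; exact: measurable_indic.
      * exact: sqint_cst.
      * move=> n x; rewrite normr1 !indicE.
        by do 2 case: (_ \in _) => /=; rewrite ?subrr ?subr0 ?sub0r ?normrN ?normr0 ?normr1.
      * move=> x; have [[k _ Fkx]|nx] := pselect ((\bigcup_k F k) x).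
          apply: cvg_near_cst; exists k.+1 => // n /= kn.
          rewrite !indicE !mem_set//; first by exists k.
          by rewrite /U -bigcup_mkord; exists k.
        apply: cvg_near_cst; apply: nearW => n.
        rewrite !indicE !memNset// /U -bigcup_mkord => -[k _ Fkx].
        by apply: nx; exists k.
(* From sets the property passes to simple functions by linearity, to nonnegative functions by
   approximation from below, and to all functions by splitting into positive and negative parts. *)
have Qnn (f : {nnsfun T >-> R}) : Q f.
  have -> : (f : T -> R) =
      (fun x => \sum_(r <- finmap.enum_fset (fset_set (range f))) r * \1_(f @^-1` [set r]) x).
    by apply/funext => x; rewrite fimfunE fsbig_finite.
  by apply: Qsum => i; [exact: sqint_indic|exact: Qset].
have Qpos f : (forall x, 0 <= f x) -> sqint f -> Q f.
  move=> f0 f2; have mf : measurable_fun setT (EFin \o f).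
    by apply/measurable_EFinP; exact: sqint_meas.
  pose a n : {nnsfun T >-> R} := nnsfun_approx measurableT mf n.
  have af n x : 0 <= a n x <= f x.
    rewrite fun_ge0 /= -lee_fin /a nnsfun_approxE.
    by apply: le_approx => // y _; rewrite /= lee_fin.
  have a2 n : sqint (a n).
    apply: sqint_le f2 => // x.
    by have /andP[a0 ax] := af n x; rewrite !ger0_norm.
  apply: (@Qcl _ (fun n => a n : T -> R)) => //.
  apply: (@L2_dominated_cvg _ _ f) => //; first exact: sqint_meas.
    move=> n x; have /andP[a0 ax] := af n x.
    by rewrite !ger0_norm ?subr_ge0// lerBlDr lerDl.
  move=> x; have := cvg_nnsfun_approx measurableT mf (fun x _ => f0 x) (Logic.I : setT x).
  by move/fine_cvg.
move=> f f2; pose fp x := Num.max (f x) 0; pose fn x := Num.max (- f x) 0.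
have fp2 : sqint fp.
  apply: (sqint_le _ _ f2) => [|x].
    by apply: measurable_maxr => //; exact: sqint_meas.
  by rewrite /fp; case: (leP (f x) 0); rewrite ?normr0.
have fn2 : sqint fn.
  apply: (sqint_le _ _ f2) => [|x].
    by apply: measurable_maxr => //; apply: measurableT_comp => //; exact: sqint_meas.
  by rewrite /fn; case: (leP (- f x) 0); rewrite ?normr0// normrN.
have -> : f = (fun x => -1 * fn x + fp x).
  apply/funext => x; rewrite /fn /fp.
  by case: (leP (f x) 0); case: (leP (- f x) 0); lra.
by apply: Qlin => //; apply: Qpos => // x; rewrite le_max lexx orbT.
Qed.

End SquareIntegrable.

(** * Extension of bilinear limits from pi-systems *)

Section MeasurePreserving.
Context (d1 d2 : measure_display) (T1 : measurableType d1)
  (T2 : measurableType d2) (R : realType).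
Variables (P1 : probability T1 R) (P2 : probability T2 R) (phi : T1 -> T2).
Hypothesis mphi : measurable_fun setT phi.
Hypothesis phiP : forall A, measurable A -> P1 (phi @^-1` A) = P2 A.

Let X : {mfun T1 >-> T2} := HB.pack phi (isMeasurableFun.Build _ _ _ _ phi mphi).

Lemma preserving_itg f : itg P2 f -> itg P1 (fun x => f (phi x)).
Proof.
move=> /[dup] /itg_meas mf /integrableP[_ intf]; apply/integrableP; split.
  by apply/measurable_EFinP; exact: measurableT_comp.
apply: le_lt_trans intf.
have fm : measurable_fun setT (fun y => `|(f y)%:E|%E).
  by apply: measurableT_comp => //; exact/measurable_EFinP.
have E := ge0_integral_distribution X fm (fun y => abse_ge0 _).
rewrite -[leLHS]E le_eqVlt; apply/orP; left; apply/eqP.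
by apply: eq_measure_integral => A mA _; exact: phiP.
Qed.

Lemma preserving_Ex f : itg P2 f -> Ex P1 (fun x => f (phi x)) = Ex P2 f.
Proof.
move=> intf; have mf := itg_meas intf.
have intX := preserving_itg intf.
rewrite /Ex /Rintegral; congr fine.
have fm : measurable_fun setT (EFin \o f) by exact/measurable_EFinP.
rewrite -[LHS](@integral_distribution _ _ _ _ _ P1 X _ fm intX).
by apply: eq_measure_integral => A mA _; exact: phiP.
Qed.

Lemma preserving_sqint f : sqint P2 f -> sqint P1 (fun x => f (phi x)).
Proof.
move=> [mf f2]; split; first exact: measurableT_comp.
exact: (preserving_itg f2).
Qed.

Lemma preserving_ae (Q : T2 -> Prop) :
  {ae P2, forall y, Q y} -> {ae P1, forall x, Q (phi x)}.
Proof.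
move=> [N [mN N0 QN]]; exists (phi @^-1` N); split.
- by rewrite -[X in measurable X]setTI; exact: mphi.
- by rewrite -N0; exact: phiP.
- by move=> x /= nQ; apply: QN.
Qed.

End MeasurePreserving.

(** The error [w m] is uniform in [n], so one first fixes [m] with a small error and then lets [n]
    grow. *)
Lemma cvg0_closure (R : realType) (u w : nat -> R) (v : nat -> nat -> R) :
  (forall n m, (u n - v m n) ^+ 2 <= w m) -> w @ \oo --> (0 : R) ->
  (forall m, v m @ \oo --> (0 : R)) -> u @ \oo --> (0 : R).
Proof.
move=> uv w0 v0; apply/cvgrPdist_lt => /= e e0.
have e2 : 0 < (e / 2) ^+ 2 by rewrite exprn_gt0// divr_gt0.
have /cvgrPdist_lt/(_ _ e2) := w0 => -[M _ /(_ M (leqnn M))].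
rewrite /= sub0r normrN => wM.
have /cvgrPdist_lt/(_ (e / 2)) := v0 M.
rewrite divr_gt0// => /(_ isT); apply: filterS => n /=.
rewrite !sub0r !normrN => vn.
have : `|u n - v M n| < e / 2.
  rewrite -(@ltr_pXn2r _ 2)// ?nnegrE ?divr_ge0 ?ltW//.
  rewrite real_normK ?num_real//; apply: le_lt_trans (uv n M) _.
  exact: le_lt_trans (ler_norm _) wM.
have := ler_normD (u n - v M n) (v M n); rewrite subrK; lra.
Qed.

Lemma cvg0_sqr (R : realType) (u w : nat -> R) :
  (forall n, u n ^+ 2 <= w n) -> w @ \oo --> (0 : R) -> u @ \oo --> (0 : R).
Proof.
move=> uw w0; apply/cvgrPdist_lt => /= eps eps0.
have /cvgrPdist_lt/(_ _ (exprn_gt0 2 eps0)) := w0.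
apply: filterS => n /=; rewrite !sub0r !normrN => wn.
rewrite -(@ltr_pXn2r _ 2)// ?nnegrE ?ltW// real_normK ?num_real//.
exact: le_lt_trans (uw n) (le_lt_trans (ler_norm _) wn).
Qed.

Section BilinearExtension.
Context (d1 d2 : measure_display) (T1 : measurableType d1)
  (T2 : measurableType d2) (R : realType).
Variables (P1 : probability T1 R) (P2 : probability T2 R).
Variables (G1 : set_system T1) (G2 : set_system T2).
Hypothesis mG1 : @measurable _ T1 = <<s G1 >>.
Hypothesis mG2 : @measurable _ T2 = <<s G2 >>.
Hypothesis G1I : setI_closed G1.
Hypothesis G2I : setI_closed G2.
Hypothesis G1T : G1 setT.
Hypothesis G2T : G2 setT.

Variables (c : nat -> (T1 -> R) -> (T2 -> R) -> R) (K : R).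
Hypothesis c_linl : forall n a f f' g,
  sqint P1 f -> sqint P1 f' -> sqint P2 g ->
  c n (fun x => a * f x + f' x) g = a * c n f g + c n f' g.
Hypothesis c_linr : forall n a f g g',
  sqint P1 f -> sqint P2 g -> sqint P2 g' ->
  c n f (fun x => a * g x + g' x) = a * c n f g + c n f g'.
Hypothesis c_bound : forall n f g, sqint P1 f -> sqint P2 g ->
  c n f g ^+ 2 <= K * (Ex P1 (fun x => f x ^+ 2) * Ex P2 (fun x => g x ^+ 2)).
Hypothesis c_gen : forall A B, G1 A -> G2 B ->
  c n (\1_A) (\1_B) @[n --> \oo] --> (0 : R).

(** As [c_bound] is uniform in [n], for one fixed argument the functions at which the forms tend to
    0 make up a closed subspace. [L2_density] thus applies twice: in the second argument with the
    first an indicator from [G1], then in the first. *)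
Lemma bilinear_extension_cvg0 f g : sqint P1 f -> sqint P2 g ->
  c n f g @[n --> \oo] --> (0 : R).
Proof.
have lin (u v : nat -> R) a : u @ \oo --> (0 : R) -> v @ \oo --> (0 : R) ->
    a * u n + v n @[n --> \oo] --> (0 : R).
  move=> u0 v0; have := cvgD (cvgM (cvg_cst a) u0) v0.
  by rewrite mulr0 addr0; apply.
have step2 A h : G1 A -> sqint P2 h -> c n (\1_A) h @[n --> \oo] --> (0 : R).
  move=> GA; have A2 : sqint P1 (\1_A).
    by apply: sqint_indic; rewrite mG1; exact: sub_sigma_algebra.
  move: h; apply: (@L2_density _ _ _ P2 _ _ mG2 G2I) => //.
  - by have := c_gen GA G2T; rewrite indicT.
  - by move=> B GB; exact: c_gen.
  - by move=> a u v u2 v2 cu cv; under eq_fun do rewrite c_linr//; exact: lin.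
  - move=> u U u2 U2 cU uU.
    apply: (@cvg0_closure _ _ (fun m => K * (Ex P1 (fun x => (\1_A x) ^+ 2)
      * Ex P2 (fun x => (u x - U m x) ^+ 2))) (fun m n => c n (\1_A) (U m))).
    + move=> n m; have -> : c n (\1_A) u - c n (\1_A) (U m) =
          c n (\1_A) (fun x => u x - U m x).
        rewrite -[X in _ = c _ _ X](_ : (fun x => -1 * U m x + u x) = _).
          by rewrite c_linr// mulN1r addrC.
        by apply/funext => x; rewrite mulN1r addrC.
      by apply: c_bound => //; exact: sqintB.
    + rewrite -[X in _ --> X](_ : K * (Ex P1 (fun x => (\1_A x) ^+ 2) * 0) = _).
        by apply: cvgM; [exact: cvg_cst|apply: cvgM => //; exact: cvg_cst].
      by rewrite !mulr0.
    + exact: cU.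
move=> f2 g2; move: f f2; apply: (@L2_density _ _ _ P1 _ _ mG1 G1I) => //.
- by have := step2 _ _ G1T g2; rewrite indicT.
- by move=> B GB; exact: step2.
- by move=> a u v u2 v2 cu cv; under eq_fun do rewrite c_linl//; exact: lin.
- move=> u U u2 U2 cU uU.
  apply: (@cvg0_closure _ _ (fun m => K * (Ex P1 (fun x => (u x - U m x) ^+ 2)
    * Ex P2 (fun x => g x ^+ 2))) (fun m n => c n (U m) g)).
  + move=> n m; have -> : c n u g - c n (U m) g =
        c n (fun x => u x - U m x) g.
      rewrite -[X in _ = c _ X _](_ : (fun x => -1 * U m x + u x) = _).
        by rewrite c_linl// mulN1r addrC.
      by apply/funext => x; rewrite mulN1r addrC.
    by apply: c_bound => //; exact: sqintB.
  + rewrite -[X in _ --> X](_ : K * (0 * Ex P2 (fun x => g x ^+ 2)) = _).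
      by apply: cvgM; [exact: cvg_cst|apply: cvgM => //; exact: cvg_cst].
    by rewrite mul0r mulr0.
  + exact: cU.
Qed.

End BilinearExtension.

(** * Shift invariance and mixing of the i.i.d. law *)

Section Rectangles.
Variables (R : realType) (d : nat).

(** Repetitions are allowed in [s], so that intersections are handled by concatenation; [undup]
    restores the distinct edges that [iid_law] asks for. *)
Definition rect (s : seq (edge d)) (B : edge d -> set R) : set (env R d) :=
  [set w | forall b, b \in s -> B b (w b)].

Definition rects : set_system (env R d) :=
  [set A | exists s B, (forall b, measurable (B b)) /\ A = rect s B].

Lemma measurable_env_coord (b : edge d) :
  measurable_fun setT (fun w : env R d => w b).
Proof.
move=> _ B mB; rewrite setTI; apply: sub_sigma_algebra.
by exists b, B.
Qed.

Lemma measurable_shift_env (z : lattice d) :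
  measurable_fun setT (@shift_env R d z).
Proof.
apply: (@measurability _ _ (env R d) (env R d) setT (shift_env z) (@cylinder R d)) => //.
move=> _ [_ [b [B [mB ->]] <-]]; rewrite setTI; apply: sub_sigma_algebra.
by exists (b.1 + z, b.2), B; split.
Qed.

Lemma measurable_rect s B : (forall b, measurable (B b)) ->
  measurable (rect s B).
Proof.
move=> mB; elim: s => [|b s ih].
  by rewrite (_ : rect _ _ = setT)//; apply/seteqP; split.
rewrite (_ : rect _ _ = ((fun w : env R d => w b) @^-1` B b) `&` rect s B).
  apply: measurableI => //; rewrite -[X in measurable X]setTI.
  exact: measurable_env_coord.
apply/seteqP; split=> w /=.
  move=> wB; split; first by apply: wB; rewrite mem_head.
  by move=> b' b's; apply: wB; rewrite in_cons b's orbT.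
by move=> [wb ws] b'; rewrite in_cons => /predU1P[->//|]; exact: ws.
Qed.

Lemma measurable_env_rects : @measurable _ (env R d) = <<s rects >>.
Proof.
apply/seteqP; split; last first.
  apply: smallest_sub; first exact: sigma_algebra_measurable.
  by move=> _ [s [B [mB ->]]]; exact: measurable_rect.
apply: smallest_sub; first exact: smallest_sigma_algebra.
move=> _ [b [B [mB ->]]]; apply: sub_sigma_algebra.
exists [:: b], (fun=> B); split=> //; apply/seteqP; split=> w /=.
  by move=> wB b'; rewrite inE => /eqP ->.
by apply; rewrite mem_head.
Qed.

Lemma rects_setT : rects setT.
Proof. by exists [::], (fun=> setT); split=> //; apply/seteqP; split. Qed.

Lemma rects_setI : setI_closed rects.
Proof.
move=> _ _ [s1 [B1 [mB1 ->]]] [s2 [B2 [mB2 ->]]].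
exists (s1 ++ s2), (fun b => (if b \in s1 then B1 b else setT) `&`
                             (if b \in s2 then B2 b else setT)); split.
  by move=> b; apply: measurableI; case: ifP.
apply/seteqP; split=> w /=.
  move=> [w1 w2] b _; split; case: ifPn => // bs; [exact: w1|exact: w2].
move=> H; split=> b bs; have := H b; rewrite mem_cat bs ?orbT => /(_ isT).
  by case.
by case.
Qed.

Lemma rect_undup s B : rect s B = rect (undup s) B.
Proof. by apply/seteqP; split=> w /= H b bs; apply: H; move: bs; rewrite mem_undup. Qed.

Definition shift_edge (z : lattice d) (b : edge d) : edge d := (b.1 + z, b.2).

Lemma shift_edgeK z : cancel (shift_edge z) (shift_edge (- z)).
Proof. by move=> [x i]; rewrite /shift_edge/= addrK. Qed.

Lemma shift_preimage_rect z s B : shift_env z @^-1` rect s B =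
  rect [seq shift_edge z b | b <- s] (fun b => B (shift_edge (- z) b)).
Proof.
apply/seteqP; split=> w /=.
  by move=> H _ /mapP[b bs ->]; rewrite shift_edgeK; exact: H.
move=> H b bs; have := H (shift_edge z b); rewrite shift_edgeK.
by apply; exact: map_f.
Qed.

Lemma shift_env_comp (z z' : lattice d) (w : env R d) :
  shift_env z (shift_env z' w) = shift_env (z + z') w.
Proof. by apply/funext => b; rewrite /shift_env/= addrA. Qed.

Lemma shift_env0 (w : env R d) : shift_env 0 w = w.
Proof. by apply/funext => -[x i]; rewrite /shift_env/= addr0. Qed.

End Rectangles.

Section Independence.
Variables (R : realType) (d : nat) (alpha beta : R) (nu : probability R R)
  (P : probability (env R d) R).
Hypothesis iid : iid_law alpha beta nu P.

Lemma iid_rect s B : (forall b, measurable (B b)) ->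
  P (rect s B) = (\prod_(b <- undup s) nu (B b))%E.
Proof. by move=> mB; rewrite rect_undup; apply: iid.2 => //; exact: undup_uniq. Qed.

(** Over disjoint lists of edges the two constraints merge into one rectangle over [s1 ++ s2], whose
    product probability splits. *)
Lemma iid_rectI s1 s2 B1 B2 :
  (forall b, measurable (B1 b)) -> (forall b, measurable (B2 b)) ->
  ~~ has (mem s1) s2 ->
  P (rect s1 B1 `&` rect s2 B2) = (P (rect s1 B1) * P (rect s2 B2))%E.
Proof.
move=> mB1 mB2; rewrite (rect_undup s1) (rect_undup s2) => s12.
have {}s12 : ~~ has (mem (undup s1)) (undup s2).
  apply: contra s12 => /hasP[x]; rewrite /= !mem_undup => x2 x1.
  by apply/hasP; exists x.
move: (undup_uniq s1) (undup_uniq s2) s12.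
move: (undup s1) (undup s2) => {}s1 {}s2 u1 u2 s12.
have n12 b : b \in s2 -> b \in s1 = false.
  move=> b2; apply/negP => b1; move/negP : s12; apply.
  by apply/hasP; exists b.
rewrite (_ : _ `&` _ = rect (s1 ++ s2) (fun b => if b \in s1 then B1 b else B2 b)).
  rewrite [LHS](iid.2 (s1 ++ s2)); last 2 first.
  - by rewrite cat_uniq u1 u2 s12.
  - by move=> b; case: ifP.
  rewrite big_cat/= [P (rect s1 B1)](iid.2 s1)// [P (rect s2 B2)](iid.2 s2)//.
  congr (_ * _)%E.
    by apply: eq_big_seq => b ->.
  by apply: eq_big_seq => b /n12 ->.
apply/seteqP; split=> w /=.
  move=> [w1 w2] b; rewrite mem_cat; case: ifPn => [b1 _|_ /= b2].
    exact: w1.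
  exact: w2.
move=> H; split=> b bs; have := H b; rewrite mem_cat bs ?orbT => /(_ isT)//.
by rewrite (n12 _ bs).
Qed.

(** A shift permutes the edges and every edge carries the same [nu], so the law and its image agree
    on the pi-system of rectangles, hence everywhere. *)
Lemma iid_shift_invariant z A : measurable A -> P (shift_env z @^-1` A) = P A.
Proof.
move=> mA.
pose X : {mfun env R d >-> env R d} := HB.pack (@shift_env R d z)
  (isMeasurableFun.Build _ _ _ _ _ (@measurable_shift_env R d z)).
apply: (measure_unique _ (fun=> setT) (@measurable_env_rects R d)
  (@rects_setI R d) _ _ (distribution P X) P) => //.
- by move=> _; exact: rects_setT.
- by rewrite bigcup_const.
- move=> _ [s [B [mB ->]]]; rewrite (rect_undup s).
  change (P (shift_env z @^-1` rect (undup s) B) = P (rect (undup s) B)).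
  rewrite shift_preimage_rect [LHS]iid.2; last 2 first.
  - by rewrite map_inj_uniq ?undup_uniq//; exact: can_inj (@shift_edgeK d z).
  - by move=> b; exact: mB.
  rewrite [RHS]iid.2 ?undup_uniq// big_map.
  by apply: eq_bigr => b _; rewrite shift_edgeK.
- by move=> _; rewrite [ltLHS](probability_setT P) ltry.
Qed.

Lemma iid_coord b A : measurable A -> P ((fun w : env R d => w b) @^-1` A) = nu A.
Proof.
move=> mA; rewrite (_ : _ @^-1` _ = rect [:: b] (fun=> A)).
  by rewrite iid_rect// big_seq1.
apply/seteqP; split=> w /=; first by move=> wA b'; rewrite inE => /eqP ->.
by apply; rewrite mem_head.
Qed.

Lemma iid_ae_bounded b : {ae P, forall w : env R d, alpha <= w b <= beta}.
Proof.
apply: (preserving_ae (@measurable_env_coord R d b) (@iid_coord b)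
  (Q := fun x => alpha <= x <= beta)).
exists (~` `[alpha, beta]%classic); split.
- exact: measurableC.
- by rewrite probability_setC// iid.1 subee.
- by move=> x; rewrite /= in_itv.
Qed.

Lemma shift_itg z f : itg P f -> itg P (fun w => f (shift_env z w)).
Proof.
exact: (preserving_itg (@measurable_shift_env R d z) (@iid_shift_invariant z)).
Qed.

Lemma shift_sqint z f : sqint P f -> sqint P (fun w => f (shift_env z w)).
Proof.
exact: (preserving_sqint (@measurable_shift_env R d z) (@iid_shift_invariant z)).
Qed.

Lemma shift_Ex z f : itg P f -> Ex P (fun w => f (shift_env z w)) = Ex P f.
Proof.
exact: (preserving_Ex (@measurable_shift_env R d z) (@iid_shift_invariant z)).
Qed.

Lemma shift_ae z (Q : env R d -> Prop) :
  {ae P, forall w, Q w} -> {ae P, forall w, Q (shift_env z w)}.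
Proof.
exact: (preserving_ae (@measurable_shift_env R d z) (@iid_shift_invariant z)).
Qed.

Lemma Ex_sqr_shift z f : sqint P f ->
  Ex P (fun w => f (shift_env z w) ^+ 2) = Ex P (fun w => f w ^+ 2).
Proof. by move=> [_ f2]; rewrite -(shift_Ex z f2). Qed.

Lemma sqr_sub_le (x y a b : R) : x ^+ 2 <= a -> y ^+ 2 <= b ->
  (x - y) ^+ 2 <= 2 * a + 2 * b.
Proof. by move=> xa yb; have := sqr_ge0 (x + y); lra. Qed.

(** The covariance is treated as a sequence of forms constant in [n], for which tending to 0 means
    being 0. On indicators it vanishes by the product formula for two distinct edges. *)
Lemma iid_coord_indep b b' f g : b != b' -> sqint nu f -> sqint nu g ->
  Ex P (fun w => f (w b) * g (w b')) = Ex nu f * Ex nu g.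
Proof.
move=> bb' f2 g2.
have co c h : sqint nu h -> sqint P (fun w => h (w c)).
  exact: (preserving_sqint (@measurable_env_coord R d c) (@iid_coord c)).
have coE c h : itg nu h -> Ex P (fun w => h (w c)) = Ex nu h.
  exact: (preserving_Ex (@measurable_env_coord R d c) (@iid_coord c)).
have mE : @measurable _ R = <<s @measurable _ R >>.
  by rewrite sigma_algebra_id//; exact: sigma_algebra_measurable.
apply/subr0_eq.
pose c (n : nat) (f g : R -> R) :=
  Ex P (fun w => f (w b) * g (w b')) - Ex nu f * Ex nu g.
have : c n f g @[n --> \oo] --> (0 : R); last first.
  by move=> /cvg_lim <-//; rewrite lim_cst.
(* The constant 4 comes from [(x - y)^2 <= 2 x^2 + 2 y^2], both squares being bounded by the same
   product of second moments. *)
apply: (@bilinear_extension_cvg0 _ _ _ _ _ nu nu _ _ mE mE _ _ _ _ c 4) => //.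
- exact: measurableI.
- exact: measurableI.
- move=> n a u u' v u2 u2' v2; rewrite /c.
  under [X in Ex P X]eq_fun do rewrite mulrDl -mulrA.
  rewrite ExD; [|by apply: itgZ; apply: itgM; exact: co|by apply: itgM; exact: co].
  rewrite ExZ; last by apply: itgM; exact: co.
  rewrite ExD; [|by apply: itgZ; exact: sqint_itg|exact: sqint_itg].
  by rewrite ExZ; [ring|exact: sqint_itg].
- move=> n a u v v' u2 v2 v2'; rewrite /c.
  under [X in Ex P X]eq_fun do rewrite mulrDr mulrCA.
  rewrite ExD; [|by apply: itgZ; apply: itgM; exact: co|by apply: itgM; exact: co].
  rewrite ExZ; last by apply: itgM; exact: co.
  rewrite ExD; [|by apply: itgZ; exact: sqint_itg|exact: sqint_itg].
  by rewrite ExZ; [ring|exact: sqint_itg].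
- move=> n u v u2 v2; rewrite /c.
  set F := Ex nu (fun x => u x ^+ 2); set G := Ex nu (fun x => v x ^+ 2).
  rewrite (_ : 4 * _ = 2 * (F * G) + 2 * (F * G)); last by ring.
  apply: sqr_sub_le.
    have := cauchy_schwarz_Ex (co b _ u2) (co b' _ v2).
    by rewrite (coE b (fun x => u x ^+ 2) u2.2) (coE b' (fun x => v x ^+ 2) v2.2).
  by rewrite exprMn ler_pM ?sqr_ge0//; exact: Ex_sqr_le.
- move=> A B mA mB; rewrite /c; apply: cvg_near_cst; apply: nearW => n.
  have mr (b0 : edge d) : measurable (if b0 == b then A else B) by case: ifP.
  have -> : (fun w : env R d => \1_A (w b) * \1_B (w b')) =
      \1_(rect [:: b; b'] (fun b0 => if b0 == b then A else B)) :> (_ -> R).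
    apply/funext => w; rewrite !indicE -natrM mulnb; congr (nat_of_bool _)%:R.
    apply/andP/idP => [[/set_mem wA /set_mem wB]|/set_mem H].
      apply/mem_set => b0; rewrite !inE => /orP[/eqP->|/eqP->].
        by rewrite eqxx.
      by rewrite eq_sym (negbTE bb').
    split; apply/mem_set.
      by have := H b; rewrite eqxx mem_head; exact.
    by have := H b'; rewrite eq_sym (negbTE bb') !inE eqxx orbT; exact.
  rewrite !Ex_indic//; last exact: measurable_rect.
  rewrite (iid.2 [:: b; b'])//= ?inE ?bb'//.
  rewrite big_cons big_seq1 eqxx eq_sym (negbTE bb') fineM ?subrr//;
    exact: fin_num_measure.
Qed.

Section Mixing.
Variable i0 : 'I_d.

Definition line_shift (n : nat) : lattice d := basis_vec i0 *+ n.

Lemma line_shift_rect_disjoint (s1 s2 : seq (edge d)) : exists N, forall n,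
  (N <= n)%N -> ~~ has (mem s1) [seq shift_edge (line_shift n) b | b <- s2].
Proof.
(* [K] bounds the [i0]-coordinate of all edges involved, so a translation by [n > 2 K] moves those
   of [s2] beyond those of [s1]. *)
pose K := (\sum_(b <- s1 ++ s2) `|(b.1 i0 0)%R|)%N.
have KP b : b \in s1 ++ s2 -> (`|(b.1 i0 0)%R| <= K)%N.
  by move=> bs; rewrite /K (big_rem b)//= leq_addr.
exists (K + K).+1 => n nK; apply/hasPn => _ /mapP[b b2 ->] /=.
apply/negP => b1.
have := KP b; rewrite mem_cat b2 orbT => /(_ isT) H2.
have := KP (shift_edge (line_shift n) b); rewrite mem_cat b1 => /(_ isT) /=.
rewrite !mxE /line_shift mulmxnE /basis_vec !mxE !eqxx/=.
move: H2 nK; move: (b.1 i0 0) => x; lia.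
Qed.

(** Distant rectangles depend on disjoint sets of edges, so the covariance of their indicators is
    exactly 0 once [n] is large. The bilinear extension carries this over to square-integrable
    functions. *)
Lemma mixing f g : sqint P f -> sqint P g ->
  Ex P (fun w => f w * g (shift_env (line_shift n) w)) @[n --> \oo] -->
  Ex P f * Ex P g.
Proof.
move=> f2 g2.
pose c (n : nat) (f g : env R d -> R) :=
  Ex P (fun w => f w * g (shift_env (line_shift n) w)) - Ex P f * Ex P g.
suff H : c n f g @[n --> \oo] --> (0 : R) by apply/subr_cvg0.
have co n h : sqint P h -> sqint P (fun w => h (shift_env (line_shift n) w)).
  exact: shift_sqint.
apply: (@bilinear_extension_cvg0 _ _ _ _ _ P P _ _
  (@measurable_env_rects R d) (@measurable_env_rects R d) _ _ _ _ c 4) => //.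
- exact: rects_setI.
- exact: rects_setI.
- exact: rects_setT.
- exact: rects_setT.
- move=> n a u u' v u2 u2' v2; rewrite /c.
  under [X in Ex P X - _]eq_fun do rewrite mulrDl -mulrA.
  rewrite ExD; [|by apply: itgZ; apply: itgM => //; exact: co
                |by apply: itgM => //; exact: co].
  rewrite ExZ; last by apply: itgM => //; exact: co.
  rewrite ExD; [|by apply: itgZ; exact: sqint_itg|exact: sqint_itg].
  by rewrite ExZ; [ring|exact: sqint_itg].
- move=> n a u v v' u2 v2 v2'; rewrite /c.
  under [X in Ex P X - _]eq_fun do rewrite mulrDr mulrCA.
  rewrite ExD; [|by apply: itgZ; apply: itgM => //; exact: co
                |by apply: itgM => //; exact: co].
  rewrite ExZ; last by apply: itgM => //; exact: co.
  rewrite ExD; [|by apply: itgZ; exact: sqint_itg|exact: sqint_itg].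
  by rewrite ExZ; [ring|exact: sqint_itg].
- move=> n u v u2 v2; rewrite /c.
  set F := Ex P (fun x => u x ^+ 2); set G := Ex P (fun x => v x ^+ 2).
  rewrite (_ : 4 * _ = 2 * (F * G) + 2 * (F * G)); last by ring.
  apply: sqr_sub_le.
    have := cauchy_schwarz_Ex u2 (co n _ v2).
    by rewrite Ex_sqr_shift.
  by rewrite exprMn ler_pM ?sqr_ge0//; exact: Ex_sqr_le.
- move=> _ _ [s1 [B1 [mB1 ->]]] [s2 [B2 [mB2 ->]]].
  have [N HN] := line_shift_rect_disjoint s1 s2.
  apply: cvg_near_cst; exists N => // n /= Nn; rewrite /c.
  set z := line_shift n.
  have m1 := measurable_rect s1 mB1; have m2 := measurable_rect s2 mB2.
  have -> : (fun w : env R d => \1_(rect s1 B1) w * \1_(rect s2 B2) (shift_env z w)) =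
      \1_(rect s1 B1 `&` (shift_env z @^-1` rect s2 B2)) :> (_ -> R).
    apply/funext => w; rewrite !indicE -natrM mulnb in_setI; congr (nat_of_bool _)%:R.
  rewrite !Ex_indic//.
    rewrite {1}shift_preimage_rect iid_rectI//; last exact: HN.
    rewrite -shift_preimage_rect iid_shift_invariant// fineM ?subrr//;
      exact: fin_num_measure.
  apply: measurableI => //; rewrite -[X in measurable X]setTI.
  exact: measurable_shift_env.
Qed.

Definition line_avg f (n : nat) (w : env R d) : R :=
  n.+1%:R^-1 * \sum_(j < n.+1) f (shift_env (line_shift j) w).

Lemma sqint_line_avg f n : sqint P f -> sqint P (line_avg f n).
Proof.
by move=> f2; apply: sqintZ; apply: sqint_sum => j; exact: shift_sqint.
Qed.

(** Expanding the square bounds the second moment of an [n]-term sum by [2 n] times the sum of the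
    first [n] correlations in absolute value. Divided by [n^2], this is twice a Cesaro mean of a
    sequence that tends to 0 by mixing. *)
Lemma mean_ergodic f : sqint P f -> Ex P f = 0 ->
  Ex P (fun w => line_avg f n w ^+ 2) @[n --> \oo] --> (0 : R).
Proof.
move=> f2 f0.
pose a n := Ex P (fun w => f w * f (shift_env (line_shift n) w)).
have a0 : `|a n| @[n --> \oo] --> (0 : R).
  by have := cvg_norm (mixing f2 f2); rewrite f0 mulr0 normr0; apply.
pose S n w := \sum_(j < n) f (shift_env (line_shift j) w).
have S2 n : sqint P (S n) by apply: sqint_sum => j; exact: shift_sqint.
have fS n : sqint P (fun w => f (shift_env (line_shift n) w)) by exact: shift_sqint.
have corr j n : (j <= n)%N -> Ex P (fun w => f (shift_env (line_shift j) w) *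
    f (shift_env (line_shift n) w)) = a (n - j)%N.
  move=> jn; rewrite /a -(shift_Ex (line_shift j) (itgM f2 (fS (n - j)%N))).
  congr Ex; apply/funext => w; rewrite shift_env_comp.
  by rewrite (_ : _ + _ = line_shift n)// /line_shift -mulrnDr subnK.
have Sbound n : Ex P (fun w => S n w ^+ 2) <= 2 * n%:R * \sum_(j < n) `|a j|.
  elim: n => [|n ih].
    rewrite mulr0 mul0r /S; under [X in Ex P X]eq_fun do rewrite big_ord0 expr0n/=.
    by rewrite Ex_cst.
  have -> : (fun w => S n.+1 w ^+ 2) = (fun w => S n w ^+ 2 +
      (2 * (S n w * f (shift_env (line_shift n) w)) +
       f (shift_env (line_shift n) w) ^+ 2)).
    by apply/funext => w; rewrite /S big_ord_recr/=; ring.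
  rewrite ExD; [|exact: sqint_sqr|by apply: itgD; [apply: itgZ; exact: itgM|exact: sqint_sqr]].
  rewrite ExD; [|by apply: itgZ; exact: itgM|exact: sqint_sqr].
  rewrite ExZ; last exact: itgM.
  have -> : Ex P (fun w => S n w * f (shift_env (line_shift n) w)) =
      \sum_(j < n) a (n - j)%N.
    under [X in Ex P X]eq_fun do rewrite /S mulr_suml.
    rewrite Ex_sum; last by move=> j; exact: itgM.
    by apply: eq_bigr => j _; rewrite corr// ltnW.
  have -> : Ex P (fun w => f (shift_env (line_shift n) w) ^+ 2) = a 0%N.
    by have := corr n n (leqnn n); rewrite subnn.
  (* The cross terms involve distances 1 to [n] only; the spared [|a 0|] leaves room for the new
     diagonal term. *)
  have H1 : \sum_(j < n) a (n - j)%N <= \sum_(j < n.+1) `|a j| - `|a 0%N|.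
    rewrite big_ord_recl/= [X in _ <= X]addrC addKr.
    rewrite (reindex_inj rev_ord_inj)/=; apply: ler_sum => j _.
    by rewrite /bump/= subKn// add1n ler_norm.
  have H2 : a 0%N <= `|a 0%N| := ler_norm _.
  have H3 : 0 <= `|a 0%N| := normr_ge0 _.
  have H4 : \sum_(j < n) `|a j| <= \sum_(j < n.+1) `|a j|.
    by rewrite big_ord_recr/= lerDl.
  have H5 : 0 <= \sum_(j < n) `|a j| by exact: sumr_ge0.
  have H6 : 2 * n%:R * \sum_(j < n) `|a j| <= 2 * n%:R * \sum_(j < n.+1) `|a j|.
    by rewrite ler_wpM2l ?mulr_ge0.
  rewrite -[n.+1%:R]natr1 mulrDr mulr1 mulrDl; lra.
have := cesaro a0; rewrite /arithmetic_mean => H.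
apply: (@squeeze_cvgr _ _ _ _ (fun=> 0) (fun n => 2 * (n.+1%:R^-1 *
  (series (fun n => `|a n|) n.+1)))).
- apply: nearW => n; rewrite Ex_sqr_ge0/= /line_avg.
  under [X in Ex P X]eq_fun do rewrite exprMn; rewrite ExZ; last exact: (sqint_sqr (S2 n.+1)).
  rewrite /series/= big_mkord.
  have i0n : 0 <= (n.+1%:R^-1 : R) ^+ 2 by exact: sqr_ge0.
  apply: le_trans (ler_wpM2l i0n (Sbound n.+1)) _.
  rewrite le_eqVlt; apply/orP; left; apply/eqP; field.
  by rewrite nat1r pnatr_eq0.
- exact: cvg_cst.
- by rewrite -[X in _ --> X](mulr0 2); apply: cvgM => //; exact: cvg_cst.
Qed.

End Mixing.
End Independence.

(** * The generator and its energy form *)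

(** The factor [2 ^+ n] results from iterating [(S + y)^2 <= 2 S^2 + 2 y^2]; it only affects the
    value of [genL_bound]. *)
Lemma sqr_sum_le (R : realType) (n : nat) (x : 'I_n -> R) :
  (\sum_i x i) ^+ 2 <= 2 ^+ n * \sum_i x i ^+ 2.
Proof.
elim: n x => [|n ih] x; first by rewrite !big_ord0 expr0n mulr0.
rewrite !big_ord_recr/= [2 ^+ n.+1]exprS.
have := ih (fun i => x (widen_ord (leqnSn n) i)).
set S := \sum_(i < n) _; set T := \sum_(i < n) _; set y := x _ => H.
have p1 : 1 <= 2 ^+ n :> R by rewrite exprn_ege1// ler1n.
have p2 : y ^+ 2 <= 2 ^+ n * y ^+ 2 by rewrite ler_peMl ?sqr_ge0.
rewrite -mulrA mulrDr; have := sqr_ge0 (S - y); lra.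
Qed.

(** * The library's L^2 seminorm and expectation in terms of [Ex] *)

Section Lnorm2.
Context (dd : measure_display) (T : measurableType dd) (R : realType).
Variable P : probability T R.

Lemma Lnorm2E (f : T -> R) : sqint P f ->
  'N[P]_2%:E[EFin \o f]%E = (Num.sqrt (Ex P (fun x => f x ^+ 2)))%:E.
Proof.
move=> f2; rewrite unlock /Lnorm.
under eq_integral do rewrite /= powR_mulrn// real_normK ?num_real//.
have fin : (\int[P]_x (f x ^+ 2)%:E)%E \is a fin_num.
  by apply: integrable_fin_num => //; exact: sqint_sqr.
rewrite -(fineK fin) poweR_EFin -powR12_sqrt//.
by apply: Ex_sqr_ge0.
Qed.

Lemma Lfun2P (f : T -> R) : f \in Lfun P 2%:E <-> sqint P f.
Proof.
split=> [f2|f2].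
  split; last exact: Lfun2_integrable_sqr.
  by have := sub_Lfun_mfun f2; rewrite inE.
rewrite inE; apply/andP; split; rewrite inE/=; first exact: (sqint_meas f2).
by rewrite /finite_norm Lnorm2E// ltry.
Qed.

Lemma expectationE (f : T -> R) : itg P f -> ('E_P[f] = (Ex P f)%:E)%E.
Proof.
move=> intf; rewrite unlock /Ex /Rintegral fineK//.
exact: integrable_fin_num.
Qed.

End Lnorm2.

(** * Dirichlet form, norm bound and polynomials of the generator *)

Section Operator.
Variables (R : realType) (d : nat) (alpha beta : R) (nu : probability R R)
  (P : probability (env R d) R).
Hypothesis iid : iid_law alpha beta nu P.
Hypothesis alpha_gt0 : 0 < alpha.

Local Notation e_ i := (@basis_vec d i).
Local Notation vfield := ('I_d -> env R d -> R).

Definition dgrad (u : env R d -> R) : vfield :=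
  fun i w => u (shift_env (e_ i) w) - u w.

Definition eform (X Y : vfield) : R :=
  \sum_i Ex P (fun w => w (0, i) * (X i w * Y i w)).

Definition vsqint (X : vfield) : Prop := forall i, sqint P (X i).

Lemma ae_coord_le b : {ae P, forall w : env R d, `|w b| <= beta}.
Proof.
apply: filterS (iid_ae_bounded iid b) => w /andP[aw wb].
by rewrite ger0_norm// (le_trans _ aw)// ltW.
Qed.

Lemma sqint_coordM b u : sqint P u -> sqint P (fun w => w b * u w).
Proof.
by apply: sqintM_bounded_ae (ae_coord_le b); exact: measurable_env_coord.
Qed.

Lemma itg_form X Y i : vsqint X -> vsqint Y ->
  itg P (fun w => w (0, i) * (X i w * Y i w)).
Proof.
move=> X2 Y2; under [X in itg P X]eq_fun do rewrite mulrA.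
by apply: itgM => //; exact: sqint_coordM.
Qed.

Lemma vsqint_dgrad u : sqint P u -> vsqint (dgrad u).
Proof. by move=> u2 i; apply: sqintB => //; exact: (shift_sqint iid). Qed.

Lemma vsqint_lin a X Y : vsqint X -> vsqint Y ->
  vsqint (fun i w => a * X i w + Y i w).
Proof. by move=> X2 Y2 i; apply: sqintD => //; exact: sqintZ. Qed.

Lemma vsqint_cst (xi : 'cV[R]_d) : vsqint (fun i _ => xi i 0).
Proof. by move=> i; exact: sqint_cst. Qed.

Lemma eformC X Y : eform X Y = eform Y X.
Proof.
by apply: eq_bigr => i _; apply: eq_Ex => w; rewrite [X i w * _]mulrC.
Qed.

Lemma eform_linl a X X' Y : vsqint X -> vsqint X' -> vsqint Y ->
  eform (fun i w => a * X i w + X' i w) Y = a * eform X Y + eform X' Y.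
Proof.
move=> X2 X2' Y2; rewrite /eform mulr_sumr -big_split; apply: eq_bigr => i _ /=.
rewrite -ExZ; last exact: itg_form.
rewrite -ExD; [|by apply: itgZ; exact: itg_form|exact: itg_form].
by apply: eq_Ex => w; ring.
Qed.

Lemma eform_linr a X Y Y' : vsqint X -> vsqint Y -> vsqint Y' ->
  eform X (fun i w => a * Y i w + Y' i w) = a * eform X Y + eform X Y'.
Proof. by move=> *; rewrite eformC eform_linl// !(eformC X). Qed.

Lemma eformDl X X' Y : vsqint X -> vsqint X' -> vsqint Y ->
  eform (fun i w => X i w + X' i w) Y = eform X Y + eform X' Y.
Proof.
move=> X2 X2' Y2; rewrite -[eform X Y]mul1r -eform_linl//; congr eform.
by apply/funext => i; apply/funext => w; rewrite mul1r.
Qed.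

Lemma eformBl X X' Y : vsqint X -> vsqint X' -> vsqint Y ->
  eform (fun i w => X i w - X' i w) Y = eform X Y - eform X' Y.
Proof.
move=> X2 X2' Y2; rewrite addrC -mulN1r -eform_linl//; congr eform.
by apply/funext => i; apply/funext => w; rewrite mulN1r addrC.
Qed.

Lemma eformDr X Y Y' : vsqint X -> vsqint Y -> vsqint Y' ->
  eform X (fun i w => Y i w + Y' i w) = eform X Y + eform X Y'.
Proof. by move=> *; rewrite eformC eformDl// !(eformC X). Qed.

Lemma eformBr X Y Y' : vsqint X -> vsqint Y -> vsqint Y' ->
  eform X (fun i w => Y i w - Y' i w) = eform X Y - eform X Y'.
Proof. by move=> *; rewrite eformC eformBl// !(eformC X). Qed.

Lemma eform_sqrB X Y : vsqint X -> vsqint Y ->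
  eform (fun i w => X i w - Y i w) (fun i w => X i w - Y i w) =
  eform X X - 2 * eform X Y + eform Y Y.
Proof.
move=> X2 Y2.
have W2 : vsqint (fun i w => X i w - Y i w) by move=> i; exact: sqintB.
by rewrite eformBl// !eformBr// (eformC Y X); ring.
Qed.

Lemma eform_ge0 X : vsqint X -> 0 <= eform X X.
Proof.
move=> X2; apply: sumr_ge0 => i _; rewrite -(Ex_cst P 0).
apply: Ex_ae_le; [exact: itg_cst|exact: itg_form|].
apply: filterS (iid_ae_bounded iid (0, i)) => w /andP[aw _].
by rewrite mulr_ge0 -?expr2 ?sqr_ge0// (le_trans _ aw)// ltW.
Qed.

Lemma eform_le X : vsqint X ->
  eform X X <= beta * \sum_i Ex P (fun w => X i w ^+ 2).
Proof.
move=> X2; rewrite mulr_sumr; apply: ler_sum => i _; rewrite -ExZ; last first.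
  exact: sqint_sqr.
apply: Ex_ae_le; [exact: itg_form|by apply: itgZ; exact: sqint_sqr|].
apply: filterS (iid_ae_bounded iid (0, i)) => w /andP[_ wb].
by rewrite -expr2 ler_wpM2r// sqr_ge0.
Qed.

Lemma eform_cauchy_schwarz X Y : vsqint X -> vsqint Y ->
  eform X Y ^+ 2 <= eform X X * eform Y Y.
Proof.
move=> X2 Y2; apply: discriminant_le; first exact: eform_ge0.
move=> t; have Z2 := vsqint_lin (- t) Y2 X2.
have := eform_ge0 Z2; rewrite eform_linl// !eform_linr// (eformC Y X).
by congr (_ <= _); ring.
Qed.

Lemma genL_lin a u v : genL (fun w : env R d => a * u w + v w) =
  (fun w => a * genL u w + genL v w).
Proof.
apply/funext => w; rewrite /genL mulr_sumr -big_split.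
by apply: eq_bigr => i _ /=; ring.
Qed.

Lemma sqint_genL u : sqint P u -> sqint P (genL u).
Proof.
move=> u2; apply: sqint_sum => i.
by apply: sqintD; apply: sqint_coordM; apply: sqintB => //; exact: (shift_sqint iid).
Qed.

Lemma shift_back i (w : env R d) : shift_env (- e_ i) (shift_env (e_ i) w) = w.
Proof. by rewrite shift_env_comp addNr shift_env0. Qed.

Lemma shift_edge_back i (w : env R d) : shift_env (e_ i) w (- e_ i, i) = w (0, i).
Proof. by rewrite /shift_env/= addNr. Qed.

(** The law is invariant under the shift by [e_i], which moves the [- e_i] half of the generator
    onto the edge [(0, i)], where both halves combine into a product of increments. *)
Lemma genL_form u v : sqint P u -> sqint P v ->
  Ex P (fun w => v w * genL u w) = eform (dgrad v) (dgrad u).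
Proof.
move=> u2 v2; rewrite /genL /eform.
under eq_Ex do rewrite mulr_sumr.
have B2 z b : sqint P (fun w => w b * (u w - u (shift_env z w))).
  by apply: sqint_coordM; apply: sqintB => //; exact: (shift_sqint iid).
rewrite Ex_sum; last by move=> i; apply: itgM => //; exact: sqintD.
apply: eq_bigr => i _; under eq_Ex do rewrite mulrDr.
rewrite ExD; [|exact: itgM|exact: itgM].
rewrite -(shift_Ex iid (e_ i) (itgM v2 (B2 _ (- e_ i, i)))).
rewrite -ExD.
- apply: eq_Ex => w; rewrite shift_back shift_edge_back /dgrad; ring.
- exact: itgM.
- exact: (shift_itg iid (e_ i) (itgM v2 (B2 _ (- e_ i, i)))).
Qed.

Lemma genL_sym u v : sqint P u -> sqint P v ->
  Ex P (fun w => v w * genL u w) = Ex P (fun w => genL v w * u w).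
Proof.
move=> u2 v2; rewrite genL_form// eformC -genL_form//.
by apply: eq_Ex => w; rewrite mulrC.
Qed.

Lemma sqint_coord b : sqint P (fun w => w b).
Proof.
apply: sqint_bounded_ae (ae_coord_le b); exact: measurable_env_coord.
Qed.

Lemma sqint_drift xi : sqint P (drift xi).
Proof.
apply: sqint_sum => i; apply: sqintZ.
by apply: sqintB; exact: sqint_coord.
Qed.

(** The same shift turns the difference of conductances in the drift into an increment of [u] across
    the edge [(0, i)]. *)
Lemma drift_form xi u : sqint P u ->
  Ex P (fun w => u w * drift xi w) = - eform (fun i _ => xi i 0) (dgrad u).
Proof.
move=> u2; rewrite /drift /eform -sumrN.
under eq_Ex do rewrite mulr_sumr.
have B2 b : sqint P (fun w => w b) by exact: sqint_coord.
rewrite Ex_sum; last first.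
  by move=> i; apply: itgM => //; apply: sqintZ; exact: sqintB.
apply: eq_bigr => i _.
have -> : Ex P (fun w => u w * (xi i 0 * (w (0, i) - w (- e_ i, i)))) =
   xi i 0 * (Ex P (fun w => u w * w (0, i)) - Ex P (fun w => u w * w (- e_ i, i))).
  rewrite -ExB; [|exact: itgM|exact: itgM]; rewrite -ExZ.
    by apply: eq_Ex => w; ring.
  by apply: itgB; exact: itgM.
rewrite -(shift_Ex iid (e_ i) (itgM u2 (B2 (- e_ i, i)))).
rewrite -ExB; [|exact: itgM|exact: (shift_itg iid (e_ i) (itgM u2 (B2 (- e_ i, i))))].
rewrite -ExZ; last first.
  apply: itgB; [exact: itgM|exact: (shift_itg iid (e_ i) (itgM u2 (B2 (- e_ i, i))))].
rewrite -ExN; last by apply: itg_form (vsqint_cst xi) (vsqint_dgrad u2).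
by apply: eq_Ex => w; rewrite shift_edge_back /dgrad; ring.
Qed.

(** [sqr_sum_le] gives [2 ^+ d], and each of the [d] directions contributes
    [2 (4 beta^2) + 2 (4 beta^2)]. Adding 1 makes the value at least 1, so that a bound of the
    squared norm by [genL_bound - 1] implies one by [genL_bound ^+ 2]. *)
Definition genL_bound : R := 1 + 2 ^+ d * (d%:R * (16 * beta ^+ 2)).

Lemma genL_bound_ge1 : 1 <= genL_bound.
Proof. by rewrite /genL_bound lerDl; do 3! apply: mulr_ge0 => //; exact: sqr_ge0. Qed.

Lemma Ex_sqr_increment b z u : sqint P u ->
  Ex P (fun w => (w b * (u w - u (shift_env z w))) ^+ 2) <=
  4 * beta ^+ 2 * Ex P (fun w => u w ^+ 2).
Proof.
move=> u2; have s2 := shift_sqint iid z u2.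
have -> : 4 * beta ^+ 2 * Ex P (fun w => u w ^+ 2) =
    2 * beta ^+ 2 * (Ex P (fun w => u w ^+ 2) + Ex P (fun w => u (shift_env z w) ^+ 2)).
  by rewrite (Ex_sqr_shift iid)//; ring.
rewrite -ExD; [|exact: sqint_sqr|exact: sqint_sqr].
rewrite -ExZ; last by apply: itgD; exact: sqint_sqr.
apply: Ex_ae_le.
- by apply: sqint_sqr; apply: sqint_coordM; exact: sqintB.
- by apply: itgZ; apply: itgD; exact: sqint_sqr.
- apply: filterS (ae_coord_le b) => w wb.
  rewrite exprMn -(@real_normK _ (w b)) ?num_real//.
  rewrite [X in _ <= X * _]mulrC -[X in _ <= X]mulrA.
  have b2 : `|w b| ^+ 2 <= beta ^+ 2.
    by rewrite lerXn2r ?nnegrE// (le_trans _ wb).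
  apply: ler_pM; rewrite ?sqr_ge0//.
  by have := sqr_ge0 (u w + u (shift_env z w)); lra.
Qed.

Lemma Ex_sqr_genL u : sqint P u ->
  Ex P (fun w => genL u w ^+ 2) <= genL_bound ^+ 2 * Ex P (fun w => u w ^+ 2).
Proof.
move=> u2; set F := Ex P (fun w => u w ^+ 2).
have F0 : 0 <= F by exact: Ex_sqr_ge0.
pose x i (w : env R d) := w (0, i) * (u w - u (shift_env (e_ i) w)).
pose y i (w : env R d) := w (- e_ i, i) * (u w - u (shift_env (- e_ i) w)).
have x2 i : sqint P (x i).
  by apply: sqint_coordM; apply: sqintB => //; exact: (shift_sqint iid).
have y2 i : sqint P (y i).
  by apply: sqint_coordM; apply: sqintB => //; exact: (shift_sqint iid).
apply: (@le_trans _ _ (2 ^+ d * \sum_i Ex P (fun w => (x i w + y i w) ^+ 2))).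
  rewrite -Ex_sum; last by move=> i; apply: sqint_sqr; exact: sqintD.
  rewrite -ExZ; last by apply: itg_sum => i; apply: sqint_sqr; exact: sqintD.
  apply: Ex_le; first by apply: sqint_sqr; exact: sqint_genL.
    by apply: itgZ; apply: itg_sum => i; apply: sqint_sqr; exact: sqintD.
  by move=> w; exact: sqr_sum_le.
apply: (@le_trans _ _ ((genL_bound - 1) * F)); last first.
  by apply: ler_wpM2r => //; have := genL_bound_ge1; nra.
rewrite /genL_bound addrC addKr -mulrA; apply: ler_wpM2l; first exact: exprn_ge0.
rewrite -mulrA -[d in d%:R](card_ord d) mulr_natl -sumr_const.
apply: ler_sum => i _.
have := Ex_sqr_increment (0, i) (e_ i) u2.
have := Ex_sqr_increment (- e_ i, i) (- e_ i) u2.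
rewrite -/F -/(x i _) -/(y i _).
have : Ex P (fun w => (x i w + y i w) ^+ 2) <=
    2 * Ex P (fun w => x i w ^+ 2) + 2 * Ex P (fun w => y i w ^+ 2).
  rewrite -!ExZ; [|exact: sqint_sqr|exact: sqint_sqr].
  rewrite -ExD; [|by apply: itgZ; exact: sqint_sqr|by apply: itgZ; exact: sqint_sqr].
  apply: Ex_le; first by apply: sqint_sqr; exact: sqintD.
    by apply: itgD; apply: itgZ; exact: sqint_sqr.
  by move=> w; have := sqr_ge0 (x i w - y i w); lra.
lra.
Qed.

Lemma genL_op_bound : op_bound P (@genL R d) genL_bound.
Proof.
move=> u /Lfun2P u2; rewrite !Lnorm2E//; last exact: sqint_genL.
have M0 : 0 <= genL_bound by rewrite (le_trans ler01)// genL_bound_ge1.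
rewrite -EFinM lee_fin -(ger0_norm M0) -sqrtr_sqr -sqrtrM ?sqr_ge0//.
by rewrite ler_wsqrtr// Ex_sqr_genL.
Qed.

Local Notation pop := (poly_op (@genL R d)).

Lemma poly_op_widen n (p : {poly R}) f w : (size p <= n)%N ->
  pop p f w = \sum_(i < n) p`_i * iter i (@genL R d) f w.
Proof.
move=> pn; rewrite /poly_op (big_ord_widen n (fun i => p`_i * iter i (@genL R d) f w))//.
rewrite big_mkcond/=; apply: eq_bigr => i _; case: ifPn => //.
by rewrite -leqNgt => ?; rewrite nth_default ?mul0r.
Qed.

Lemma poly_op_lin a (p q : {poly R}) f w : pop (a *: p + q) f w = a * pop p f w + pop q f w.
Proof.
pose n := maxn (size p) (size q).
rewrite !(@poly_op_widen n) ?leq_maxl ?leq_maxr//; last first.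
  apply: leq_trans (size_polyD _ _) _.
  by rewrite geq_max leq_max (leq_trans (size_scale_leq _ _))//= leq_maxr.
rewrite mulr_sumr -big_split; apply: eq_bigr => i _ /=.
by rewrite coefD coefZ mulrDl mulrA.
Qed.

Lemma poly_opC c f w : pop c%:P f w = c * f w.
Proof.
rewrite (@poly_op_widen 1) ?size_polyC ?leq_b1// big_ord1.
by rewrite coefC.
Qed.

Lemma genL_sum (I : Type) (s : seq I) (c : I -> R) (F : I -> env R d -> R) w :
  genL (fun w => \sum_(i <- s) c i * F i w) w = \sum_(i <- s) c i * genL (F i) w.
Proof.
elim: s w => [|i s ih] w.
  rewrite big_nil /genL; apply: big1 => i _; rewrite !big_nil; ring.
rewrite big_cons -ih.
have -> : (fun w => \sum_(j <- i :: s) c j * F j w) =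
    (fun w => c i * F i w + \sum_(j <- s) c j * F j w).
  by apply/funext => w'; rewrite big_cons.
by rewrite genL_lin.
Qed.

Lemma poly_opX (p : {poly R}) f : pop ('X * p) f = genL (pop p f).
Proof.
apply/funext => w; rewrite (@poly_op_widen (size p).+1); last first.
  by rewrite (leq_trans (size_polyMleq _ _))// size_polyX.
rewrite big_ord_recl coefXM/= mul0r add0r genL_sum.
by apply: eq_bigr => i _; rewrite coefXM.
Qed.

Lemma sqint_iter_genL n f : sqint P f -> sqint P (iter n (@genL R d) f).
Proof. by move=> f2; elim: n => //= n ih; exact: sqint_genL. Qed.

Lemma sqint_poly_op p f : sqint P f -> sqint P (pop p f).
Proof.
move=> f2; apply: sqint_sum => i; apply: sqintZ; exact: sqint_iter_genL.
Qed.

(** By symmetry of [L], polynomials in [L] move across the expectation. In the induction on the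
    Horner form of [p], one [L] at a time passes to [q] as a factor ['X]. *)
Lemma poly_op_mul (p q : {poly R}) f : sqint P f ->
  Ex P (fun w => pop p f w * pop q f w) = Ex P (fun w => f w * pop (p * q) f w).
Proof.
move=> f2; elim/poly_ind: p q => [|p c ih] q.
  rewrite mul0r; apply: eq_Ex => w.
  by rewrite -[0]/(0%:P) poly_opC mul0r mulr0 mul0r.
have E1 w : pop (p * 'X + c%:P) f w = genL (pop p f) w + c * f w.
  rewrite -[p * 'X]scale1r poly_op_lin mul1r poly_opC.
  by rewrite [p * 'X]mulrC poly_opX.
have E2 w : pop ((p * 'X + c%:P) * q) f w = pop (p * ('X * q)) f w + c * pop q f w.
  by rewrite mulrDl -mulrA mul_polyC addrC poly_op_lin addrC.
under [LHS]eq_Ex do rewrite E1 mulrDl -mulrA.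
under [RHS]eq_Ex do rewrite E2 mulrDr [_ * (c * _)]mulrCA.
have p2 := sqint_poly_op p f2; have q2 := sqint_poly_op q f2.
have pq2 := sqint_poly_op (p * ('X * q)) f2.
rewrite ExD; [|by apply: itgM => //; exact: sqint_genL|by apply: itgZ; exact: itgM].
rewrite [RHS]ExD; [|exact: itgM|by apply: itgZ; exact: itgM].
by rewrite -genL_sym// -ih poly_opX.
Qed.

End Operator.

(** * The corrector *)

Lemma cvg0_sum (R : realType) (I : Type) (s : seq I) (u : I -> nat -> R) :
  (forall i, u i @ \oo --> (0 : R)) ->
  \sum_(i <- s) u i n @[n --> \oo] --> (0 : R).
Proof.
move=> u0; elim: s => [|i s ih].
  by under eq_fun do rewrite big_nil; exact: cvg_cst.
under eq_fun do rewrite big_cons.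
by have := cvgD (u0 i) ih; rewrite addr0; apply.
Qed.

Section Corrector.
Variables (R : realType) (d : nat) (alpha beta : R) (nu : probability R R)
  (P : probability (env R d) R).
Hypothesis iid : iid_law alpha beta nu P.
Hypothesis alpha_gt0 : 0 < alpha.
Variables (xi : 'cV[R]_d) (phi : lattice d -> env R d -> R) (q : R).
Hypothesis phiP : is_corrector P xi phi.
Hypothesis energyE : (q%:E =
  'E_P[fun w => quad (Amx 0 w) (xi + grad (phi^~ w) 0)%R])%E.

Local Notation e_ i := (@basis_vec d i).
Local Notation V := (fun i w => grad (phi^~ w) 0 i 0).
Local Notation Xi := (fun i (_ : env R d) => xi i 0).
Local Notation Y := (fun i w => xi i 0 + grad (phi^~ w) 0 i 0).

Lemma mulmx_AmxE (x : lattice d) (w : env R d) (v : 'cV[R]_d) i :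
  (Amx x w *m v) i 0 = w (x, i) * v i 0.
Proof. by rewrite mul_diag_mx !mxE. Qed.

Lemma quad_AmxE (w : env R d) (v : 'cV[R]_d) :
  quad (Amx 0 w) v = \sum_i w (0, i) * v i 0 ^+ 2.
Proof.
rewrite /quad /dot mxE; apply: eq_bigr => i _.
by rewrite mxE mulmx_AmxE; ring.
Qed.

Lemma measurable_gradphi x i : measurable_fun setT (fun w => grad (phi^~ w) x i 0).
Proof.
have [mphi _ _ _ _] := phiP.
have -> : (fun w => grad (phi^~ w) x i 0) = (fun w => phi (x + e_ i) w - phi x w).
  by apply/funext => w; rewrite mxE.
exact: measurable_funB.
Qed.

Let g (w : env R d) : R := \sum_i w (0, i) * Y i w ^+ 2.

Let mg i : measurable_fun setT (fun w : env R d => w (0, i) * Y i w ^+ 2).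
Proof.
apply: measurable_funM; first exact: measurable_env_coord.
by apply: measurable_funX; apply: measurable_funD => //; exact: measurable_gradphi.
Qed.

Let gE : (\int[P]_w (g w)%:E = q%:E)%E.
Proof.
rewrite energyE unlock; apply: eq_integral => w _.
rewrite quad_AmxE; congr (_%:E); apply: eq_bigr => i _.
by rewrite [(xi + _) i 0]mxE.
Qed.

Let itg_g : itg P g.
Proof.
have mgs : measurable_fun setT g by apply: measurable_sum => i; exact: mg.
apply/integrableP; split; first exact/measurable_EFinP.
by rewrite integral_fin_num_abs// gE.
Qed.

(** Ellipticity bounds [alpha] times the square of [Y i] by the energy density [g], which is
    integrable because its extended-real expectation equals the real number [q]. *)
Lemma corrector_vsqint : vsqint P V.
Proof.
move=> i; have mY : measurable_fun setT (Y i).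
  by apply: measurable_funD => //; exact: measurable_gradphi.
suff : sqint P (Y i).
  move=> /(sqintD (sqint_cst P (- xi i 0))).
  by congr sqint; apply/funext => w; rewrite addKr.
split=> //; apply: (@itg_ae_le _ _ _ _ _ (fun w => alpha^-1 * g w)).
- exact: measurable_funX.
- have : {ae P, forall w : env R d, forall j, alpha <= w (0, j)}.
    apply: filter_forall => j.
    by apply: filterS (iid_ae_bounded iid (0, j)) => w /andP[].
  apply: filterS => w aw; rewrite ger0_norm ?sqr_ge0//.
  rewrite ler_pdivlMl// /g (bigD1 i)//=.
  apply: ler_wpDr; last by rewrite ler_wpM2r ?sqr_ge0.
  apply: sumr_ge0 => j _; rewrite mulr_ge0 ?sqr_ge0//.
  by rewrite (le_trans _ (aw j))// ltW.
- exact: itgZ.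
Qed.

Lemma corrector_Y_vsqint : vsqint P Y.
Proof. by move=> i; apply: sqintD; [exact: sqint_cst|exact: corrector_vsqint]. Qed.

Lemma corrector_energy : q = eform P Y Y.
Proof.
have -> : q = Ex P g by rewrite /Ex /Rintegral gE.
rewrite /g Ex_sum /eform.
  by apply: eq_bigr => i _; apply: eq_Ex => w; rewrite expr2.
move=> i; have := itg_form iid alpha_gt0 i corrector_Y_vsqint corrector_Y_vsqint.
by congr itg; apply/funext => w; rewrite expr2.
Qed.

(** Weak form of the corrector equation. The equation at the origin is tested against [u];
    stationarity expresses the flux at [- e_i] through a shifted environment, and shifting that term
    by [e_i] produces [dgrad u]. *)
Lemma corrector_orthogonal u : sqint P u -> eform P Y (dgrad u) = 0.
Proof.
move=> u2; have [_ _ stat _ eqn] := phiP.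
pose F i (w : env R d) : R := w (0, i) * Y i w.
have F2 i : sqint P (F i).
  by apply: (sqint_coordM iid alpha_gt0); exact: corrector_Y_vsqint.
have Fs2 i z : sqint P (fun w => F i (shift_env z w)) by exact: (shift_sqint iid).
have S0 : {ae P, forall w, \sum_i (F i w - F i (shift_env (- e_ i) w)) = 0}.
  have H : {ae P, forall w, forall i, grad (phi^~ w) (0 + - e_ i) =
      grad (phi^~ (shift_env (- e_ i) w)) 0}.
    by apply: filter_forall => i; exact: stat.
  apply: filterS2 eqn H => w /(_ 0) /eqP; rewrite oppr_eq0 => /eqP eqw Hw.
  rewrite -[RHS]eqw /divstar; apply: eq_bigr => i _.
  rewrite !mulmx_AmxE ![(xi + _) i 0]mxE /F; congr (_ - _).
  by rewrite Hw.
have : Ex P (fun w => u w * \sum_i (F i w - F i (shift_env (- e_ i) w))) = 0.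
  rewrite -[RHS](Ex_cst P); apply: Ex_ae => //.
    apply: (itg_meas (P := P)); apply: itgM => //.
    by apply: sqint_sum => i; exact: sqintB.
  by apply: filterS S0 => w ->; rewrite mulr0.
under eq_Ex do rewrite mulr_sumr.
rewrite Ex_sum; last by move=> i; apply: itgM => //; exact: sqintB.
move=> H; apply/eqP; rewrite -oppr_eq0 -[X in _ == X]H; apply/eqP.
rewrite /eform -sumrN; apply: eq_bigr => i _.
under [RHS]eq_Ex do rewrite mulrBr.
rewrite ExB; [|exact: itgM|exact: itgM].
rewrite -(shift_Ex iid (e_ i) (itgM u2 (Fs2 i (- e_ i)))).
rewrite -ExB; [|exact: itgM|exact: (shift_itg iid (e_ i) (itgM u2 (Fs2 i (- e_ i))))].
rewrite -ExN; last exact: (itg_form iid alpha_gt0 i corrector_Y_vsqint (vsqint_dgrad iid u2)).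
by apply: eq_Ex => w; rewrite shift_back /dgrad /F; ring.
Qed.

Variable i0 : 'I_d.
Local Notation ln n := (line_shift i0 n).

Definition corrector_primitive (n : nat) (w : env R d) : R :=
  - (n.+1%:R^-1 * \sum_(j < n.+1) phi (ln j) w).

(** [phi] need not be stationary, but each step along the line adds a shifted copy of [V i0], which
    is square integrable. *)
Lemma phi_line_sqint j : sqint P (phi (ln j)).
Proof.
have [mphi phi0 stat _ _] := phiP.
elim: j => [|j ih].
  rewrite (_ : phi (ln 0) = fun=> 0); first exact: sqint_cst.
  by apply/funext => w; exact: phi0.
have S2 : sqint P (fun w => phi (ln j) w + V i0 (shift_env (ln j) w)).
  by apply: sqintD => //; exact: (shift_sqint iid (ln j) (corrector_vsqint i0)).
apply: (sqint_ae_le (C := 1) (mphi _) _ S2).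
apply: filterS (stat 0 (ln j)) => w <-; rewrite add0r mxE mul1r.
by rewrite [X in _ <= `|X|]addrC subrK /line_shift mulrSr.
Qed.

Lemma sqint_corrector_primitive n : sqint P (corrector_primitive n).
Proof.
apply: sqintN; apply: sqintZ; apply: sqint_sum => j; exact: phi_line_sqint.
Qed.

(* Averaging [phi] along a line gives a stationary function whose gradient is
   [V] minus its ergodic average. *)
Lemma dgrad_corrector_primitive n i : {ae P, forall w,
  dgrad (corrector_primitive n) i w = V i w - line_avg i0 (V i) n w}.
Proof.
have [mphi phi0 stat _ _] := phiP.
have A1 : {ae P, forall w, forall l, grad (phi^~ w) (0 + ln l) =
    grad (phi^~ (shift_env (ln l) w)) 0}.
  by apply: ae_foralln => l; exact: stat.
have A2 : {ae P, forall w, forall l, grad (phi^~ w) (0 + (ln l + e_ i)) =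
    grad (phi^~ (shift_env (ln l + e_ i) w)) 0}.
  by apply: ae_foralln => l; exact: stat.
have A3 := shift_ae iid (e_ i) A1.
apply: filterS3 A1 A2 A3 => w A1 A2 A3.
(* Cocycle relation: both sides vanish at [j = 0], and stationarity gives them the same increments
   along the line. The term [phi (e_ i) w] is [V i w], since [phi] vanishes at the origin. *)
have key j : phi (ln j) (shift_env (e_ i) w) = phi (ln j + e_ i) w - phi (e_ i) w.
  elim: j => [|j ih]; first by rewrite phi0 add0r subrr.
  have step x y : phi (x + e_ i0) y = phi x y + grad (phi^~ y) x i0 0.
    by rewrite mxE [RHS]addrC subrK.
  rewrite {1}/line_shift mulrSr step -[basis_vec _ *+ j](add0r) A3.
  rewrite -/(ln j) shift_env_comp -A2 !add0r ih.
  have -> : ln j.+1 + e_ i = (ln j + e_ i) + e_ i0.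
    by rewrite /line_shift mulrSr addrAC.
  by rewrite step; ring.
rewrite /dgrad /corrector_primitive /line_avg.
have -> : \sum_(j < n.+1) V i (shift_env (ln j) w) =
    \sum_(j < n.+1) phi (ln j) (shift_env (e_ i) w) -
    \sum_(j < n.+1) phi (ln j) w + n.+1%:R * V i w.
  have -> : n.+1%:R * V i w = \sum_(j < n.+1) V i w.
    by rewrite sumr_const card_ord mulr_natl.
  rewrite -sumrB -big_split/=.
  apply: eq_bigr => j _; rewrite -A1 add0r key !mxE phi0 add0r; ring.
have n0 : n.+1%:R != 0 :> R by rewrite pnatr_eq0.
set a := \sum_(j < n.+1) _; set b := \sum_(j < n.+1) _.
rewrite [n.+1%:R^-1 * (_ + _)]mulrDr mulKf//; ring.
Qed.

Lemma corrector_primitive_cvg i :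
  Ex P (fun w => (V i w - dgrad (corrector_primitive n) i w) ^+ 2)
    @[n --> \oo] --> (0 : R).
Proof.
have [_ _ _ mean _] := phiP.
have V2 := corrector_vsqint.
have V0 : Ex P (V i) = 0.
  by have [_ +] := mean 0 i; rewrite unlock /Ex /Rintegral => ->.
have := mean_ergodic iid i0 (V2 i) V0.
rewrite (_ : (fun n => Ex P (fun w => (line_avg i0 (V i) n w) ^+ 2)) =
   (fun n => Ex P (fun w => (V i w - dgrad (corrector_primitive n) i w) ^+ 2)))//.
apply/funext => n.
have D2 := vsqint_dgrad iid (sqint_corrector_primitive n).
apply: Ex_ae.
- apply: measurable_funX; exact: (sqint_meas (sqint_line_avg iid i0 n (V2 i))).
- apply: measurable_funX; apply: measurable_funB.
    exact: (sqint_meas (V2 i)).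
  exact: (sqint_meas (D2 i)).
- by apply: filterS (dgrad_corrector_primitive n i) => w ->; rewrite subKr.
Qed.

Lemma corrector_potential_cvg :
  eform P (fun i w => V i w - dgrad (corrector_primitive n) i w)
         (fun i w => V i w - dgrad (corrector_primitive n) i w)
    @[n --> \oo] --> (0 : R).
Proof.
have W2 n : vsqint P (fun i w => V i w - dgrad (corrector_primitive n) i w).
  move=> i; apply: sqintB; first exact: corrector_vsqint.
  exact: (vsqint_dgrad iid (sqint_corrector_primitive n)).
apply: (@squeeze_cvgr _ _ _ _ (fun=> 0) (fun n => beta * \sum_i
   Ex P (fun w => (V i w - dgrad (corrector_primitive n) i w) ^+ 2))).
- apply: nearW => n; rewrite (eform_ge0 iid alpha_gt0)//=.
  exact: (eform_le iid alpha_gt0).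
- exact: cvg_cst.
- have H : \sum_i Ex P (fun w =>
      (V i w - dgrad (corrector_primitive n) i w) ^+ 2) @[n --> \oo] -->
      (0 : R).
    by apply: cvg0_sum => i; exact: corrector_primitive_cvg.
  by have := cvgM (cvg_cst beta) H; rewrite mulr0; apply.
Qed.

(** [Y] is orthogonal to every [dgrad u], so its product with [W n] does not depend on [n], while
    Cauchy-Schwarz bounds the square of that product by a quantity tending to 0. *)
Lemma corrector_V_orthogonal : eform P Y V = 0.
Proof.
have V2 := corrector_vsqint; have Y2 := corrector_Y_vsqint.
have D2 n := vsqint_dgrad iid (sqint_corrector_primitive n).
pose W n := (fun i w => V i w - dgrad (corrector_primitive n) i w).
have W2 n : vsqint P (W n) by move=> i; apply: sqintB; [exact: V2|exact: D2].
have YW n : eform P Y (W n) = eform P Y V.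
  rewrite (eformBr iid alpha_gt0)// corrector_orthogonal ?subr0//.
  exact: sqint_corrector_primitive.
have H : eform P Y V ^+ 2 <= 0.
  have lim0 : eform P Y Y * eform P (W n) (W n) @[n --> \oo] --> (0 : R).
    have := cvgM (cvg_cst (eform P Y Y)) corrector_potential_cvg.
    by rewrite mulr0; apply.
  rewrite -(cvg_lim _ lim0)//; apply: limr_ge; first by apply/cvg_ex; exists 0.
  by apply: nearW => n; rewrite -(YW n) (eform_cauchy_schwarz iid alpha_gt0).
by apply/eqP; rewrite -sqrf_eq0 eq_le H sqr_ge0.
Qed.

(** Since [Y = Xi + V] is orthogonal to [V], the cross term [<Xi, V>_A] equals [- <V, V>_A]. *)
Lemma corrector_energy_split : q = eform P Xi Xi - eform P V V.
Proof.
have V2 := corrector_vsqint; have Y2 := corrector_Y_vsqint.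
have X2 := vsqint_cst P xi.
have := corrector_V_orthogonal; rewrite corrector_energy.
rewrite (eformDl iid alpha_gt0)// => XV.
rewrite (eformDl iid alpha_gt0)// !(eformDr iid alpha_gt0)// (eformC P V Xi).
lra.
Qed.

Lemma corrector_drift u : sqint P u ->
  Ex P (fun w => u w * drift xi w) = eform P V (dgrad u).
Proof.
move=> u2; have V2 := corrector_vsqint.
have X2 := vsqint_cst P xi; have D2 := vsqint_dgrad iid u2.
rewrite (drift_form iid alpha_gt0)//.
have := corrector_orthogonal u2; rewrite (eformDl iid alpha_gt0)//; lra.
Qed.

End Corrector.

(** * The spectral measure of the drift *)

Lemma measurable_fun_continuous_in (R : realType) (D : set R) (f : R -> R) :
  measurable D -> (forall x, D x -> {for x, continuous f}) ->
  measurable_fun D f.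
Proof.
move=> mD cf; apply: subspace_continuous_measurable_fun => //.
by apply: continuous_in_subspaceT => x; rewrite inE; exact: cf.
Qed.

Section SpectralMeasure.
Variables (R : realType) (d : nat) (alpha beta : R) (nu : probability R R)
  (P : probability (env R d) R).
Hypothesis iid : iid_law alpha beta nu P.
Hypothesis alpha_gt0 : 0 < alpha.
Variables (f : env R d -> R) (e : {measure set R -> \bar R}).
Hypothesis f2 : sqint P f.
Hypothesis eP : spectral_measure P f e.

Local Notation M := (genL_bound d beta).
Local Notation pop := (poly_op (@genL R d)).

Let M_gt0 : 0 < M.
Proof. by rewrite (lt_le_trans ltr01)// genL_bound_ge1. Qed.

Lemma continuous_min_bound : continuous (fun l : R => Num.min l M).
Proof.
move=> l; apply: (@continuous_min _ _ (fun l : R => l) (fun=> M)) => //.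
exact: cvg_cst.
Qed.

(** The sequence constantly equal to [p] witnesses [is_funcalc], as uniform convergence is required
    only on [[0, M]]. Beyond [M], [Psi] may level off, which its boundedness on the half-line
    demands. *)
Lemma spectral_funcalc (Psi : R -> R) (p : {poly R}) : continuous Psi ->
  (exists K, forall l, 0 <= l -> `|Psi l| <= K) ->
  (forall l, 0 <= l <= M -> Psi l = p.[l]) ->
  (\int[e]_(l in `[0%R, +oo[%classic) (Psi l)%:E =
   (Ex P (fun w => f w * pop p f w)%R)%:E)%E.
Proof.
move=> cPsi bPsi Psip; have p2 := sqint_poly_op iid alpha_gt0 p f2.
have [_ /(_ Psi) H] := eP.
rewrite -(H _ bPsi (pop p f)).
- rewrite expectationE//; exact: itgM.
- exact: continuous_subspaceT.
split; first exact/Lfun2P.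
exists M, (fun=> p); split.
- exact: (genL_op_bound iid alpha_gt0).
- move=> Q /uniform_nbhs[E [entE subQ]]; exists 0%N => // n _; apply: subQ => y /=.
  rewrite in_itv/= => yM; rewrite Psip//; exact: entourage_refl.
- apply: cvg_near_cst; apply: nearW => n.
  rewrite (_ : EFin \o _ = cst 0%E) ?Lnorm0//.
  by apply/funext => w /=; rewrite subrr.
Qed.

Lemma poly_op0 w : pop 0 f w = 0.
Proof. by rewrite /poly_op size_poly0 big_ord0. Qed.

(** The test function [min (max (l - M) 0) 1] vanishes on [[0, M]], where the zero polynomial
    represents it, and is positive beyond; its zero integral leaves no mass there. *)
Lemma spectral_above : e `]M, +oo[%classic = 0%E.
Proof.
pose Psi (l : R) : R := Num.min (Num.max (l - M) 0) 1.
have Psi0 l : 0 <= Psi l by rewrite /Psi le_min le_max lexx orbT ler01.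
have cPsi : continuous Psi.
  move=> l; apply: (@continuous_min _ _ (fun l => Num.max (l - M) 0) (fun=> 1)).
    apply: (@continuous_max _ _ (fun l => l - M) (fun=> 0)); last exact: cvg_cst.
    by apply: cvgB => //; exact: cvg_cst.
  exact: cvg_cst.
have Ex0 : Ex P (fun w => f w * pop 0 f w) = 0.
  rewrite -[RHS](Ex_cst P); apply: eq_Ex => w.
  by rewrite poly_op0 mulr0.
have bPsi : exists K : R, forall l : R, 0 <= l -> `|Psi l| <= K.
  by exists 1 => l _; rewrite ger0_norm// /Psi ge_min lexx orbT.
have Psip l : 0 <= l <= M -> Psi l = (0 : {poly R}).[l].
  move=> /andP[_ lM]; rewrite horner0 /Psi max_r ?subr_le0//.
  by rewrite min_l.
have := spectral_funcalc cPsi bPsi Psip; rewrite Ex0 => I0.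
have mPsi : measurable_fun (`[0%R, +oo[%classic : set R) (EFin \o Psi).
  apply/measurable_EFinP; apply: measurable_funTS; exact: continuous_measurable_fun.
have : (\int[e]_(l in `[0%R, +oo[%classic) `|(EFin \o Psi) l| = 0)%E.
  by rewrite -[RHS]I0; apply: eq_integral => l _; rewrite /= ger0_norm.
move=> /ae_eq_integral_abs -/(_ _ mPsi) []//  N [mN N0 sub].
apply/eqP; rewrite -measure_le0 -N0; apply: le_measure; rewrite ?inE//.
apply: subset_trans sub => l /=; rewrite in_itv/= andbT => Ml H.
have := H _; rewrite in_itv/= andbT => /(_ (ltW (lt_trans M_gt0 Ml))) [] /eqP.
rewrite /Psi gt_eqF// lt_min ltr01 andbT lt_max subr_gt0 Ml//.
Qed.

Lemma spectral_poly (p : {poly R}) : (forall l, 0 <= l <= M -> 0 <= p.[l]) ->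
  (\int[e]_(l in `[0%R, M]%classic) (p.[l])%:E =
   (Ex P (fun w => f w * pop p f w)%R)%:E)%E.
Proof.
move=> p0.
(* Freezing [p] beyond [M] makes it bounded on the half-line without changing the integral. *)
pose Psi (l : R) : R := p.[Num.min l M].
have cPsi : continuous Psi.
  move=> l; apply: (@continuous_comp _ _ _ (fun l : R => Num.min l M) (horner p)).
    exact: continuous_min_bound.
  exact: continuous_horner.
have minM l : 0 <= l -> 0 <= Num.min l M <= M.
  by move=> l0; rewrite le_min l0 ltW//= ge_min lexx orbT.
rewrite -(@spectral_funcalc Psi p)//; last 2 first.
- have [c _ maxc] := EVT_max (ltW M_gt0)
    (continuous_subspaceT (A := `[0, M]%classic) (@continuous_horner _ p)).
  exists p.[c] => l l0; rewrite ger0_norm ?p0 ?minM//.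
  by apply: maxc; rewrite in_itv/= minM.
- by move=> l /andP[_ lM]; rewrite /Psi min_l.
rewrite (@ge0_negligible_integral _ _ _ e `[0, +oo[ `]M, +oo[)//; last 3 first.
- apply/measurable_EFinP; apply: measurable_funTS; exact: continuous_measurable_fun.
- by move=> l /=; rewrite in_itv/= andbT => l0; rewrite lee_fin p0// minM.
- exact: spectral_above.
have -> : `[0%R, +oo[ `\` `]M, +oo[ = `[0, M]%classic.
  apply/seteqP; split=> l /=; rewrite !in_itv/= !andbT.
    by move=> [-> /negP]; rewrite -leNgt.
  by move=> /andP[-> lM]; split=> //; apply/negP; rewrite -leNgt.
apply: eq_integral => l; rewrite inE/= in_itv/= => /andP[_ lM].
by rewrite /Psi min_l.
Qed.

Lemma spectral_mass : e `[0, M]%classic = (Ex P (fun w => f w ^+ 2))%:E.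
Proof.
have := @spectral_poly 1%:P; rewrite (_ : Ex P _ = Ex P (fun w => f w ^+ 2)).
  move=> <-; last by move=> l _; rewrite hornerC.
  by under eq_integral do rewrite hornerC; rewrite integral_cst// mul1e.
by apply: eq_Ex => w; rewrite poly_opC mul1r expr2.
Qed.

(** It maps [[0, M]] into [[0, 1]] and is below 1 off the origin, so the partial Neumann sums
    [neumann n] increase to [1 / l] on []0, M]], with relative error exactly [residual ^+ n]. *)
Definition residual : {poly R} := 1 - M^-1 *: 'X.

Definition neumann (n : nat) : {poly R} := M^-1 *: \sum_(i < n) residual ^+ i.

Lemma mulX_neumann n : 'X * neumann n = 1 - residual ^+ n.
Proof.
have -> : 'X * neumann n = - ((residual - 1) * \sum_(i < n) residual ^+ i).
  rewrite /neumann /residual addrAC subrr add0r mulNr opprK.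
  by rewrite -scalerAr scalerAl.
by rewrite -subrX1 opprB.
Qed.

Lemma residual_itv l : 0 <= l <= M -> 0 <= residual.[l] <= 1.
Proof.
move=> /andP[l0 lM]; rewrite !hornerE subr_ge0.
rewrite ler_pdivrMl// mulr1 lM/= gerBl mulr_ge0// invr_ge0 ltW//.
Qed.

Lemma neumann_ge0 n l : 0 <= l <= M -> 0 <= (neumann n).[l].
Proof.
move=> /residual_itv/andP[r0 _]; rewrite hornerZ.
apply: mulr_ge0; first by rewrite invr_ge0 ltW.
by rewrite horner_sum sumr_ge0// => i _; rewrite horner_exp exprn_ge0.
Qed.

Lemma mul_neumann n l : l * (neumann n).[l] = 1 - residual.[l] ^+ n.
Proof.
by have := congr1 (horner^~ l) (mulX_neumann n); rewrite !hornerE.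
Qed.

Lemma mul_neumann_itv n l : 0 <= l <= M -> 0 <= l * (neumann n).[l] <= 1.
Proof.
move=> /residual_itv/andP[r0 r1]; rewrite mul_neumann subr_ge0 exprn_ile1//=.
by rewrite gerBl exprn_ge0.
Qed.

Lemma neumann_le_inv n l : 0 < l <= M -> (neumann n).[l] <= l^-1.
Proof.
move=> /andP[l0 lM]; rewrite -[leRHS]mul1r ler_pdivlMr// mulrC.
have lM' : 0 <= l <= M by rewrite (ltW l0).
by have /andP[_] := mul_neumann_itv n lM'.
Qed.

Lemma neumann_nd n m l : 0 <= l <= M -> (n <= m)%N ->
  (neumann n).[l] <= (neumann m).[l].
Proof.
move=> /residual_itv/andP[r0 _] nm; rewrite !hornerZ.
apply: ler_wpM2l; first by rewrite invr_ge0 ltW.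
rewrite !horner_sum -(subnKC nm) big_split_ord/= lerDl sumr_ge0// => i _.
by rewrite horner_exp exprn_ge0.
Qed.

Lemma residual_cvg0 l : 0 < l <= M -> residual.[l] ^+ n @[n --> \oo] --> (0 : R).
Proof.
move=> /andP[l0 lM]; apply: cvg_expr.
have lM' : 0 <= l <= M by rewrite (ltW l0).
have /andP[r0 _] := residual_itv lM'; rewrite ger0_norm//.
by rewrite !hornerE ltrBlDr ltrDl mulr_gt0// invr_gt0.
Qed.

Lemma neumann_cvg l : 0 < l <= M ->
  (neumann n).[l] @[n --> \oo] --> l^-1.
Proof.
move=> /[dup] lM /andP[l0 _].
have -> : (fun n => (neumann n).[l]) = (fun n => (1 - residual.[l] ^+ n) * l^-1).
  by apply/funext => n; rewrite -mul_neumann mulrAC divff ?mul1r// gt_eqF.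
have := cvgM (cvgB (cvg_cst (1 : R)) (residual_cvg0 lM)) (cvg_cst (l^-1 : R)).
by rewrite subr0 mul1r; apply.
Qed.

Lemma genL_neumann n : genL (pop (neumann n) f) =
  (fun w => f w - pop (residual ^+ n) f w).
Proof.
rewrite -poly_opX mulX_neumann; apply/funext => w.
rewrite addrC -scaleN1r poly_op_lin -polyC1 poly_opC; ring.
Qed.

(** For [u = N(L) f] the left side is the functional [2 <u, f> - <u, L u>], which the corrector
    energy will bound from above. The right side comes from
    [2 N - N 'X N = N (2 - (1 - residual^n))]. *)
Lemma neumann_energy n :
  2 * Ex P (fun w => pop (neumann n) f w * f w) -
  Ex P (fun w => pop (neumann n) f w * genL (pop (neumann n) f) w) =
  Ex P (fun w => f w * pop (neumann n * (1 + residual ^+ n)) f w).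
Proof.
set N := neumann n.
have fN w : f w = pop 1%:P f w by rewrite poly_opC mul1r.
under [X in 2 * X]eq_Ex do rewrite [X in _ * X]fN.
under [X in _ - X]eq_Ex do rewrite -poly_opX.
rewrite !(poly_op_mul iid alpha_gt0)//.
have N2 := sqint_poly_op iid alpha_gt0 (N * 1%:P) f2.
have N2' := sqint_poly_op iid alpha_gt0 (N * ('X * N)) f2.
rewrite -ExZ; last exact: itgM.
rewrite -ExB; [|by apply: itgZ; exact: itgM|exact: itgM].
apply: eq_Ex => w.
have -> : N * (1 + residual ^+ n) = 2 *: (N * 1%:P) + (-1) *: (N * ('X * N)).
  by rewrite mulX_neumann scaleN1r polyC1 scaler_nat; ring.
rewrite poly_op_lin.
have -> : pop (-1 *: (N * ('X * N))) f w = - pop (N * ('X * N)) f w.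
  by rewrite -[-1 *: _]addr0 poly_op_lin poly_op0; ring.
by ring.
Qed.

(** * The corrector energy as the spectral integral of [1 / l] *)

Section Energy.
Variables (V : 'I_d -> env R d -> R) (U : nat -> env R d -> R).
Hypothesis V2 : vsqint P V.
Hypothesis VP : forall u, sqint P u ->
  Ex P (fun w => u w * f w) = eform P V (dgrad u).
Hypothesis U2 : forall n, sqint P (U n).
Hypothesis VU : eform P (fun i w => V i w - dgrad (U n) i w)
    (fun i w => V i w - dgrad (U n) i w) @[n --> \oo] --> (0 : R).

Local Notation b := (eform P V V).

Lemma eform_sub_sqr u : sqint P u ->
  eform P (fun i w => V i w - dgrad u i w) (fun i w => V i w - dgrad u i w) =
  b - (2 * eform P V (dgrad u) - eform P (dgrad u) (dgrad u)).
Proof.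
move=> u2; have D2 := vsqint_dgrad iid u2.
by rewrite (eform_sqrB iid alpha_gt0)//; ring.
Qed.

(** By completing the square, [2 <V, Du>_A - <Du, Du>_A] never exceeds [<V, V>_A]. For [u = N(L) f]
    it equals the integral of [N (1 + residual^n)], which dominates that of [N]. *)
Lemma spectral_neumann_le n :
  (\int[e]_(l in `[0%R, M]%classic) ((neumann n).[l])%:E <= b%:E)%E.
Proof.
have u2 := sqint_poly_op iid alpha_gt0 (neumann n) f2.
have D2 := vsqint_dgrad iid u2.
have N0 l : 0 <= l <= M -> 0 <= (neumann n * (1 + residual ^+ n)).[l].
  move=> lM; rewrite hornerM mulr_ge0 ?neumann_ge0//.
  have /andP[r0 _] := residual_itv lM.
  by rewrite hornerD horner_exp hornerC addr_ge0// exprn_ge0.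
have mp (p : {poly R}) : measurable_fun `[0, M]%classic (fun l => p.[l]%:E).
  apply/measurable_EFinP; apply: measurable_funTS.
  by apply: continuous_measurable_fun; exact: continuous_horner.
apply: (@le_trans _ _ (\int[e]_(l in `[0%R, M]%classic)
    ((neumann n * (1 + residual ^+ n)).[l])%:E)%E).
  apply: ge0_le_integral => //.
  - by move=> l /=; rewrite in_itv/= lee_fin; exact: neumann_ge0.
  - move=> l /=; rewrite in_itv/= lee_fin => lM.
    rewrite hornerM hornerD hornerC horner_exp ler_peMr ?neumann_ge0//.
    by have /andP[r0 _] := residual_itv lM; rewrite lerDl exprn_ge0.
rewrite spectral_poly// lee_fin -neumann_energy VP// (genL_form iid alpha_gt0)//.
rewrite -subr_ge0 -eform_sub_sqr//; apply: (eform_ge0 iid alpha_gt0).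
by move=> i; exact: sqintB.
Qed.

(** At the origin [neumann n] takes the value [n / M], so an atom there would push its integral
    above the energy for large [n]. *)
Lemma spectral_atom0 : e [set 0%R] = 0%E.
Proof.
have b0 : 0 <= b by exact: (eform_ge0 iid alpha_gt0).
have mp (p : {poly R}) : measurable_fun `[0, M]%classic (fun l => p.[l]%:E).
  apply/measurable_EFinP; apply: measurable_funTS.
  by apply: continuous_measurable_fun; exact: continuous_horner.
have N0 n : (neumann n).[0] = n%:R / M.
  rewrite hornerZ horner_sum mulrC; congr (_ * _).
  rewrite (eq_bigr (fun=> 1)) ?sumr_const ?card_ord// => i _.
  by rewrite horner_exp !hornerE ?mulr0 ?subr0 ?expr1n.
have H n : ((n%:R / M)%:E * e [set 0%R] <= b%:E)%E.
  apply: le_trans (spectral_neumann_le n).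
  rewrite -integral_cst//.
  apply: (@le_trans _ _ (\int[e]_(l in [set 0%R]) ((neumann n).[l])%:E)%E).
    rewrite le_eqVlt; apply/orP; left; apply/eqP; apply: eq_integral => l.
    by rewrite inE/= => ->; rewrite N0.
  apply: ge0_subset_integral => //.
  - by move=> l /=; rewrite in_itv/= lee_fin; exact: neumann_ge0.
  - by move=> l /= ->; rewrite in_itv/= lexx ltW.
have e0 : (0 <= e [set 0%R])%E by exact: measure_ge0.
(* The case [n = 1] excludes an infinite atom, so that the Archimedean argument below concerns real
   numbers. *)
have fin : e [set 0%R] \is a fin_num.
  rewrite ge0_fin_numE// ltNge leye_eq; apply/eqP => ey.
  have := H 1%N; rewrite ey gt0_muley ?leNgt ?ltry//.
  by rewrite lte_fin divr_gt0.
rewrite -(fineK fin); congr (_%:E).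
apply/eqP; rewrite eq_le fine_ge0// andbT leNgt; apply/negP => f0.
have [n nb] : exists n : nat, M * b / fine (e [set 0%R]) < n%:R.
  by exists (Num.truncn (M * b / fine (e [set 0%R]))).+1; exact: truncnS_gt.
have := H n; rewrite -(fineK fin) -EFinM lee_fin.
rewrite mulrAC ler_pdivrMr// leNgt [b * M]mulrC -ltr_pdivrMr//.
by rewrite nb.
Qed.

Lemma spectral_poly_oc (p : {poly R}) : (forall l, 0 <= l <= M -> 0 <= p.[l]) ->
  (\int[e]_(l in `]0%R, M]%classic) (p.[l])%:E =
   (Ex P (fun w => f w * pop p f w)%R)%:E)%E.
Proof.
move=> p0; rewrite -(spectral_poly p0).
rewrite [RHS](@ge0_negligible_integral _ _ _ e _ [set 0%R])//; last 2 first.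
- apply/measurable_EFinP; apply: measurable_funTS.
  by apply: continuous_measurable_fun; exact: continuous_horner.
- exact: spectral_atom0.
congr (integral _ _ _); apply/seteqP; split=> l /=; rewrite !in_itv/=.
  move=> /andP[l0 ->]; rewrite (ltW l0); split=> // l0'.
  by rewrite l0' ltxx in l0.
move=> [/andP[l0 ->] /eqP]; rewrite andbT lt_neqAle eq_sym => ->.
by rewrite l0.
Qed.

Let minv : measurable_fun `]0%R, M]%classic (fun l : R => (l^-1)%:E).
Proof.
apply/measurable_EFinP; apply: measurable_fun_continuous_in => // l /=.
by rewrite in_itv/= => /andP[l0 _]; apply: inv_continuous; rewrite gt_eqF.
Qed.

Let mpoly (p : {poly R}) : measurable_fun `]0%R, M]%classic (fun l => p.[l]%:E).
Proof.
apply/measurable_EFinP; apply: measurable_funTS.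
by apply: continuous_measurable_fun; exact: continuous_horner.
Qed.

Let oc_cc l : `]0%R, M]%classic l -> 0 <= l <= M.
Proof. by rewrite /= in_itv/= => /andP[/ltW -> ->]. Qed.

Lemma spectral_inv_le :
  (\int[e]_(l in `]0%R, M]%classic) (l^-1)%:E <= b%:E)%E.
Proof.
have -> : (\int[e]_(l in `]0%R, M]%classic) (l^-1)%:E =
    \int[e]_(l in `]0%R, M]%classic) limn (fun n => ((neumann n).[l])%:E))%E.
  apply: eq_integral => l; rewrite inE/= in_itv/= => lM.
  apply/esym/cvg_lim => //; apply/cvg_EFin; first exact: nearW.
  exact: neumann_cvg.
rewrite monotone_convergence//; last 2 first.
- by move=> n l /oc_cc lM; rewrite lee_fin neumann_ge0.
- by move=> l /oc_cc lM n m nm; rewrite lee_fin neumann_nd.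
apply: lime_le.
  apply: ereal_nondecreasing_is_cvgn => n m nm; apply: ge0_le_integral => //.
  - by move=> l /oc_cc lM; rewrite lee_fin neumann_ge0.
  - by move=> l /oc_cc lM; rewrite lee_fin neumann_nd.
apply: nearW => n.
rewrite spectral_poly_oc; last by move=> l; exact: neumann_ge0.
by rewrite -spectral_poly ?spectral_neumann_le// => l; exact: neumann_ge0.
Qed.

Let I := fine (\int[e]_(l in `]0%R, M]%classic) (l^-1)%:E)%E.

Let I_fin : (\int[e]_(l in `]0%R, M]%classic) (l^-1)%:E)%E \is a fin_num.
Proof.
rewrite ge0_fin_numE; first exact: le_lt_trans spectral_inv_le (ltry _).
apply: integral_ge0 => l /oc_cc /andP[l0 _].
by rewrite lee_fin invr_ge0.
Qed.

(** The norm is the integral of [residual^(2n)], which decays pointwise on []0, M]] and is dominated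
    by 1, integrable as the mass is finite. At the origin the residual equals 1; there the absence
    of an atom is essential. *)
Lemma residual_sqint_cvg0 :
  Ex P (fun w => pop (residual ^+ n) f w ^+ 2) @[n --> \oo] --> (0 : R).
Proof.
have resE n : Ex P (fun w => pop (residual ^+ n) f w ^+ 2) =
    fine (\int[e]_(l in `]0%R, M]%classic) ((residual ^+ n * residual ^+ n).[l])%:E)%E.
  under eq_Ex do rewrite expr2.
  rewrite (poly_op_mul iid alpha_gt0)// spectral_poly_oc// => l _.
  by rewrite hornerM -expr2 sqr_ge0.
under eq_fun do rewrite resE.
have [] := @dominated_convergence _ _ _ e `]0%R, M]%classic _
  (fun n l => ((residual ^+ n * residual ^+ n).[l])%:E) (cst 0%E) (cst 1%E).
- by [].
- by move=> n; exact: mpoly.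
- exact: measurable_cst.
- apply: aeW => l /=; rewrite in_itv/= => lM.
  apply/cvg_EFin; first exact: nearW.
  have := cvgM (residual_cvg0 lM) (residual_cvg0 lM); rewrite mulr0.
  by under [in X in _ -> X]eq_fun do rewrite hornerM horner_exp; apply.
- apply/integrableP; split; first exact: measurable_cst.
  under eq_integral do rewrite /= normr1.
  rewrite integral_cst// mul1e.
  apply: (@le_lt_trans _ _ (e `[0, M]%classic)).
    by apply: le_measure; rewrite ?inE// => l /oc_cc; rewrite /= in_itv.
  by rewrite spectral_mass ltry.
- apply: aeW => l n /oc_cc lM /=; rewrite lee_fin.
  have /andP[r0 r1] := residual_itv lM.
  rewrite hornerM horner_exp ger0_norm ?mulr_ge0 ?exprn_ge0//.
  by rewrite mulr_ile1 ?exprn_ge0 ?exprn_ile1.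
move=> _ _; rewrite integral0 => H.
exact: (fine_cvg H).
Qed.

Lemma eform_neumann_le n :
  eform P (dgrad (pop (neumann n) f)) (dgrad (pop (neumann n) f)) <= I.
Proof.
have u2 := sqint_poly_op iid alpha_gt0 (neumann n) f2.
rewrite -(genL_form iid alpha_gt0)//.
under eq_Ex do rewrite -poly_opX.
rewrite (poly_op_mul iid alpha_gt0)//.
have p0 l : 0 <= l <= M -> 0 <= (neumann n * ('X * neumann n)).[l].
  move=> lM; rewrite !hornerM hornerX mulr_ge0 ?neumann_ge0//.
  by have /andP[] := mul_neumann_itv n lM.
rewrite -lee_fin /I -(spectral_poly_oc p0) fineK//; apply: ge0_le_integral => //.
  by move=> l /oc_cc lM; rewrite lee_fin p0.
move=> l lM; have lM' := oc_cc lM; rewrite lee_fin !hornerM hornerX.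
apply: (@le_trans _ _ (neumann n).[l]).
  by rewrite ler_piMr ?neumann_ge0//; have /andP[] := mul_neumann_itv n lM'.
by apply: neumann_le_inv; move: lM; rewrite /= in_itv.
Qed.

(** With [u_n = neumann n (L) f] and [f = L u_n + residual^n (L) f], one gets
    [<V, Du>_A = <Du, Du_n>_A + o(1)] for fixed [u], and [2 <Du, Du_n>_A - <Du, Du>_A <= <Du_n,
    Du_n>_A <= I]. After [n] tends to infinity, [u] runs through the sequence [U], whose gradients
    tend to [V]. *)
Lemma energy_le_spectral_inv : b <= I.
Proof.
have key u : sqint P u ->
    b - eform P (fun i w => V i w - dgrad u i w) (fun i w => V i w - dgrad u i w)
      <= I.
  move=> u2; have D2 := vsqint_dgrad iid u2; rewrite eform_sub_sqr// subKr.
  pose un n := pop (neumann n) f.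
  have un2 n : sqint P (un n) by exact: (sqint_poly_op iid alpha_gt0).
  have r2 n : sqint P (pop (residual ^+ n) f) by exact: (sqint_poly_op iid alpha_gt0).
  have ur0 : Ex P (fun w => u w * pop (residual ^+ n) f w) @[n --> \oo] --> (0 : R).
    apply: (@cvg0_sqr _ _ (fun n => Ex P (fun w => u w ^+ 2) *
        Ex P (fun w => pop (residual ^+ n) f w ^+ 2))).
      by move=> n; exact: cauchy_schwarz_Ex.
    have := cvgM (cvg_cst (Ex P (fun w => u w ^+ 2))) residual_sqint_cvg0.
    by rewrite mulr0; apply.
  have bound n : 2 * eform P V (dgrad u) - eform P (dgrad u) (dgrad u) <=
      I + 2 * Ex P (fun w => u w * pop (residual ^+ n) f w).
    have E1 : eform P V (dgrad u) = eform P (dgrad u) (dgrad (un n)) +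
        Ex P (fun w => u w * pop (residual ^+ n) f w).
      rewrite -VP// -(genL_form iid alpha_gt0)// -ExD; [|
        by apply: itgM => //; exact: (sqint_genL iid alpha_gt0)|exact: itgM].
      by apply: eq_Ex => w; rewrite genL_neumann; ring.
    have un2' := vsqint_dgrad iid (un2 n).
    have W2 : vsqint P (fun i w => dgrad u i w - dgrad (un n) i w).
      by move=> i; exact: sqintB.
    have := eform_ge0 iid alpha_gt0 W2.
    rewrite (eform_sqrB iid alpha_gt0)//.
    have := eform_neumann_le n; rewrite -/(un n) E1; lra.
  have lim0 : I + 2 * Ex P (fun w => u w * pop (residual ^+ n) f w)
      @[n --> \oo] --> I.
    by have := cvgD (cvg_cst I) (cvgM (cvg_cst (2 : R)) ur0); rewrite mulr0 addr0; apply.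
  rewrite -(cvg_lim _ lim0)//; apply: limr_ge; first by apply/cvg_ex; exists I.
  exact: nearW.
have lim0 : b - eform P (fun i w => V i w - dgrad (U n) i w)
    (fun i w => V i w - dgrad (U n) i w) @[n --> \oo] --> b.
  by have := cvgB (cvg_cst b) VU; rewrite subr0; apply.
rewrite -(cvg_lim _ lim0)//; apply: limr_le; first by apply/cvg_ex; exists b.
by apply: nearW => n; exact: key.
Qed.

Lemma spectral_invE : (\int[e]_(l in `]0%R, M]%classic) (l^-1)%:E = b%:E)%E.
Proof.
apply/eqP; rewrite eq_le spectral_inv_le -(fineK I_fin) lee_fin.
exact: energy_le_spectral_inv.
Qed.

End Energy.
End SpectralMeasure.

(** * The spectral weight *)

Section Weight.
Variable R : realType.
Implicit Types (k : nat) (mu l : R).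

(* [1/l - P_k/D_k = weight k mu l / l] *)
Definition weight k mu l : R :=
  \prod_(j < k) ((2 ^+ j * mu) / (2 ^+ j * mu + l)) ^+ 2.

Lemma weightS k mu l : weight k.+1 mu l =
  weight k mu l * ((2 ^+ k * mu) / (2 ^+ k * mu + l)) ^+ 2.
Proof. by rewrite /weight big_ord_recr. Qed.

Lemma weight_factor j mu l : 0 < mu -> 0 <= l ->
  0 <= (2 ^+ j * mu) / (2 ^+ j * mu + l) <= 1.
Proof.
move=> mu0 l0; have a0 : 0 < 2 ^+ j * mu by rewrite mulr_gt0 ?exprn_gt0.
have b0 : 0 < 2 ^+ j * mu + l by rewrite ltr_wpDr.
rewrite (divr_ge0 (ltW a0) (ltW b0))/=.
by rewrite ler_pdivrMr// mul1r lerDl.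
Qed.

Lemma weight_ge0 k mu l : 0 <= weight k mu l.
Proof. by apply: prodr_ge0 => j _; exact: sqr_ge0. Qed.

Lemma weight_nincr k k' mu l : 0 < mu -> 0 <= l -> (k <= k')%N ->
  weight k' mu l <= weight k mu l.
Proof.
move=> mu0 l0 /subnKC <-; elim: (k' - k)%N => [|n ih]; first by rewrite addn0.
rewrite addnS weightS; apply: le_trans ih; rewrite ler_piMr ?weight_ge0//.
by rewrite exprn_ile1//; have /andP[] := weight_factor (k + n) mu0 l0.
Qed.

Lemma weight_le1 k mu l : 0 < mu -> 0 <= l -> weight k mu l <= 1.
Proof.
move=> mu0 l0; apply: le_trans (weight_nincr mu0 l0 (leq0n k)) _.
by rewrite /weight big_ord0.
Qed.

Definition weight_cst k : R := \prod_(j < k) (2 ^+ j) ^+ 2.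

Lemma weight_cst_gt0 k : 0 < weight_cst k.
Proof. by apply: prodr_gt0 => j _; rewrite !exprn_gt0. Qed.

(** Dropping [2^j mu] from each denominator leaves [(2^j mu / l)^2]. *)
Lemma weight_le_pow k mu l : 0 < mu -> 0 < l ->
  weight k mu l <= weight_cst k * (mu / l) ^+ (2 * k).
Proof.
move=> mu0 l0; have -> : weight_cst k * (mu / l) ^+ (2 * k) =
    \prod_(j < k) ((2 ^+ j) ^+ 2 * (mu / l) ^+ 2).
  by rewrite big_split/= prodr_const card_ord exprM.
apply: ler_prod => j _; rewrite sqr_ge0 -exprMn lerXn2r ?nnegrE//.
- by have /andP[] := weight_factor j mu0 (ltW l0).
- by rewrite mulr_ge0 ?exprn_ge0 ?divr_ge0 ?ltW.
rewrite mulrA ler_wpM2l//; first by rewrite mulr_ge0 ?exprn_ge0 ?ltW.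
by rewrite lef_pV2 ?posrE ?lerDr ?addr_gt0 ?mulr_ge0 ?mulr_gt0 ?exprn_ge0 ?exprn_gt0// ltW.
Qed.

(** With [t = l / mu], factor [j] is [(1 + t / 2^j)^-2 >= exp (- 2 t / 2^j)], and the coefficients
    [2 / 2^j] sum to [4 - 4 / 2^k]. The induction carries this exact sum; replacing it by 4 makes
    the bound uniform in [k]. *)
Lemma weight_ge_exp k mu l : 0 < mu -> 0 <= l ->
  expR (- (4 * (l / mu))) <= weight k mu l.
Proof.
move=> mu0 l0; set t := l / mu; have t0 : 0 <= t by rewrite divr_ge0// ltW.
apply: (@le_trans _ _ (expR (- ((4 - 4 / 2 ^+ k) * t)))).
  by rewrite ler_expR lerN2 ler_wpM2r// gerBl divr_ge0// exprn_ge0.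
elim: k => [|k ih].
  by rewrite /weight big_ord0 expr0 divr1 subrr mul0r oppr0 expR0.
have p0 : 0 < 2 ^+ k :> R by rewrite exprn_gt0.
rewrite weightS (_ : - _ = - ((4 - 4 / 2 ^+ k) * t) + (- (t / 2 ^+ k)) *+ 2); last first.
  by rewrite exprS; field; rewrite gt_eqF.
rewrite expRD mulr2n [expR (_ + _)]expRD -expr2; apply: ler_pM; rewrite ?expR_ge0 ?sqr_ge0//.
rewrite lerXn2r ?nnegrE ?expR_ge0//.
  by have /andP[] := weight_factor k mu0 l0.
rewrite expRN -[leRHS]invrK lef_pV2 ?posrE ?expR_gt0//; last first.
  by rewrite invr_gt0 divr_gt0 ?mulr_gt0// ltr_wpDr// mulr_gt0.
rewrite invf_div mulrDl divff ?gt_eqF ?mulr_gt0//.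
rewrite (_ : l / _ = t / 2 ^+ k); first exact: expR_ge1Dx.
by rewrite /t; field; rewrite !gt_eqF.
Qed.

(** Before squaring, each factor is at least [mu] times its value at [mu = 1], because
    [2^j mu + l <= 2^j + l]; then [weight_ge_exp] applies at [mu = 1]. *)
Lemma weight_ge_pow k mu l : 0 < mu <= 1 -> 0 <= l ->
  mu ^+ (2 * k) * expR (- (4 * l)) <= weight k mu l.
Proof.
move=> /andP[mu0 mu1] l0.
apply: (@le_trans _ _ (mu ^+ (2 * k) * weight k 1 l)).
  apply: ler_wpM2l; first by rewrite exprn_ge0// ltW.
  by have := @weight_ge_exp k 1 l ltr01 l0; rewrite divr1.
have -> : mu ^+ (2 * k) * weight k 1 l =
    \prod_(j < k) (mu ^+ 2 * ((2 ^+ j * 1) / (2 ^+ j * 1 + l)) ^+ 2).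
  by rewrite big_split/= prodr_const card_ord exprM.
apply: ler_prod => j _; have p0 : 0 < 2 ^+ j :> R by rewrite exprn_gt0.
rewrite mulr1 -exprMn sqr_ge0 lerXn2r ?nnegrE//.
- exact: mulr_ge0 (ltW mu0) (divr_ge0 (ltW p0) (addr_ge0 (ltW p0) l0)).
- by have /andP[] := weight_factor j mu0 l0.
rewrite mulrCA mulrA; apply: ler_wpM2l; first by rewrite mulr_ge0 ?ltW.
rewrite lef_pV2 ?posrE ?ltr_wpDr ?mulr_gt0//.
by rewrite lerD2r ler_piMr// ltW.
Qed.

Lemma Dpoly_gt0 k mu l : 0 < mu -> 0 <= l -> 0 < (Dpoly k mu).[l].
Proof.
move=> mu0 l0; rewrite /Dpoly horner_prod; apply: prodr_gt0 => j _.
by rewrite horner_exp !hornerE exprn_gt0// ltr_wpDr// mulr_gt0// exprn_gt0.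
Qed.

Lemma weightE k mu l : 0 < mu -> 0 <= l ->
  weight k mu l = 2 ^+ (k * k.-1) * mu ^+ (2 * k) / (Dpoly k mu).[l].
Proof.
move=> mu0 l0; rewrite /Dpoly horner_prod.
have -> : 2 ^+ (k * k.-1) * mu ^+ (2 * k) = \prod_(j < k) (2 ^+ j * mu) ^+ 2.
  elim: k => [|k ih]; first by rewrite big_ord0 !expr0 mulr1.
  rewrite big_ord_recr/= -ih exprMn -exprM.
  have -> : (k.+1 * k = k * k.-1 + k * 2)%N by case: k {ih} => //= k; lia.
  by rewrite (mulnSr 2 k) !exprD mulrACA !mulrA.
rewrite /weight -prodf_div; apply: eq_bigr => j _.
by rewrite horner_exp !hornerE expr_div_n.
Qed.

(** The constant subtracted in [Ppoly] is the value of [Dpoly] at 0, as [weightE] at [l = 0] shows,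
    so the division by ['X] has no remainder and can be undone. *)
Lemma Ppoly_div k mu l : 0 < mu -> 0 < l ->
  (Ppoly k mu).[l] / (Dpoly k mu).[l] = l^-1 - weight k mu l / l.
Proof.
move=> mu0 l0; rewrite weightE ?ltW//.
set c := 2 ^+ _ * _; have D0 := Dpoly_gt0 k mu0 (ltW l0).
suff H : (Ppoly k mu).[l] * l = (Dpoly k mu).[l] - c.
  have -> : (Ppoly k mu).[l] = ((Dpoly k mu).[l] - c) / l.
    by rewrite -H mulfK// gt_eqF.
  by field; rewrite !gt_eqF.
have dv : 'X %| Dpoly k mu - c%:P.
  rewrite -['X]subr0 -polyC0 dvdp_XsubCl /root !hornerE subr_eq0.
  have := weightE k mu0 (lexx 0).
  have -> : weight k mu 0 = 1.
    rewrite /weight big1// => j _; rewrite addr0 divff ?expr1n//.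
    by rewrite mulf_neq0 ?expf_neq0 ?gt_eqF.
  move=> H; apply/eqP; apply: (@mulIf _ (Dpoly k mu).[0]^-1).
    by rewrite invr_eq0 gt_eqF// Dpoly_gt0.
  by rewrite -H divff// gt_eqF// Dpoly_gt0.
have := congr1 (horner^~ l) (divpK dv); rewrite /= -/(Ppoly k mu).
by rewrite !hornerE.
Qed.

End Weight.

(** * Dyadic estimates *)

Section SeriesBounds.
Variable R : realType.
Implicit Types (x y a s q : R) (n : nat).

Lemma dyadic_scale y : 1 <= y -> exists n, 2 ^+ n <= y < 2 ^+ n.+1.
Proof.
move=> y1; have ex : exists n, y < 2 ^+ n.
  exists (Num.truncn y).+1; apply: lt_le_trans (truncnS_gt y) _.
  by rewrite -natrX ler_nat ltnW// ltn_expl.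
case: (ex_minnP ex) => -[|n]; first by rewrite expr0 ltNge y1.
move=> yn nmin; exists n; rewrite yn andbT leNgt; apply/negP => /nmin.
by rewrite ltnn.
Qed.

Lemma geom_sum_le (r : R) n : 0 <= r < 1 -> \sum_(i < n) r ^+ i <= (1 - r)^-1.
Proof.
move=> /andP[r0 r1]; have p : 0 < 1 - r by rewrite subr_gt0.
rewrite -[leRHS]mul1r ler_pdivlMr// mulrC -opprB mulNr -subrX1 opprB.
by rewrite gerBl exprn_ge0.
Qed.

Lemma pow_le_expR x (m : nat) : 0 <= x -> (x / m.+1%:R) ^+ m.+1 <= expR x.
Proof.
move=> x0; have -> : expR x = expR (x / m.+1%:R) ^+ m.+1.
  by rewrite -expRM_natl mulrC divfK// pnatr_eq0.
rewrite lerXn2r ?nnegrE ?expR_ge0 ?divr_ge0//.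
by apply: le_trans (expR_ge1Dx _); rewrite lerDr.
Qed.

(** With [r = s * s], one power [s ^+ i] absorbs the polynomial factor and the other leaves a
    convergent geometric series. *)
Lemma poly_geom_sum_le (r q : R) : 0 < r < 1 -> 0 <= q ->
  exists2 S, 0 < S & forall n, \sum_(i < n) r ^+ i * i.+1%:R `^ q <= S.
Proof.
move=> /andP[r0 r1] q0; pose s := Num.sqrt r.
have s0 : 0 < s by rewrite sqrtr_gt0.
have s1 : s < 1 by rewrite -[ltRHS]sqrtr1 ltr_sqrt.
have rE : r = s * s by rewrite -expr2 sqr_sqrtr// ltW.
pose t := - ln s; have t0 : 0 < t by rewrite oppr_gt0 ln_lt0// s0.
have sE i : s ^+ i = expR (- (i%:R * t)).
  by rewrite /t mulrN opprK expRM_natl lnK// posrE.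
pose m := Num.truncn q; have qm : q <= m.+1%:R by rewrite ltW// truncnS_gt.
(* [pow_le_expR] at [x = (i + 1) t] bounds [(i + 1)^(m + 1)] by
   [((m + 1) / t)^(m + 1) exp ((i + 1) t)], while [s ^+ i = exp (- i t)]; the factor [exp t] is what
   remains. *)
pose K := (m.+1%:R / t) ^+ m.+1 * expR t.
have K0 : 0 < K by rewrite mulr_gt0 ?expR_gt0 ?exprn_gt0 ?divr_gt0.
have bound i : s ^+ i * i.+1%:R `^ q <= K.
  apply: (@le_trans _ _ (s ^+ i * i.+1%:R ^+ m.+1)).
    apply: ler_wpM2l; first by rewrite exprn_ge0// ltW.
    by rewrite -powR_mulrn// ler_powR// ler1n.
  have it0 : 0 <= i.+1%:R * t by rewrite mulr_ge0// ltW.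
  have := pow_le_expR m it0; rewrite -mulrA exprMn => H.
  rewrite sE /K expRN ler_pdivrMl ?expR_gt0// mulrCA -expRD.
  have tm : 0 < (t / m.+1%:R) ^+ m.+1 by rewrite exprn_gt0// divr_gt0.
  rewrite -(ler_pM2r tm); apply: le_trans H _.
  have E : (m.+1%:R / t) ^+ m.+1 * (t / m.+1%:R) ^+ m.+1 = 1.
    rewrite -exprMn (_ : _ * _ = 1) ?expr1n//.
    by field; rewrite gt_eqF//= ?nat1r ?pnatr_eq0 ?gt_eqF.
  rewrite mulrAC E mul1r.
  by rewrite ler_expR -natr1 mulrDl mul1r.
exists (K * (1 - s)^-1); first by rewrite mulr_gt0// invr_gt0 subr_gt0.
move=> n; apply: (@le_trans _ _ (\sum_(i < n) K * s ^+ i)).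
  apply: ler_sum => i _; rewrite rE exprMn -mulrA mulrC ler_wpM2r//.
  by rewrite exprn_ge0// ltW.
rewrite -mulr_sumr; apply: ler_wpM2l; first exact: ltW.
by apply: geom_sum_le; rewrite (ltW s0).
Qed.

Lemma lnp_ge1 x : 1 <= lnp x.
Proof. by rewrite /lnp le_max lexx orbT. Qed.

Lemma lnp_gt0 x : 0 < lnp x.
Proof. by rewrite (lt_le_trans ltr01)// lnp_ge1. Qed.

Lemma lnp_homo x y : 0 < x -> x <= y -> lnp x <= lnp y.
Proof.
move=> x0 xy; rewrite /lnp ge_max !le_max lexx orbT andbT.
by rewrite ler_ln ?posrE ?xy// (lt_le_trans x0).
Qed.

Lemma ln2_le1 : ln 2 <= 1 :> R.
Proof.
have := @le_ln1Dx R 1; rewrite (_ : 1 + 1 = 2); first by apply; lra.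
by [].
Qed.

Lemma ln2_gt0 : 0 < ln 2 :> R.
Proof. by rewrite ln_gt0// ltr1n. Qed.

(** As [ln 2 <= 1], the logarithm grows by at most [n], and [lnp >= 1] lets this be absorbed into a
    factor. *)
Lemma lnp_dyadic a n : 0 < a -> lnp (a / 2 ^+ n)^-1 <= n.+1%:R * lnp a^-1.
Proof.
move=> a0; have L1 := lnp_ge1 a^-1; have n0 : 0 <= n%:R :> R by [].
have La : ln a^-1 <= lnp a^-1 by rewrite /lnp le_max lexx.
move: (lnp a^-1) L1 La => L L1 La.
rewrite /lnp ge_max -[n.+1%:R]natr1; apply/andP; split; last by nra.
rewrite invf_div lnM ?posrE ?exprn_gt0 ?invr_gt0// lnXn// -[ln 2 *+ n]mulr_natr.
rewrite mulrDl mul1r; apply: lerD => //.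
by rewrite mulrC ler_wpM2l// (le_trans ln2_le1).
Qed.

Lemma powR_exprn x n s : 0 <= x -> (x ^+ n) `^ s = (x `^ s) ^+ n.
Proof.
by move=> x0; rewrite -powR_mulrn// -powRrM mulrC powRrM powR_mulrn ?powR_ge0.
Qed.

Lemma powR_split x s (p : nat) : 0 < x -> x `^ s = x `^ (s - p%:R) * x ^+ p.
Proof.
move=> x0; rewrite -powR_mulrn ?ltW// -powRD ?subrK//.
by apply/implyP => _; rewrite gt_eqF.
Qed.

End SeriesBounds.

(** * Spectral integrals bounded by sums over scales *)

Section Domination.
Variables (R : realType) (e : {measure set R -> \bar R}).

(** The integrand is dominated by the sum of steps of height [H n] on [[0, x n]]. All steps start at
    0 because the spectral exponents control the mass of such intervals. *)
Lemma integral_le_series (D : set R) (h : R -> R) (x H : nat -> R) :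
  measurable D -> measurable_fun D h -> (forall l, D l -> 0 <= h l) ->
  (forall n, 0 <= H n) ->
  (forall l, D l -> exists n, 0 <= l <= x n /\ h l <= H n) ->
  (\int[e]_(l in D) (h l)%:E <= \sum_(n <oo) (H n)%:E * e `[0%R, x n]%classic)%E.
Proof.
move=> mD mh h0 H0 dom.
have t0 n l : (0 <= (H n * \1_(`[0, x n]%classic) l)%:E)%E.
  by rewrite lee_fin mulr_ge0.
have mt n : measurable_fun D (fun l => (H n * \1_(`[0, x n]%classic) l)%:E).
  apply/measurable_EFinP; apply: measurable_funM => //.
apply: (@le_trans _ _ (\int[e]_(l in D)
    \sum_(n <oo) (H n * \1_(`[0%R, x n]%classic) l)%:E)%E).
  apply: ge0_le_integral => //.
  - exact/measurable_EFinP.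
  - by apply: (@ge0_emeasurable_sum _ _ _ D _ xpredT).
  - move=> l Dl; have [n [lx hH]] := dom l Dl.
    apply: le_trans (nneseries_lim_ge n.+1 _); last by move=> *; exact: t0.
    rewrite big_nat_recr//=; apply: (@le_trans _ _ (H n * \1_(`[0, x n]%classic) l)%:E).
      by rewrite lee_fin indicE mem_set ?mulr1//= in_itv.
    by rewrite leeDr// sume_ge0.
rewrite integral_nneseries//; apply: lee_nneseries.
  by move=> n _ _; apply: integral_ge0 => l _; exact: t0.
move=> n _; under eq_integral do rewrite EFinM.
rewrite ge0_integralZl// ?lee_fin//; last first.
  by apply/measurable_EFinP; exact: measurable_indic.
apply: lee_wpmul2l; first by rewrite lee_fin.
rewrite integral_indic//; apply: le_measure; rewrite ?inE//.
exact: measurableI.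
Qed.

Lemma integral_le_exponents (C0 gamma q : R) (D : set R) (h : R -> R)
    (x H B : nat -> R) (S : R) :
  0 <= C0 -> spectral_exponents_ge C0 e gamma q ->
  measurable D -> measurable_fun D h -> (forall l, D l -> 0 <= h l) ->
  (forall n, 0 <= H n) -> (forall n, 0 < x n) ->
  (forall l, D l -> exists n, 0 <= l <= x n /\ h l <= H n) ->
  (forall n, H n * (x n `^ gamma * lnp (x n)^-1 `^ q) <= B n) ->
  (forall n, \sum_(i < n) B i <= S) ->
  (\int[e]_(l in D) (h l)%:E <= (C0 * S)%:E)%E.
Proof.
move=> C00 eC0 mD mh h0 H0 x0 dom HB BS.
apply: le_trans (integral_le_series mD mh h0 H0 dom) _.
have pos n : (0 <= (H n)%:E * e `[0%R, x n]%classic)%E.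
  by rewrite mule_ge0 ?lee_fin.
apply: lime_le; first by apply: is_cvg_nneseries => n _ _; exact: pos.
apply: nearW => n; apply: (@le_trans _ _ (\sum_(0 <= i < n) (C0 * B i)%:E)%E).
  apply: lee_sum => i _.
  apply: (@le_trans _ _ ((H i)%:E *
      (C0 * (x i `^ gamma * lnp (x i)^-1 `^ q))%:E)%E).
    by apply: lee_wpmul2l; [rewrite lee_fin|exact: eC0].
  by rewrite -EFinM lee_fin mulrCA ler_wpM2l.
rewrite sumEFin lee_fin big_mkord -mulr_sumr.
by apply: ler_wpM2l.
Qed.

End Domination.

Section UpperBound.
Variables (R : realType) (gamma q C0 M : R).
Hypothesis q_ge0 : 0 <= q.
Hypothesis C0_gt0 : 0 < C0.
Implicit Types e : {measure set R -> \bar R}.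

Lemma measurable_inv_pow p (D : set R) : measurable D ->
  (forall l, D l -> 0 < l) -> measurable_fun D (fun l : R => (l^-1) ^+ p).
Proof.
move=> mD D0; apply: measurable_funX.
apply: measurable_fun_continuous_in => // l Dl.
by apply: inv_continuous; rewrite gt_eqF// D0.
Qed.

Lemma measurable_weight_div k mu (D : set R) : 0 < mu -> measurable D ->
  (forall l, D l -> 0 < l) -> measurable_fun D (fun l => weight k mu l / l).
Proof.
move=> mu0 mD D0; apply: measurable_funM; last first.
  have := measurable_inv_pow 1 mD D0.
  by congr measurable_fun; apply/funext => l; rewrite expr1.
elim: k => [|k ih].
  rewrite (_ : weight 0 mu = fun=> 1)//.
  by apply/funext => l; rewrite /weight big_ord0.
rewrite (_ : weight k.+1 mu = fun l => weight k mu l *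
    ((2 ^+ k * mu) / (2 ^+ k * mu + l)) ^+ 2); last first.
  by apply/funext => l; rewrite weightS.
apply: measurable_funM => //; apply: measurable_funX; apply: measurable_funM => //.
apply: measurable_fun_continuous_in => // l Dl.
apply: (@continuous_comp _ _ _ (fun l => 2 ^+ k * mu + l) GRing.inv).
  by apply: cvgD => //; exact: cvg_cst.
apply: inv_continuous; rewrite gt_eqF//; apply: addr_gt0; last exact: D0.
by rewrite mulr_gt0// exprn_gt0.
Qed.

(** On the dyadic shell just below [x n = a / 2^n] one has [1 / l <= 2 / x n]. The exponents then
    give a series in [r^n (n + 1)^q] with [r = 2^(p - gamma) < 1], the factor [(n + 1)^q] coming
    from [lnp_dyadic]. *)
Lemma integral_inv_pow_le (p : nat) : p%:R < gamma ->
  exists2 C, 0 < C & forall e, spectral_exponents_ge C0 e gamma q ->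
  forall a : R, 0 < a ->
  (\int[e]_(l in `]0%R, a]%classic) ((l^-1) ^+ p)%:E <=
   (C * (a `^ (gamma - p%:R) * lnp a^-1 `^ q))%:E)%E.
Proof.
move=> pg; set s := gamma - p%:R; have s0 : 0 < s by rewrite subr_gt0.
pose r : R := 2^-1 `^ s.
have r0 : 0 < r by apply: powR_gt0; rewrite invr_gt0.
have r1 : r < 1.
  rewrite /r -[2^-1]powR_inv1// -powRrM mulN1r powRN invf_lt1 ?powR_gt0//.
  rewrite [ltLHS](_ : _ = 1 `^ s); last by rewrite powR1.
  by apply: gt0_ltr_powR; rewrite ?nnegrE// ltr1n.
have r01 : 0 < r < 1 by rewrite r0 r1.
have [S S0 HS] := poly_geom_sum_le r01 q_ge0.
exists (C0 * (2 ^+ p * S)); first by rewrite !mulr_gt0 ?exprn_gt0.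
move=> e eC0 a a0; set L := a `^ s * _.
have L0 : 0 <= L by rewrite mulr_ge0 ?powR_ge0.
pose x n : R := a / 2 ^+ n.
have x0 n : 0 < x n by rewrite divr_gt0 ?exprn_gt0.
rewrite -mulrA -mulrA.
apply: (@integral_le_exponents _ _ _ gamma q _ _ x (fun n => (2 / x n) ^+ p)
  (fun n => 2 ^+ p * L * (r ^+ n * n.+1%:R `^ q))) => //.
- exact: ltW.
- by apply: measurable_inv_pow => // l /=; rewrite in_itv/= => /andP[].
- by move=> l /=; rewrite in_itv/= => /andP[l0 _]; rewrite exprn_ge0// invr_ge0 ltW.
- by move=> n; rewrite exprn_ge0// divr_ge0// ltW.
- move=> l /=; rewrite in_itv/= => /andP[l0 la].
  have [|n /andP[n1 n2]] := @dyadic_scale _ (a / l); first by rewrite ler_pdivlMr// mul1r.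
  exists n; have p2 : 0 < 2 ^+ n :> R by rewrite exprn_gt0.
  rewrite ler_pdivlMr// mulrC -ler_pdivlMr// n1 (ltW l0); split=> //.
  have li : l^-1 <= 2 / x n.
    rewrite /x invf_div mulrA -exprS ler_pdivlMr// mulrC.
    exact: ltW.
  rewrite lerXn2r ?nnegrE//; first by rewrite invr_ge0 ltW.
  by rewrite divr_ge0// ltW.
- move=> n; rewrite (powR_split gamma p (x0 n)) -/s.
  have -> : (2 / x n) ^+ p * (x n `^ s * x n ^+ p * lnp (x n)^-1 `^ q) =
      2 ^+ p * (x n `^ s * lnp (x n)^-1 `^ q).
    have xp : x n ^+ p != 0 by rewrite expf_neq0// gt_eqF.
    by rewrite exprMn exprVn; field.
  rewrite -mulrA; apply: ler_wpM2l; first by rewrite exprn_ge0.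
  have -> : x n `^ s = a `^ s * r ^+ n.
    by rewrite /x -exprVn powRM ?exprn_ge0 ?(ltW a0)// powR_exprn.
  rewrite /L -!mulrA; apply: ler_wpM2l; first exact: powR_ge0.
  rewrite mulrCA; apply: ler_wpM2l; first by rewrite exprn_ge0// ltW.
  have lnp0 y : 0 <= lnp y :> R by exact: ltW (lnp_gt0 y).
  rewrite [leRHS]mulrC -powRM//.
  by apply: ge0_ler_powR; rewrite ?nnegrE ?mulr_ge0// lnp_dyadic.
- move=> n; rewrite -mulr_sumr [S * L]mulrC [leRHS]mulrA.
  by apply: ler_wpM2l; [rewrite mulr_ge0// exprn_ge0|exact: HS].
Qed.

(* [Q] selects the dyadic scales below [M]; it is needed only when the ratio of
   the geometric series is 1. *)
Lemma integral_weight_above_le k (Q : pred nat) e mu S :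
  spectral_exponents_ge C0 e gamma q -> 0 < mu ->
  (forall n, 2 ^+ n * mu <= M -> Q n) ->
  (forall n, \sum_(i < n | Q i) (2 `^ (gamma - 1) * 2^-1 ^+ (2 * k)) ^+ i <= S) ->
  (\int[e]_(l in `]mu, M]%classic) (weight k mu l / l)%:E <=
   (C0 * (weight_cst R k * 2 `^ gamma * S *
     (mu `^ (gamma - 1) * lnp mu^-1 `^ q)))%:E)%E.
Proof.
move=> eC0 mu0 MQ QS; set L := mu `^ _ * _; set r := _ * 2^-1 ^+ _ in QS.
have L0 : 0 <= L by rewrite mulr_ge0 ?powR_ge0.
have k0 := weight_cst_gt0 R k.
pose z n : R := 2 ^+ n * mu.
have z0 n : 0 < z n by rewrite mulr_gt0 ?exprn_gt0.
have h20 n m : 0 <= (2^-1 ^+ n) ^+ m :> R by rewrite !exprn_ge0// invr_ge0.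
pose H n := if Q n then weight_cst R k * (2^-1 ^+ n) ^+ (2 * k) / z n else 0.
apply: (@integral_le_exponents _ _ _ gamma q _ _ (fun n => 2 * z n) H
  (fun n => if Q n then weight_cst R k * 2 `^ gamma * L * r ^+ n else 0)) => //.
- exact: ltW.
- apply: measurable_weight_div => // l /=; rewrite in_itv/= => /andP[l0 _].
  exact: lt_trans l0.
- move=> l /=; rewrite in_itv/= => /andP[l0 _].
  by rewrite divr_ge0 ?weight_ge0// ltW// (lt_trans mu0).
- move=> n; rewrite /H; case: ifP => // _.
  exact: divr_ge0 (mulr_ge0 (ltW k0) (h20 _ _)) (ltW (z0 n)).
- by move=> n; rewrite mulr_gt0.
(* On the shell [z n <= l < 2 z n] the weight is at most [weight_cst R k * 2^(- 2 k n)] and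
   [1 / l <= 1 / z n]. Against a mass of order [(2 z n)^gamma] this yields the ratio
   [2^(gamma - 1 - 2 k)]. *)
- move=> l /=; rewrite in_itv/= => /andP[ml lM].
  have l0 := lt_trans mu0 ml.
  have [|n /andP[n1 n2]] := @dyadic_scale _ (l / mu).
    by rewrite ler_pdivlMr// mul1r ltW.
  have zl : z n <= l by rewrite /z -ler_pdivlMr.
  exists n; rewrite (ltW l0) /z mulrA -exprS -ler_pdivrMr// (ltW n2); split=> //.
  rewrite /H MQ; last exact: le_trans lM.
  apply: ler_pM; rewrite ?weight_ge0 ?invr_ge0 ?(ltW l0)//; last first.
    by rewrite lef_pV2 ?posrE.
  apply: le_trans (weight_le_pow k mu0 l0) _.
  apply: ler_wpM2l; first exact: ltW.
  rewrite lerXn2r ?nnegrE ?divr_ge0 ?exprn_ge0 ?invr_ge0 ?(ltW mu0) ?(ltW l0)//.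
  by rewrite ler_pdivrMr// exprVn mulrC ler_pdivlMr ?exprn_gt0// mulrC.
- move=> n; rewrite /H; case: (Q n); last by rewrite mul0r.
  have -> : (2 * z n) `^ gamma = 2 `^ gamma * (z n * (mu `^ (gamma - 1) * (2 `^ (gamma - 1)) ^+ n)).
    rewrite powRM ?(ltW (z0 n))//; congr (_ * _).
    rewrite (powR_split gamma 1 (z0 n)) expr1 mulrC; congr (_ * _).
    by rewrite /z powRM ?exprn_ge0 ?(ltW mu0)// powR_exprn// mulrC.
  have -> : weight_cst R k * (2^-1 ^+ n) ^+ (2 * k) / z n *
     (2 `^ gamma * (z n * (mu `^ (gamma - 1) * (2 `^ (gamma - 1)) ^+ n)) *
      lnp (2 * z n)^-1 `^ q) =
     weight_cst R k * 2 `^ gamma * r ^+ n * (mu `^ (gamma - 1) * lnp (2 * z n)^-1 `^ q).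
    rewrite /r exprMn -!exprM (mulnC n).
    by field; rewrite gt_eqF.
  rewrite [leRHS]mulrAC; apply: ler_wpM2l.
    by rewrite !mulr_ge0 ?exprn_ge0 ?mulr_ge0 ?exprn_ge0 ?powR_ge0 ?(ltW k0)// invr_ge0.
  rewrite /L; apply: ler_wpM2l; first exact: powR_ge0.
  apply: ge0_ler_powR => //; rewrite ?nnegrE ?(ltW (lnp_gt0 _))//.
  apply: lnp_homo; first by rewrite invr_gt0 mulr_gt0.
  rewrite lef_pV2 ?posrE ?mulr_gt0// /z mulrA -exprS.
  by rewrite ler_peMl ?(ltW mu0)// exprn_ege1// ler1n.
- move=> n; rewrite -big_mkcond -mulr_sumr [leRHS]mulrAC.
  by apply: ler_wpM2l => //; rewrite !mulr_ge0 ?powR_ge0 ?(ltW k0).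
Qed.

End UpperBound.

Section WeightIntegral.
Variables (R : realType) (M : R).
Hypothesis M_ge1 : 1 <= M.
Implicit Types e : {measure set R -> \bar R}.

Let M_gt0 : 0 < M. Proof. exact: lt_le_trans ltr01 M_ge1. Qed.

Let weight_div_ge0 k mu l : 0 < l -> (0 <= (weight k mu l / l : R)%:E)%E.
Proof. by move=> l0; rewrite lee_fin divr_ge0 ?weight_ge0// ltW. Qed.

Let itv_gt0 (a b l : R) : 0 <= a -> `]a, b]%classic l -> 0 < l.
Proof. by move=> a0; rewrite /= in_itv/= => /andP[al _]; exact: le_lt_trans al. Qed.

Let mweight k mu (a b : R) : 0 < mu -> 0 <= a ->
  measurable_fun `]a, b]%classic (fun l => (weight k mu l / l)%:E).
Proof.
move=> mu0 a0; apply/measurable_EFinP; apply: measurable_weight_div => // l.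
exact: itv_gt0.
Qed.

Let minv (p : nat) (a b : R) : 0 <= a ->
  measurable_fun `]a, b]%classic (fun l : R => ((l^-1) ^+ p)%:E).
Proof.
move=> a0; apply/measurable_EFinP; apply: measurable_inv_pow => // l.
exact: itv_gt0.
Qed.

Section Upper.
Variables (gamma q C0 : R).
Hypothesis gamma_gt1 : 1 < gamma.
Hypothesis q_ge0 : 0 <= q.
Hypothesis C0_gt0 : 0 < C0.

Lemma rate_ge0 k mu : 0 < mu -> 0 <= rate k gamma q mu.
Proof.
move=> mu0; rewrite /rate; case: ifP => _; first by rewrite exprn_ge0// ltW.
by case: ifP => _; rewrite mulr_ge0 ?powR_ge0// exprn_ge0// ltW.
Qed.

(** Below [mu] the weight is simply bounded by 1, which leaves [1 / l]; its decay matters only above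
    [mu]. *)
Lemma weight_integral_split k e mu B1 B2 : 0 < mu ->
  (\int[e]_(l in `]0%R, mu]%classic) ((l^-1) ^+ 1)%:E <= B1)%E ->
  (\int[e]_(l in `]mu, M]%classic) (weight k mu l / l)%:E <= B2)%E ->
  (\int[e]_(l in `]0%R, M]%classic) (weight k mu l / l)%:E <= B1 + B2)%E.
Proof.
move=> mu0 H1 H2; pose D : set R := `]0%R, mu]%classic `|` `]mu, M]%classic.
have D0 l : D l -> 0 < l.
  by move=> [/(itv_gt0 (lexx 0))|/(itv_gt0 (ltW mu0))].
have mD : measurable D by exact: measurableU.
have mwD : measurable_fun D (fun l => (weight k mu l / l)%:E).
  by apply/measurable_EFinP; exact: measurable_weight_div.
apply: (@le_trans _ _ (\int[e]_(l in D) (weight k mu l / l)%:E)%E).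
  apply: ge0_subset_integral => //.
  - by move=> l /D0; exact: weight_div_ge0.
  - move=> l /=; rewrite in_itv/= => /andP[l0 lM]; rewrite /D/= !in_itv/= l0 lM.
    by case: (leP l mu); [left|right].
rewrite ge0_integral_setU//; last 2 first.
- by move=> l /D0; exact: weight_div_ge0.
- apply/disj_set2P; apply/seteqP; split=> l //= [].
  by rewrite !in_itv/= => /andP[_ lm] /andP[]; rewrite ltNge lm.
apply: leeD; last exact: H2.
apply: le_trans H1; apply: ge0_le_integral => //.
- by move=> l /(itv_gt0 (lexx 0)); exact: weight_div_ge0.
- exact: mweight.
- exact: minv.
- move=> l /(itv_gt0 (lexx 0)) l0; rewrite lee_fin expr1 ler_piMl ?invr_ge0 ?(ltW l0)//.
  by rewrite weight_le1// ltW.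
Qed.

Lemma weight_integral_le k : exists2 C, 0 < C & forall e mu,
  spectral_exponents_ge C0 e gamma q -> 0 < mu ->
  (\int[e]_(l in `]0%R, M]%classic) (weight k mu l / l)%:E <=
   (C * rate k gamma q mu)%:E)%E.
Proof.
have k0 := weight_cst_gt0 R k.
have g1 : 1%:R < gamma by [].
have [CA CA0 HA] := integral_inv_pow_le q_ge0 C0_gt0 g1.
(* When [gamma > 2 k + 1], no splitting at [mu] is needed: [weight_le_pow] extracts [mu^(2 k)], and
   the remaining [(1 / l)^(2 k + 1)] is integrable down to 0. *)
have [kg|gk] := ltP (2 * k + 1)%:R gamma.
  have rateE mu : rate k gamma q mu = mu ^+ (2 * k) by rewrite /rate kg.
  have [C C_0 HC] := integral_inv_pow_le q_ge0 C0_gt0 kg.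
  set K := M `^ (gamma - (2 * k + 1)%:R) * lnp M^-1 `^ q.
  have K0 : 0 < K by rewrite mulr_gt0 ?powR_gt0 ?lnp_gt0.
  exists (weight_cst R k * (C * K)); first exact: mulr_gt0 k0 (mulr_gt0 C_0 K0).
  move=> e mu eC0 mu0; rewrite rateE.
  have c0 : 0 <= weight_cst R k * mu ^+ (2 * k).
    by rewrite mulr_ge0 ?(ltW k0)// exprn_ge0// ltW.
  apply: (@le_trans _ _ (\int[e]_(l in `]0%R, M]%classic)
     ((weight_cst R k * mu ^+ (2 * k))%:E * ((l^-1) ^+ (2 * k + 1))%:E))%E).
    apply: ge0_le_integral => //.
    - by move=> l /(itv_gt0 (lexx 0)); exact: weight_div_ge0.
    - exact: mweight.
    - by apply: measurable_funeM; exact: minv.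
    - move=> l /(itv_gt0 (lexx 0)) l0; rewrite -EFinM lee_fin addn1 exprSr mulrA.
      apply: ler_wpM2r; first by rewrite invr_ge0 ltW.
      by rewrite -mulrA -exprMn weight_le_pow.
  rewrite ge0_integralZl//; [|exact: minv|].
    apply: (@le_trans _ _ ((weight_cst R k * mu ^+ (2 * k))%:E * (C * K)%:E)%E).
      by apply: lee_wpmul2l; [rewrite lee_fin|exact: HC].
    by rewrite -EFinM lee_fin mulrAC.
  by move=> l /(itv_gt0 (lexx 0)) l0; rewrite lee_fin exprn_ge0// invr_ge0 ltW.
have [gE|gn] := eqVneq gamma (2 * k + 1)%:R.
  have rateE mu : rate k gamma q mu = mu ^+ (2 * k) * lnp mu^-1 `^ (1 + q).
    by rewrite /rate ltNge gk/= gE eqxx.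
  pose cst1 : R := (ln M + 1) / ln 2 + 1.
  have lM0 : 0 <= ln M by exact: ln_ge0.
  have cst10 : 0 < cst1.
    by rewrite ltr_wpDl// divr_ge0 ?addr_ge0// ltW// ln2_gt0.
  pose K := C0 * (weight_cst R k * 2 `^ gamma * cst1).
  have K0 : 0 < K by rewrite !mulr_gt0// powR_gt0.
  exists (CA + K); first by rewrite addr_gt0.
  move=> e mu eC0 mu0; set L := lnp mu^-1; rewrite rateE -/L.
  have L1 : 1 <= L by exact: lnp_ge1.
  (* [N] exceeds every [n] with [2^n mu <= M]. With ratio 1 all these scales contribute equally, and
     [N <= cst1 * L] is the source of the extra logarithm. *)
  pose N := (Num.truncn (ln (M / mu) / ln 2)).+1.
  have NL : N%:R <= cst1 * L.
    rewrite /N -natr1 /cst1 mulrDl mul1r lerD//.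
    apply: (@le_trans _ _ ((ln M + L) / ln 2)); last first.
      rewrite mulrAC ler_pM2r ?invr_gt0 ?ln2_gt0//; nra.
    have y0 : 0 <= (ln M + L) / ln 2.
      by rewrite divr_ge0 ?addr_ge0 ?(ltW (ln2_gt0 R))// (le_trans ler01).
    apply: (@le_trans _ _ (Num.truncn ((ln M + L) / ln 2))%:R).
      rewrite ler_nat; apply: le_truncn.
      rewrite ler_pM2r ?invr_gt0 ?ln2_gt0// lnM ?posrE ?invr_gt0// lerD2l.
      by rewrite /L /lnp le_max lexx.
    by rewrite truncn_le.
  have ratio1 : 2 `^ (gamma - 1) * 2^-1 ^+ (2 * k) = 1 :> R.
    by rewrite gE natrD addrK powR_mulrn// -exprMn divff ?expr1n// pnatr_eq0.
  have H2 : (\int[e]_(l in `]mu, M]%classic) (weight k mu l / l)%:E <=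
     (C0 * (weight_cst R k * 2 `^ gamma * (cst1 * L) *
       (mu `^ (gamma - 1) * L `^ q)))%:E)%E.
    apply: (@integral_weight_above_le _ gamma q C0 M q_ge0 C0_gt0 k (fun n => (n < N)%N)) => //.
      move=> n nM; have nx : n%:R <= ln (M / mu) / ln 2.
        rewrite ler_pdivlMr ?ln2_gt0// mulr_natl -lnXn//.
        by rewrite ler_ln ?posrE ?exprn_gt0 ?divr_gt0// ler_pdivlMr.
      by rewrite /N ltnS truncn_ge_nat// (le_trans _ nx).
    move=> n; rewrite ratio1; apply: le_trans NL.
    under eq_bigr do rewrite expr1n.
    have -> : \sum_(i < n | (i < N)%N) 1 = (minn n N)%:R :> R.
      elim: n => [|n ih]; first by rewrite big_ord0 min0n.
      rewrite big_mkcond big_ord_recr/= -big_mkcond/= ih.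
      case: ltnP => nN; last first.
        by rewrite addr0 (minn_idPr (leqW nN)).
      by rewrite (minn_idPl nN) natr1.
    by rewrite ler_nat geq_minr.
  apply: le_trans (weight_integral_split mu0 (HA e eC0 mu mu0) H2) _.
  have -> : mu `^ (gamma - 1) = mu ^+ (2 * k).
    by rewrite gE natrD addrK powR_mulrn// ltW.
  have -> : L `^ (1 + q) = L * L `^ q.
    rewrite powRD; last by apply/implyP => _; rewrite gt_eqF// (lt_le_trans ltr01).
    by rewrite powRr1// (le_trans ler01).
  rewrite -EFinD lee_fin.
  have Lq0 : 0 <= L `^ q by exact: powR_ge0.
  have m0 : 0 <= mu ^+ (2 * k) by rewrite exprn_ge0// ltW.
  have mL : mu ^+ (2 * k) * L `^ q <= mu ^+ (2 * k) * (L * L `^ q).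
    by rewrite ler_wpM2l// ler_peMl.
  rewrite [leRHS]mulrDl; apply: lerD; first by rewrite ler_wpM2l ?(ltW CA0).
  by rewrite /K le_eqVlt; apply/orP; left; apply/eqP; ring.
have {gn} gk' : gamma < (2 * k + 1)%:R by rewrite lt_neqAle gn.
have rateE mu : rate k gamma q mu = mu `^ (gamma - 1) * lnp mu^-1 `^ q.
  by rewrite /rate ltNge gk/= lt_eqF.
pose r : R := 2 `^ (gamma - 1) * 2^-1 ^+ (2 * k).
have r0 : 0 <= r by rewrite mulr_ge0 ?powR_ge0// exprn_ge0// invr_ge0.
have r1 : r < 1.
  rewrite /r exprVn ltr_pdivrMr ?exprn_gt0// mul1r -powR_mulrn//.
  rewrite /powR pnatr_eq0/= ltr_expR ltr_pM2r ?ln2_gt0//.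
  by rewrite ltrBlDr; move: gk'; rewrite natrD.
have r01 : 0 <= r < 1 by rewrite r0.
pose K := C0 * (weight_cst R k * 2 `^ gamma * (1 - r)^-1).
have K0 : 0 < K by rewrite !mulr_gt0 ?powR_gt0// invr_gt0 subr_gt0.
exists (CA + K); first by rewrite addr_gt0.
move=> e mu eC0 mu0; rewrite rateE mulrDl.
have H2 := @integral_weight_above_le _ gamma q C0 M q_ge0 C0_gt0 k predT e mu (1 - r)^-1
  eC0 mu0 (fun _ _ => isT) (fun n => geom_sum_le n r01).
apply: le_trans (weight_integral_split mu0 (HA e eC0 mu mu0) H2) _.
rewrite -EFinD lee_fin; apply: lerD => //.
by rewrite /K le_eqVlt; apply/orP; left; apply/eqP; ring.
Qed.

(* The weight decreases in [k] and the rate is the same for all large [k], so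
   finitely many constants suffice. *)
Lemma weight_integral_le_unif : exists2 C, 0 < C & forall e mu k,
  spectral_exponents_ge C0 e gamma q -> 0 < mu ->
  (\int[e]_(l in `]0%R, M]%classic) (weight k mu l / l)%:E <=
   (C * rate k gamma q mu)%:E)%E.
Proof.
have bound k : exists c, 0 < c /\ forall e mu,
    spectral_exponents_ge C0 e gamma q -> 0 < mu ->
    (\int[e]_(l in `]0%R, M]%classic) (weight k mu l / l)%:E <=
     (c * rate k gamma q mu)%:E)%E.
  by have [C C_0 HC] := weight_integral_le k; exists C.
have [c cP] := choice bound.
pose k1 := Num.truncn gamma.
have small k : (k1 <= k)%N -> gamma < (2 * k + 1)%:R.
  move=> kk; apply: lt_le_trans (truncnS_gt gamma) _.
  by rewrite ler_nat -/k1; lia.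
pose C := \sum_(k < k1.+1) c k.
have cC k : (k <= k1)%N -> c k <= C.
  rewrite -ltnS => kk; rewrite /C (bigD1 (Ordinal kk))//= lerDl.
  by apply: sumr_ge0 => i _; have [/ltW] := cP i.
exists C; first by apply: lt_le_trans (cC 0%N _) => //; have [] := cP 0%N.
move=> e mu k eC0 mu0.
have [kk|kk] := leqP k k1.
  have [_ /(_ e mu eC0 mu0) H] := cP k; apply: le_trans H _.
  by rewrite lee_fin ler_wpM2r ?rate_ge0// cC.
have [_ /(_ e mu eC0 mu0) H] := cP k1.
have -> : rate k gamma q mu = rate k1 gamma q mu.
  rewrite /rate; have g1 := small k1 (leqnn _); have gk := small k (ltnW kk).
  by rewrite !ltNge (ltW g1) (ltW gk)/= !lt_eqF.
apply: (@le_trans _ _ (c k1 * rate k1 gamma q mu)%:E); last first.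
  by rewrite lee_fin ler_wpM2r ?rate_ge0// cC.
apply: le_trans H; apply: ge0_le_integral => //.
- by move=> l /(itv_gt0 (lexx 0)); exact: weight_div_ge0.
- exact: mweight.
- exact: mweight.
- move=> l /(itv_gt0 (lexx 0)) l0; rewrite lee_fin ler_wpM2r ?invr_ge0 ?(ltW l0)//.
  by rewrite weight_nincr ?(ltW l0)// ltnW.
Qed.

End Upper.

(** * Lower bounds by restricting the spectral integral to an interval *)

Section Lower.
Variable e : {measure set R -> \bar R}.
Hypothesis e_above : e `]M, +oo[%classic = 0%E.
Hypothesis e_atom0 : e [set 0%R] = 0%E.

Let measure_itv_cc (b : R) : 0 < b ->
  (e `[0%R, b]%classic <= e (`]0%R, b]%classic `&` `]0%R, M]%classic))%E.
Proof.
move=> b0; set D := _ `&` _.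
have mD : measurable D by exact: measurableI.
apply: (@le_trans _ _ (e ([set 0%R] `|` (`]M, +oo[%classic `|` D)))).
  apply: le_measure; rewrite ?inE//.
    by apply: measurableU => //; exact: measurableU.
  move=> l /=; rewrite !in_itv/= !andbT => /andP[l0 lb].
  move: l0; rewrite le_eqVlt => /predU1P[<-|l0]; first by left.
  by right; rewrite /D/= !in_itv/= l0 lb/=; case: (ltP M l); [left|right].
have mT : measurable (`]M, +oo[%classic : set R) by [].
have h1 := measureU2 e (measurable_set1 (0 : R)) (measurableU _ _ mT mD).
have h2 := measureU2 e mT mD.
move: h1 h2; rewrite [X in (_ <= X + _)%E]e_atom0 [X in (_ -> _ <= X + _ -> _)%E]e_above !add0e.
exact: le_trans.
Qed.

Let weight_integral_ge (k : nat) (mu b c : R) : 0 < mu -> 0 < b -> 0 <= c ->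
  (forall l, 0 < l -> l <= b -> l <= M -> c <= weight k mu l / l) ->
  (c%:E * e `[0%R, b]%classic <=
   \int[e]_(l in `]0%R, M]%classic) (weight k mu l / l)%:E)%E.
Proof.
move=> mu0 b0 c0 H; pose D : set R := `]0%R, b]%classic `&` `]0%R, M]%classic.
have mD : measurable D by exact: measurableI.
apply: (@le_trans _ _ (c%:E * e D)%E).
  by apply: lee_wpmul2l; [rewrite lee_fin|exact: measure_itv_cc].
rewrite -integral_cst//.
apply: (@le_trans _ _ (\int[e]_(l in D) (weight k mu l / l)%:E)%E); last first.
  apply: ge0_subset_integral => //; first exact: mweight.
    by move=> l /(itv_gt0 (lexx 0)); exact: weight_div_ge0.
  exact: subIsetr.
apply: ge0_le_integral => //.
- apply: measurable_funS (mweight k mu0 (lexx 0)); first by [].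
  exact: subIsetr.
- move=> l []; rewrite /= !in_itv/= => /andP[l0 lb] /andP[_ lM].
  by rewrite lee_fin H.
Qed.

(** On []0, mu]] one has [l / mu <= 1], so [weight_ge_exp] leaves at least [exp (- 4)]. *)
Lemma weight_integral_ge_mass k mu : 0 < mu ->
  ((expR (-4) / mu)%:E * e `[0%R, mu]%classic <=
   \int[e]_(l in `]0%R, M]%classic) (weight k mu l / l)%:E)%E.
Proof.
move=> mu0; apply: weight_integral_ge => //.
  by rewrite divr_ge0 ?expR_ge0 ?ltW.
move=> l l0 lmu _; apply: ler_pM; rewrite ?expR_ge0 ?invr_ge0 ?(ltW mu0)//.
  apply: le_trans (weight_ge_exp k mu0 (ltW l0)).
  rewrite ler_expR lerN2 -[leRHS]mulr1 ler_wpM2l//.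
  by rewrite ler_pdivrMr// mul1r.
by rewrite lef_pV2 ?posrE.
Qed.

(** On the whole interval []0, M]] the factor [exp (- 4 l) / l] is at least its value at [M]. *)
Lemma weight_integral_ge_pow k mu : 0 < mu <= 1 ->
  ((mu ^+ (2 * k) * (expR (- (4 * M)) / M))%:E * e `[0%R, M]%classic <=
   \int[e]_(l in `]0%R, M]%classic) (weight k mu l / l)%:E)%E.
Proof.
move=> mu01; have /andP[mu0 _] := mu01; apply: weight_integral_ge => //.
  by rewrite mulr_ge0 ?divr_ge0 ?expR_ge0 ?exprn_ge0 ?ltW.
move=> l l0 lM _; rewrite mulrA; apply: ler_pM; rewrite ?invr_ge0 ?(ltW M_gt0)//.
- by rewrite mulr_ge0 ?expR_ge0 ?exprn_ge0 ?ltW.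
- apply: le_trans (weight_ge_pow k mu01 (ltW l0)).
  by rewrite ler_wpM2l ?exprn_ge0 ?(ltW mu0)// ler_expR lerN2 ler_wpM2l.
- by rewrite lef_pV2 ?posrE.
Qed.

End Lower.

End WeightIntegral.

(** * The homogenization error *)

Section HomogenizationError.
Variables (R : realType) (d : nat) (alpha beta : R) (nu : probability R R)
  (P : probability (env R d) R).
Hypothesis iid : iid_law alpha beta nu P.
Hypothesis alpha_gt0 : 0 < alpha.

Local Notation M := (genL_bound d beta).

(** Centering by the mean of [nu] cancels in each difference of conductances, and centered
    conductances of distinct edges are orthogonal. The edges [(0, i)] and [(- e_i, i)] are all
    distinct, so only the diagonal terms survive, two for each [i]. *)
Lemma drift_sqr_mean (xi : 'cV[R]_d) :
  (Ex P (fun w => drift xi w ^+ 2))%:E = ((2 * dot xi xi)%:E * 'V_nu[idfun])%E.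
Proof.
have id2 : sqint nu (fun x : R => x).
  apply: (@sqint_bounded_ae _ _ _ _ _ beta) => //.
  exists (~` `[alpha, beta]%classic); split.
  - exact: measurableC.
  - by rewrite probability_setC// iid.1 subee.
  - move=> x /=; apply: contra_not; rewrite in_itv/= => /andP[ax xb].
    by rewrite ger0_norm// (le_trans _ ax)// ltW.
pose m := Ex nu (fun x => x); pose z (x : R) := x - m.
have z2 : sqint nu z by apply: sqintB => //; exact: sqint_cst.
have z0 : Ex nu z = 0.
  rewrite /z ExB ?Ex_cst ?subrr//; first exact: sqint_itg.
  exact: itg_cst.
have -> : ('V_nu[idfun] = (Ex nu (fun x => z x ^+ 2))%:E)%E.
  rewrite -expectationE; last exact: sqint_sqr.
  rewrite /variance unlock; congr expectation; apply/funext => x /=.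
  rewrite expectationE; last exact: sqint_itg.
  by rewrite expr2.
set v := Ex nu (fun x => z x ^+ 2); rewrite -EFinM; congr _%:E.
pose Z b (w : env R d) : R := z (w b).
have Z2 b : sqint P (Z b).
  exact: (preserving_sqint (@measurable_env_coord R d b) (iid_coord iid b) z2).
have ZZ b b' : Ex P (fun w => Z b w * Z b' w) = (b == b')%:R * v.
  have [<-|bb'] := eqVneq b b'.
    rewrite mul1r /v.
    rewrite -(preserving_Ex (@measurable_env_coord R d b) (iid_coord iid b) z2.2).
    by apply: eq_Ex => w; rewrite expr2.
  by rewrite (iid_coord_indep iid)// z0 mul0r mul0r.
pose t i w := Z (0, i) w - Z (- basis_vec i, i) w.
have t2 i : sqint P (t i) by exact: sqintB.
have e0 i j : ((0, i) : edge d) == (- basis_vec j, j) = false.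
  apply/negP => /eqP[/(congr1 (fun u : lattice d => u j 0))].
  by rewrite !mxE !eqxx.
have tt i j : Ex P (fun w => t i w * t j w) = (i == j)%:R * (2 * v).
  have -> : Ex P (fun w => t i w * t j w) =
      Ex P (fun w => Z (0, i) w * Z (0, j) w)
      - Ex P (fun w => Z (0, i) w * Z (- basis_vec j, j) w)
      - Ex P (fun w => Z (- basis_vec i, i) w * Z (0, j) w)
      + Ex P (fun w => Z (- basis_vec i, i) w * Z (- basis_vec j, j) w).
    have iZ b b' : itg P (fun w => Z b w * Z b' w) by exact: itgM.
    rewrite -(ExB (iZ _ _) (iZ _ _)) -(ExB (itgB (iZ _ _) (iZ _ _)) (iZ _ _)).
    rewrite -(ExD (itgB (itgB (iZ _ _) (iZ _ _)) (iZ _ _)) (iZ _ _)).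
    by apply: eq_Ex => w; rewrite /t; ring.
  rewrite !ZZ e0 [(- basis_vec i, i) == (0, j)]eq_sym e0 !xpair_eqE eqxx/=.
  have -> : (- basis_vec i == - basis_vec j :> lattice d) && (i == j) = (i == j).
    by have [->|] := eqVneq i j; rewrite ?eqxx ?andbF.
  by ring.
have driftE w : drift xi w = \sum_i xi i 0 * t i w.
  by apply: eq_bigr => i _; rewrite /t /Z /z; ring.
under eq_Ex do rewrite driftE expr2 mulr_suml.
have x2 i : sqint P (fun w => xi i 0 * t i w) by exact: sqintZ.
rewrite Ex_sum; last by move=> i; apply: itgM => //; exact: sqint_sum.
have -> : 2 * dot xi xi * v = \sum_i xi i 0 * xi i 0 * (2 * v).
  rewrite /dot mxE -mulr_suml; under eq_bigr do rewrite mxE.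
  by ring.
apply: eq_bigr => i _.
under eq_Ex do rewrite mulr_sumr.
rewrite Ex_sum; last by move=> j; exact: itgM.
rewrite (bigD1 i)//= big1 ?addr0; last first.
  move=> j ji.
  rewrite (@eq_Ex _ _ _ P _ (fun w => xi i 0 * xi j 0 * (t i w * t j w))); last first.
    by move=> w; ring.
  by rewrite ExZ ?tt 1?eq_sym ?(negbTE ji) ?mul0r ?mulr0//; exact: itgM.
rewrite (@eq_Ex _ _ _ P _ (fun w => xi i 0 * xi i 0 * (t i w * t i w))); last first.
  by move=> w; ring.
by rewrite ExZ ?tt ?eqxx ?mul1r//; exact: itgM.
Qed.

Variables (Ahom Amuk : 'M[R]_d) (mu : R) (k : nat) (xi : 'cV[R]_d)
  (e : {measure set R -> \bar R}) (i0 : 'I_d).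
Hypothesis AhomP : is_Ahom P Ahom.
Hypothesis mu_gt0 : 0 < mu.
Hypothesis AmukP : is_Amuk P k mu Amuk.
Hypothesis eP : spectral_measure P (drift xi) e.

Lemma drift_atom0 : e [set 0%R] = 0%E.
Proof.
have [_ /(_ xi) [phi [phiP energyE]]] := AhomP.
apply: (spectral_atom0 iid alpha_gt0 (sqint_drift iid alpha_gt0 xi) eP
  (corrector_vsqint iid alpha_gt0 phiP energyE)).
by move=> u u2; exact: (corrector_drift iid alpha_gt0 phiP energyE).
Qed.

Lemma quadB (A B : 'M[R]_d) : quad (A - B) xi = quad A xi - quad B xi.
Proof. by rewrite /quad /dot mulmxBl mulmxBr !mxE. Qed.

Let M_gt0 : 0 < M.
Proof. by rewrite (lt_le_trans ltr01)// genL_bound_ge1. Qed.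

(** Both quadratic forms are [E(xi . A xi)] minus a spectral integral: of [1 / l] for [Ahom] by
    [spectral_invE], of [P_k / D_k] for [Amuk]. [Ppoly_div] gives the difference of the
    integrands. *)
Lemma homogenization_errorE : (quad (Amuk - Ahom) xi)%:E =
  (\int[e]_(l in `]0%R, M]%classic) (weight k mu l / l)%:E)%E.
Proof.
have [_ /(_ xi) [phi [phiP energyE]]] := AhomP.
have dr2 := sqint_drift iid alpha_gt0 xi.
have invE := spectral_invE iid alpha_gt0 dr2 eP
  (corrector_vsqint iid alpha_gt0 phiP energyE)
  (fun u => corrector_drift iid alpha_gt0 phiP energyE (u := u))
  (fun n => sqint_corrector_primitive iid alpha_gt0 phiP energyE i0 n)
  (corrector_potential_cvg iid alpha_gt0 phiP energyE i0).
have AhomE := corrector_energy_split iid alpha_gt0 phiP energyE i0.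
set b := eform P _ _ in invE AhomE; set x := eform P _ _ in AhomE.
have Ex0 : ('E_P[fun w => quad (Amx 0 w) xi] = x%:E)%E.
  have X2 := vsqint_cst P xi.
  have qE : (fun w => quad (Amx 0 w) xi) =
      (fun w : env R d => \sum_i w (0, i) * (xi i 0 * xi i 0)).
    by apply/funext => w; rewrite quad_AmxE.
  have it i := itg_form iid alpha_gt0 i X2 X2.
  by rewrite qE expectationE ?Ex_sum//; exact: itg_sum.
have [_ /(_ xi e eP)] := AmukP; rewrite Ex0.
pose f l : R := (Ppoly k mu).[l] / (Dpoly k mu).[l].
have cf l : 0 <= l -> {for l, continuous f}.
  move=> l0; apply: cvgM; first exact: continuous_horner.
  apply: (@continuous_comp _ _ _ (horner (Dpoly k mu)) GRing.inv).
    exact: continuous_horner.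
  by apply: inv_continuous; rewrite gt_eqF// Dpoly_gt0.
have mf (D : set R) : measurable D -> (forall l, D l -> 0 <= l) ->
    measurable_fun D (EFin \o f).
  move=> mD D0; apply/measurable_EFinP.
  by apply: measurable_fun_continuous_in => // l /D0; exact: cf.
have oc0 l : `]0%R, M]%classic l -> 0 < l by rewrite /= in_itv/= => /andP[].
(* The half-line reduces to []0, M]]: the origin carries no atom and nothing lies beyond [M]. *)
have -> : (\int[e]_(l in `[0%R, +oo[%classic) ((Ppoly k mu).[l] / (Dpoly k mu).[l])%:E
    = \int[e]_(l in `]0%R, M]%classic) (f l)%:E)%E.
  pose N : set R := [set 0%R] `|` `]M, +oo[%classic.
  have mN : measurable N by exact: measurableU.
  have N0 l : N l -> 0 <= l.
    move=> [->//|/=]; rewrite in_itv/= andbT => Ml.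
    by rewrite ltW// (lt_trans M_gt0).
  have eN : e N = 0%E.
    have mT : measurable (`]M, +oo[%classic : set R) by [].
    apply/eqP; rewrite eq_le measure_ge0 andbT.
    apply: le_trans (measureU2 e (measurable_set1 (0 : R)) mT) _.
    by rewrite [X in (X + _)%E]drift_atom0 add0e [leLHS](spectral_above iid alpha_gt0 dr2 eP).
  have -> : `[0%R, +oo[%classic = N `|` `]0%R, M]%classic.
    apply/seteqP; split=> l; rewrite /N /= !in_itv/= !andbT.
      rewrite le_eqVlt => /predU1P[<-|l0]; first by left; left.
      by rewrite l0/=; case: (ltP M l); [left; right|right].
    move=> [[->//|Ml]|/andP[/ltW//]].
    by rewrite ltW// (lt_trans M_gt0).
  rewrite integral_setU//.
  - by rewrite null_set_integral ?add0e//; exact: mf.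
  - by apply: mf; [exact: measurableU|move=> l [/N0//|/oc0/ltW]].
  - apply/disj_set2P; apply/seteqP; split=> l //.
    rewrite /N /= !in_itv/= !andbT => -[[->|Ml] /andP[]]; first by rewrite ltxx.
    by move=> _; rewrite leNgt Ml.
have mw : measurable_fun `]0%R, M]%classic (fun l => (weight k mu l / l)%:E).
  by apply/measurable_EFinP; apply: measurable_weight_div => // l /oc0.
have w0 l : `]0%R, M]%classic l -> (0 <= (weight k mu l / l)%:E)%E.
  by move=> /oc0 l0; rewrite lee_fin divr_ge0 ?weight_ge0// ltW.
have fE l : `]0%R, M]%classic l -> f l = l^-1 - weight k mu l / l.
  by move=> /oc0 l0; rewrite /f Ppoly_div.
have f0 l : `]0%R, M]%classic l -> (0 <= (f l)%:E)%E.
  move=> lM; have l0 := oc0 _ lM; rewrite lee_fin fE// -[X in X - _]mul1r -mulrBl.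
  by rewrite mulr_ge0 ?invr_ge0 ?(ltW l0)// subr_ge0 weight_le1// ltW.
have : (\int[e]_(l in `]0%R, M]%classic) (l^-1)%:E =
   \int[e]_(l in `]0%R, M]%classic) (f l)%:E +
   \int[e]_(l in `]0%R, M]%classic) (weight k mu l / l)%:E)%E.
  rewrite -ge0_integralD//; last by apply: mf => // l /oc0/ltW.
  by apply: eq_integral => l; rewrite inE => lM; rewrite -EFinD fE// subrK.
rewrite invE quadB AhomE.
have i1 : (0 <= \int[e]_(l in `]0%R, M]%classic) (f l)%:E)%E by exact: integral_ge0.
have i2 : (0 <= \int[e]_(l in `]0%R, M]%classic) (weight k mu l / l)%:E)%E.
  exact: integral_ge0.
move: i1 i2; set I1 := integral _ _ _; set I2 := integral _ _ _.
(* Both integrals are nonnegative with a real sum, so infinite values are excluded. *)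
case: I1 => [r1| |]; case: I2 => [r2| |] //= _ _ [bE] [aE].
by congr _%:E; rewrite aE bE; ring.
Qed.

End HomogenizationError.

Lemma norm2_eq1 (R : realType) (d : nat) (xi : 'cV[R]_d) :
  norm2 xi = 1 -> dot xi xi = 1.
Proof.
rewrite /norm2 => H.
have d0 : 0 <= dot xi xi.
  by rewrite /dot mxE sumr_ge0// => i _; rewrite mxE -expr2 sqr_ge0.
by rewrite -(sqr_sqrtr d0) H expr1n.
Qed.

Theorem theorem4 (R : realType) (d : nat) (alpha beta : R)
    (hd : (2 <= d)%N) (halpha : 0 < alpha) (hbeta : alpha <= beta) :
  (forall gamma q C0 : R, 1 < gamma -> 0 <= q -> 0 < C0 ->
   exists2 C : R, 0 < C &
   forall (nu : probability R R) (P : probability (env R d) R)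
          (Ahom Amuk : 'M[R]_d) (mu : R) (k : nat) (xi : 'cV[R]_d)
          (e : {measure set R -> \bar R}),
     iid_law alpha beta nu P -> is_Ahom P Ahom ->
     0 < mu -> (1 <= k)%N -> is_Amuk P k mu Amuk ->
     norm2 xi = 1 -> spectral_measure P (drift xi) e ->
     spectral_exponents_ge C0 e gamma q ->
     0 <= quad (Amuk - Ahom) xi <= C * rate k gamma q mu)
  /\
  (forall v : R, 0 < v ->
   exists2 c : R, 0 < c &
   forall (nu : probability R R) (P : probability (env R d) R)
          (Ahom Amuk : 'M[R]_d) (mu : R) (k : nat) (xi : 'cV[R]_d)
          (e : {measure set R -> \bar R}),
     iid_law alpha beta nu P -> (v%:E <= 'V_nu[idfun])%E -> is_Ahom P Ahom ->
     0 < mu <= 1 -> (1 <= k)%N -> is_Amuk P k mu Amuk ->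
     norm2 xi = 1 -> spectral_measure P (drift xi) e ->
     c * (mu ^+ (2 * k) + mu^-1 * fine (e `[0, mu]%classic)) <=
       quad (Amuk - Ahom) xi).
Proof.
pose M := genL_bound d beta.
have M1 : 1 <= M by exact: genL_bound_ge1.
have M0 : 0 < M by exact: lt_le_trans M1.
(* The direction of the lines along which the corrector is averaged. *)
have i0 : 'I_d by exists 0%N; exact: leq_trans hd.
split=> [gamma q C0 gamma1 q0 C00|v v0].
  have [C C_0 HC] := weight_integral_le_unif M1 gamma1 q0 C00.
  exists C => // nu P Ahom Amuk mu k xi e iid AhomP mu0 _ AmukP _ eP eC0.
  have E := homogenization_errorE iid halpha i0 AhomP mu0 AmukP eP.
  rewrite -!lee_fin E HC// andbT; apply: integral_ge0 => l /=.
  rewrite in_itv/= => /andP[l0 _].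
  by rewrite lee_fin divr_ge0 ?weight_ge0// ltW.
(* The exponentials come from the two weight bounds, and [2 v] bounds the mass of [e] from below.
   Each constant is half of what its bound gives: the error is at least both [2 * c1 * B] and
   [2 * c2 * A] for the terms [A], [B] named below, hence at least their mean. *)
pose c1 : R := expR (-4) / 2; pose c2 : R := expR (- (4 * M)) / M * v.
have c10 : 0 < c1 by rewrite divr_gt0 ?expR_gt0.
have c20 : 0 < c2 by rewrite !mulr_gt0 ?invr_gt0 ?expR_gt0.
exists (Num.min c1 c2); first by rewrite lt_min c10 c20.
move=> nu P Ahom Amuk mu k xi e iid hv AhomP mu01 _ AmukP xi1 eP.
have /andP[mu0 mu1] := mu01.
have E := homogenization_errorE iid halpha i0 AhomP mu0 AmukP eP.
have dr2 := sqint_drift iid halpha xi.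
have above := spectral_above iid halpha dr2 eP.
have atom0 := drift_atom0 iid halpha AhomP eP.
have mass := spectral_mass iid halpha dr2 eP.
have L1 := weight_integral_ge_mass above atom0 k mu0.
have L2 := weight_integral_ge_pow M1 above atom0 k mu01.
rewrite -E in L1; rewrite -E in L2.
set Q := quad _ _ in L1 L2 *.
have mass_ge : 2 * v <= Ex P (fun w => drift xi w ^+ 2).
  rewrite -lee_fin (drift_sqr_mean iid halpha) norm2_eq1// mulr1 EFinM.
  by apply: lee_wpmul2l => //; rewrite lee_fin.
(* Otherwise [L1] would bound a real number from below by infinity; finiteness is what allows
   passing to [fine]. *)
have emu : (e `[0%R, mu]%classic) \is a fin_num.
  rewrite ge0_fin_numE//; apply: contraTT L1; rewrite -leNgt leye_eq => /eqP ->.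
  by rewrite gt0_muley ?lte_fin ?divr_gt0 ?expR_gt0// -ltNge ltry.
have {}L1 : 2 * c1 * (mu^-1 * fine (e `[0%R, mu]%classic)) <= Q.
  move: L1; rewrite -(fineK emu) -EFinM lee_fin; congr (_ <= _).
  by rewrite /c1; field; rewrite gt_eqF.
have {}L2 : 2 * c2 * mu ^+ (2 * k) <= Q.
  move: L2; rewrite mass -EFinM lee_fin; apply: le_trans.
  rewrite (_ : 2 * c2 * _ = mu ^+ (2 * k) * (expR (- (4 * M)) / M) * (2 * v)); last first.
    by rewrite /c2; ring.
  by rewrite ler_wpM2l// mulr_ge0 ?divr_ge0 ?expR_ge0 ?exprn_ge0 ?(ltW mu0) ?(ltW M0).
set A := mu ^+ _ in L2 *; set B := mu^-1 * _ in L1 *.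
have A0 : 0 <= A by rewrite exprn_ge0// ltW.
have B0 : 0 <= B by rewrite mulr_ge0 ?invr_ge0 ?(ltW mu0)// fine_ge0.
have m1 : Num.min c1 c2 <= c1 by rewrite ge_min lexx.
have m2 : Num.min c1 c2 <= c2 by rewrite ge_min lexx orbT.
have := ler_wpM2r A0 m2; have := ler_wpM2r B0 m1; lra.
Qed.
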